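(* Let $Q_0$ be a finite alphabet. (1) For every growing computable sequence $w\in\mathbb{W}(Q_0)$ there exists a cellular automaton $\mathcal{A}$ over an alphabet $Q\supseteq Q_0$ such that for every fully supported Bernoulli measure $\mu$ on $Q^{\mathbb{Z}}$, $L_\mu(\mathcal{A})=L_w$. (2) For all growing computable sequences $w,w'\in\mathbb{W}(Q_0)$ there exists a cellular automaton $\mathcal{A}$ over an alphabet $Q\supseteq Q_0$ such that for every fully supported Bernoulli measure $\mu$ on $Q^{\mathbb{Z}}$, $L_\mu(\mathcal{A})=L_w\cup L_{w'}$ and $C_\mu(\mathcal{A})=L_{w'}$.
   Context: A cellular automaton (CA) $\mathcal{A}$ over finite alphabet $Q$ has radius $r$ and local rule $\delta:Q^{2r+1}\to Q$; global map $\mathcal{A}(c)_z=\delta(c_{z-r},\dots,c_{z+r})$. For a word $u$, $[u]_0=\{c:c_{[0,|u|-1]}=u\}$ and $\mathcal{A}^t\mu([u]_0)=\mu(\mathcal{A}^{-t}([u]_0))$. Persistent set: $L_\mu(\mathcal{A})=\{u\in Q^*:\lim_t\mathcal{A}^t\mu([u]_0)=0 \text{ fails}\}$. Cesaro-persistent set: $C_\mu(\mathcal{A})=\{u\in Q^*: \lim_{n}\frac1n\sum_{k\le n}\mathcal{A}^k\mu([u]_0)=0\text{ fails}\}$. A Bernoulli measure satisfies $\mu([u]_i)=\prod_q\mu([q]_0)^{|u|_q}$; fully supported means all coefficients positive. For words $u,v$ with $|u|<|v|$, $|v|_u$ is the number of positions $i$ with $v_{[i,i+|u|-1]}=u$,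 and $d_v(u)=|v|_u/(|v|-|u|)$. A growing computable sequence over $Q_0$ is a sequence $(w_i)_{i\in\mathbb{N}}$ of finite words over $Q_0$ with $|w_i|\to\infty$ such that some Turing machine computes $w_i$ from $i$; $\mathbb{W}(Q_0)$ is the set of these. For such $w$, $L_w=\{u\in Q_0^*: d_{w_i}(u)\not\to 0 \text{ as } i\to\infty\}$. *)

(* Defs.v *)
From HB Require Import structures.
From mathcomp Require Import all_boot all_order all_algebra.
From mathcomp Require Import all_classical all_reals topology normedtype sequences.
Set Implicit Arguments. Unset Strict Implicit. Unset Printing Implicit Defensive.
Import Order.TTheory GRing.Theory Num.Theory numFieldNormedType.Exports.
Local Open Scope ring_scope.
Local Open Scope classical_set_scope.

(* Computability: Kleene's partial recursive functions (equivalent to  *)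
(* Turing machines).  Untyped syntax, arguments given as a list.       *)
Inductive prf : Type :=
| PZero : prf
| PSucc : prf
| PProj : nat -> prf
| PComp : prf -> seq prf -> prf
| PRec  : prf -> prf -> prf
| PMin  : prf -> prf.

Inductive prf_eval : prf -> seq nat -> nat -> Prop :=
| ev_zero xs : prf_eval PZero xs 0
| ev_succ x xs : prf_eval PSucc (x :: xs) x.+1
| ev_proj i xs : (i < size xs)%N -> prf_eval (PProj i) xs (nth 0%N xs i)
| ev_comp f gs xs ys y :
    prf_evals gs xs ys -> prf_eval f ys y -> prf_eval (PComp f gs) xs y
| ev_rec0 g h xs y : prf_eval g xs y -> prf_eval (PRec g h) (0%N :: xs) y
| ev_recS g h n xs z y :
    prf_eval (PRec g h) (n :: xs) z -> prf_eval h (n :: z :: xs) y ->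
    prf_eval (PRec g h) (n.+1 :: xs) y
| ev_min f xs n :
    prf_eval f (n :: xs) 0%N ->
    (forall m, (m < n)%N -> exists k, prf_eval f (m :: xs) k.+1) ->
    prf_eval (PMin f) xs n
with prf_evals : seq prf -> seq nat -> seq nat -> Prop :=
| evs_nil xs : prf_evals [::] xs [::]
| evs_cons g gs xs y ys :
    prf_eval g xs y -> prf_evals gs xs ys -> prf_evals (g :: gs) xs (y :: ys).

(* Injective (computable) coding of words over a finite alphabet by naturals:
   bijective base (#|Q0|+1) numeration with digits enum_rank q + 1. *)
Definition word_code (Q0 : finType) (s : seq Q0) : nat :=
  foldr (fun q acc => ((enum_rank q).+1 + #|Q0|.+1 * acc)%N) 0%N s.

Definition computable_seq (Q0 : finType) (w : nat -> seq Q0) : Prop :=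
  exists f : prf, forall i, prf_eval f [:: i] (word_code (w i)).

Definition growing (Q0 : finType) (w : nat -> seq Q0) : Prop :=
  forall N, exists M, forall i, (M <= i)%N -> (N <= size (w i))%N.

Definition growing_computable (Q0 : finType) (w : nat -> seq Q0) : Prop :=
  growing w /\ computable_seq w.

Definition occ (Q0 : eqType) (v u : seq Q0) : nat :=
  count (fun i => take (size u) (drop i v) == u) (iota 0 (size v - size u).+1).

(* d_v(u) = |v|_u / (|v| - |u|)  (only meaningful when |u| < |v|) *)
Definition dens (R : realType) (Q0 : eqType) (v u : seq Q0) : R :=
  (occ v u)%:R / (size v - size u)%:R.

Definition Lw (R : realType) (Q0 : finType) (w : nat -> seq Q0) (u : seq Q0) : Prop :=
  ~ ((fun i => dens R (w i) u) @ \oo --> (0 : R)).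

Record ca (Q : finType) := Ca {
  radius : nat;
  rule : (radius.*2.+1).-tuple Q -> Q }.
Arguments radius {Q}.
Arguments rule {Q}.

Definition ca_img (Q : finType) (A : ca Q) (v : seq Q) : seq Q :=
  match v with
  | [::] => [::]
  | x :: _ =>
      [seq rule A [tuple nth x v (i + j) | j < (radius A).*2.+1]
      | i <- iota 0 (size v - (radius A).*2)]
  end.

(* Fully supported Bernoulli measure on Q^Z, given by its one-letter
   weights p q = mu([q]_0). *)
Definition full_bernoulli (R : realType) (Q : finType) (p : Q -> R) : Prop :=
  (forall q, 0 < p q) /\ \sum_(q : Q) p q = 1.

(* A^t mu([u]_0) = mu(A^{-t}([u]_0)) : the preimage is the union of the
   cylinders [v]_{-rt} with |v| = |u| + 2rt and F^t(v) = u, hence its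
   Bernoulli measure is the following finite sum. *)
Definition ca_push (R : realType) (Q : finType) (A : ca Q) (p : Q -> R)
    (t : nat) (u : seq Q) : R :=
  \sum_(v : (size u + (radius A).*2 * t).-tuple Q | iter t (ca_img A) v == u)
     \prod_(q <- v) p q.

Definition persistent (R : realType) (Q : finType) (A : ca Q) (p : Q -> R)
    (u : seq Q) : Prop :=
  ~ ((fun t => ca_push A p t u) @ \oo --> (0 : R)).

Definition cesaro_persistent (R : realType) (Q : finType) (A : ca Q) (p : Q -> R)
    (u : seq Q) : Prop :=
  ~ ((fun n => (\sum_(1 <= k < n.+1) ca_push A p k u) / n%:R) @ \oo --> (0 : R)).

(* Main.v *)
(* A partial recursive function is compiled to a counter program with an output queue, and
   the automaton has two layers: letters of [Q0] that move right at speed one, and agents. An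
   agent is a base cell followed by zone cells; the zone stores the digits of a binary clock,
   the counters in unary and the queue. Each carry out of the clock lengthens the zone by one
   cell, from [e - 1] to [e] at age about [2 ^ e.-1], and this starts the computation with
   input [e] of a word [w (i e)], where [i] grows slowly; the word then rotates in the queue
   and its letters are emitted, so that to the right of an agent the letter layer is periodic
   with a period read from [w (i e)]. The same epoch contains a second computation, of
   [w' (i' e)], which replaces the first word after [2 ^ half_up e] steps. Hence [w] is shown
   only during a vanishing proportion of the time, and [w'] alone matters in the Cesaro mean.

   At age about [2 ^ s] an agent can only be alive if its base was followed initially by about
   [sqrt (2 * s)] zone cells carrying a mark that is never created later: the program tests
   this, and the base dies if the test fails. Conversely such an initial pattern followed by a
   gap, with no rival nearby, keeps an agent alive up to that age; one is found within
   [2 ^ o(s)] cells to the left of a window with probability tending to 1, whereas an initial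
   zone of length proportional to [s] is exponentially rare in [s]. So with probability
   tending to 1 the letters in a window of length about [s ^ 2] were emitted by one agent of
   nearly the common age, no cell of an agent occurs there, and the probability of a word is
   asymptotically its frequency in the periodic repetition of the word shown at that age. *)
Require Import Defs.
From HB Require Import structures.
From mathcomp Require Import all_boot all_order all_algebra.
From mathcomp Require Import zify ring lra.
From mathcomp Require Import all_classical all_reals topology normedtype sequences.
From Stdlib Require Import FunctionalExtensionality.
Set Implicit Arguments. Unset Strict Implicit. Unset Printing Implicit Defensive.

(** * Counter programs and compilation of partial recursive functions *)

(** The order sqrt(2 * s) of the test leaves no room for a crude estimate. The search for a survivor
    must cover about [D ^ (L + 2)] cells, with [L = tri_root (s + 2)] and [D] of the order of an
    inverse weight, while the bases able to pass the test have a density bounded by [theta] to a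
    power of the same order [L]. A union bound over the search range is therefore useless; it is
    applied only to the polynomially many places in or near the window. Farther away a long-lived
    base does no harm unless its clock is close to a reset, and by translation invariance a given
    base has such a clock at polynomially many distances only. Space-time is described along the
    paths of the carries: [(d, m)] stands for distance [d] at half-step [2 * m + d]. What happens
    there reaches the base at half-step [2 * (m + d)], so being alive at [n] controls all
    [m + d < n], and survival is an induction on [n]. The running time of the given machine is
    unknown. The input [e] serves as its fuel, which bounds time and registers together; the index
    of the word grows by at most one per epoch, so no word is skipped. *)

Section Program.
Variable T : Type.

Definition upd (rho : nat -> nat) r v : nat -> nat :=
  fun x => if x == r then v else rho x.

Inductive instr :=
| IInc of nat & nat
| IDec of nat & nat
| IJz of nat & nat & nat
| IPush of T & nat
| ITest of nat
| IShow of bool.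

Definition state := (nat * (nat -> nat) * seq T)%type.

(** Outside the program the default [IShow false] applies, which keeps address and registers and
    rotates the queue: halting and displaying are the same thing. [ITest] is a mere jump here; its
    lethal effect exists only in the automaton. *)
Definition step (prog : seq instr) (s : state) : state :=
  let: (pc, rho, q) := s in
  match nth (IShow false) prog pc with
  | IInc r n => (n, upd rho r (rho r).+1, q)
  | IDec r n => (n, upd rho r (rho r).-1, q)
  | IJz r z nz => (if rho r == 0 then z else nz, rho, q)
  | IPush a n => (n, rho, a :: q)
  | ITest n => (n, rho, q)
  | IShow _ => (pc, rho, rot 1 q)
  end.

Definition bounded (B : pred nat) (s : state) := (forall r, B (s.1.2 r)) /\ B (size s.2).

Definition plain i := match i with ITest _ | IShow _ => false | _ => true end.

Definition at_pc prog (s : state) := nth (IShow false) prog s.1.1.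

(** [B] will be [v <= e], so that registers and queue fit into the zone. [plain] guarantees that no
    test is made and no flag is armed before the stated end. *)
Definition runs prog B n s s' :=
  [/\ iter n (step prog) s = s',
      forall i, i <= n -> bounded B (iter i (step prog) s) &
      forall i, i < n -> plain (at_pc prog (iter i (step prog) s))].

Definition code_at (prog : seq instr) k code :=
  forall i, i < size code -> nth (IShow false) prog (k + i) = nth (IShow false) code i.

Lemma code_at_cat prog k c1 c2 :
  code_at prog k (c1 ++ c2) -> code_at prog k c1 /\ code_at prog (k + size c1) c2.
Proof.
move=> H; split=> i Hi.
  by rewrite H ?size_cat ?nth_cat ?Hi //; lia.
rewrite -addnA H ?size_cat ?nth_cat; last by lia.
by rewrite ifF ?addKn //; lia.
Qed.

Lemma code_at_cons prog k x c :
  code_at prog k (x :: c) -> nth (IShow false) prog k = x /\ code_at prog k.+1 c.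
Proof.
move=> H; split; first by have := H 0 isT; rewrite addn0.
by move=> i Hi; have := H i.+1 Hi; rewrite addnS -addSn.
Qed.

Lemma runs0 prog B s : bounded B s -> runs prog B 0 s s.
Proof. by move=> H; split=> // -[]. Qed.

Lemma runsS prog B n s s' : plain (at_pc prog s) ->
  bounded B s -> runs prog B n (step prog s) s' -> runs prog B n.+1 s s'.
Proof.
move=> Hp Hs [E H H']; split; first by rewrite iterSr.
  by case=> [|i] Hi //; rewrite iterSr; apply: H.
by case=> [|i] Hi //; rewrite iterSr; apply: H'.
Qed.

Lemma runs_trans prog B n1 n2 s1 s2 s3 :
  runs prog B n1 s1 s2 -> runs prog B n2 s2 s3 -> runs prog B (n1 + n2) s1 s3.
Proof.
move=> [E1 H1 H1'] [E2 H2 H2']; split; first by rewrite addnC iterD E1.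
  move=> i Hi; case: (leqP i n1) => Hin; first exact: H1.
  have -> : i = (i - n1) + n1 by lia.
  by rewrite iterD E1; apply: H2; lia.
move=> i Hi; case: (ltnP i n1) => Hin; first exact: H1'.
have -> : i = (i - n1) + n1 by lia.
by rewrite iterD E1; apply: H2'; lia.
Qed.

Lemma runs_bounded_r prog B n s s' : runs prog B n s s' -> bounded B s'.
Proof. by case=> <- H _; apply: H. Qed.

Inductive cmd :=
| CSkip
| CInc of nat
| CDec of nat
| CPush of T
| CSeq of cmd & cmd
| CIf of nat & cmd & cmd
| CWhile of nat & cmd.

Variable B : pred nat.

Inductive exec : cmd -> (nat -> nat) -> seq T -> nat -> (nat -> nat) -> seq T -> Prop :=
| ex_skip rho q : exec CSkip rho q 0 rho q
| ex_inc r rho q : B (rho r).+1 -> exec (CInc r) rho q 1 (upd rho r (rho r).+1) q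
| ex_dec r rho q : exec (CDec r) rho q 1 (upd rho r (rho r).-1) q
| ex_push a rho q : B (size q).+1 -> exec (CPush a) rho q 1 rho (a :: q)
| ex_seq c1 c2 rho1 q1 n1 rho2 q2 n2 rho3 q3 :
    exec c1 rho1 q1 n1 rho2 q2 -> exec c2 rho2 q2 n2 rho3 q3 ->
    exec (CSeq c1 c2) rho1 q1 (n1 + n2) rho3 q3
| ex_ifz r c1 c2 rho q n rho' q' : rho r = 0 -> exec c2 rho q n rho' q' ->
    exec (CIf r c1 c2) rho q n.+1 rho' q'
| ex_ifnz r c1 c2 rho q n rho' q' : rho r <> 0 -> exec c1 rho q n rho' q' ->
    exec (CIf r c1 c2) rho q n.+2 rho' q'
| ex_whz r c rho q : rho r = 0 -> exec (CWhile r c) rho q 1 rho q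
| ex_whnz r c rho1 q1 n1 rho2 q2 n2 rho3 q3 : rho1 r <> 0 ->
    exec c rho1 q1 n1 rho2 q2 -> exec (CWhile r c) rho2 q2 n2 rho3 q3 ->
    exec (CWhile r c) rho1 q1 (n1 + n2).+2 rho3 q3.

Fixpoint csize c :=
  match c with
  | CSkip => 0
  | CInc _ | CDec _ | CPush _ => 1
  | CSeq c1 c2 => csize c1 + csize c2
  | CIf _ c1 c2 => (csize c1 + csize c2).+2
  | CWhile _ c => (csize c).+2
  end.

(** [IJz 0] with two equal targets serves as an unconditional jump. *)
Fixpoint compile c k : seq instr :=
  match c with
  | CSkip => [::]
  | CInc r => [:: IInc r k.+1]
  | CDec r => [:: IDec r k.+1]
  | CPush a => [:: IPush a k.+1]
  | CSeq c1 c2 => compile c1 k ++ compile c2 (k + csize c1)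
  | CIf r c1 c2 =>
      let e := (k + csize c1).+2 in
      IJz r e k.+1 :: compile c1 k.+1 ++ (IJz 0 (e + csize c2) (e + csize c2) :: compile c2 e)
  | CWhile r c =>
      IJz r (k + csize c).+2 k.+1 :: rcons (compile c k.+1) (IJz 0 k k)
  end.

Lemma size_compile c k : size (compile c k) = csize c.
Proof.
elim: c k => //= [c1 IH1 c2 IH2|r c1 IH1 c2 IH2|r c IH] k.
- by rewrite size_cat IH1 IH2.
- by rewrite size_cat /= IH1 IH2 addnS.
- by rewrite size_rcons IH.
Qed.

Lemma if_same_jump b (k : nat) : (if b then k else k) = k.
Proof. by case: b. Qed.

Hypothesis B_pred : forall v, B v -> B v.-1.

Lemma bounded_upd pc pc' rho q r v : bounded B (pc, rho, q) -> B v ->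
  bounded B (pc', upd rho r v, q).
Proof. by case=> H1 H2 Hv; split=> //= x; rewrite /upd; case: eqP. Qed.

Lemma compile_runs prog c k rho q n rho' q' :
  code_at prog k (compile c k) -> exec c rho q n rho' q' -> bounded B (k, rho, q) ->
  runs prog B n (k, rho, q) (k + csize c, rho', q').
Proof.
move=> Hc He; elim: He k Hc => {c rho q n rho' q'}.
- by move=> rho q k _ H /=; rewrite addn0; apply: runs0.
- move=> r rho q Hr k /code_at_cons[/= E _] H.
  by rewrite addn1; apply: runsS; rewrite /at_pc //= E //; apply: runs0; apply: bounded_upd H _.
- move=> r rho q k /code_at_cons[/= E _] H.
  rewrite addn1; apply: runsS; rewrite /at_pc //= E //; apply: runs0; apply: (bounded_upd _ _ H).
  by apply: B_pred; case: H.
- move=> a rho q Hr k /code_at_cons[/= E _] [H1 H2].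
  by rewrite addn1; apply: runsS; rewrite /at_pc //= E //; apply: runs0; split.
- move=> c1 c2 rho1 q1 n1 rho2 q2 n2 rho3 q3 _ IH1 _ IH2 k /= /code_at_cat[H1].
  rewrite size_compile => H2 H; have R1 := IH1 _ H1 H.
  apply: (runs_trans R1); rewrite addnA; apply: IH2 => //.
  by have [] := runs_bounded_r R1.
- move=> r c1 c2 rho q n rho' q' H0 _ IH k /= /code_at_cons[Hj] /code_at_cat[_].
  rewrite size_compile => /code_at_cons[_ H2] H.
  apply: runsS; rewrite /at_pc //= Hj // H0 eqxx.
  have E : (k.+1 + csize c1).+1 = (k + csize c1).+2 by lia.
  rewrite E in H2; have := IH _ H2 H.
  by rewrite (_ : _ + csize c2 = k + (csize c1 + csize c2).+2) //; lia.
- move=> r c1 c2 rho q n rho' q' /eqP H0 _ IH k /= /code_at_cons[Hj] /code_at_cat[H1].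
  rewrite size_compile => /code_at_cons[H2 _] H.
  apply: runsS; rewrite /at_pc //= Hj // (negbTE H0).
  have R1 := IH _ H1 H; rewrite -addn1; apply: (runs_trans R1).
  apply: runsS; [by rewrite /at_pc /= H2|exact: (runs_bounded_r R1)|].
  rewrite /= H2 if_same_jump (_ : k + (csize c1 + csize c2).+2 = (k + csize c1).+2 + csize c2); last by lia.
  by apply: runs0; have [] := runs_bounded_r R1.
- move=> r c rho q H0 k /= /code_at_cons[E _] H.
  apply: runsS; rewrite /at_pc //= E // H0 eqxx (_ : k + (csize c).+2 = (k + csize c).+2); last by lia.
  exact: runs0.
- move=> r c rho1 q1 n1 rho2 q2 n2 rho3 q3 /eqP H0 _ IH1 _ IH2 k Hc H.
  have := Hc; move=> /= /code_at_cons[Hj]; rewrite -cats1 => /code_at_cat[H1].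
  rewrite size_compile => /code_at_cons[H2 _].
  apply: runsS; rewrite /at_pc //= Hj // (negbTE H0).
  have R1 := IH1 _ H1 H; rewrite -addnS; apply: (runs_trans R1).
  apply: runsS; [by rewrite /at_pc /= H2|exact: (runs_bounded_r R1)|].
  by rewrite /= H2 if_same_jump; apply: IH2 => //; have [] := runs_bounded_r R1.
Qed.

End Program.

Ltac upd_tac :=
  apply: functional_extensionality => ?; rewrite /upd;
  repeat (case: eqP => ? //; subst => //); try lia; try congruence.

Ltac upds := rewrite /upd; repeat (case: eqP => ?; try lia).

(** * Recursive functions as structured counter programs *)

Section PrfCompile.
Variable T : Type.
Implicit Types (rho : nat -> nat) (q : seq T).

Lemma updE rho r v : upd rho r v r = v.
Proof. by rewrite /upd eqxx. Qed.

Lemma upd_ne rho r v x : x != r -> upd rho r v x = rho x.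
Proof. by rewrite /upd => /negbTE->. Qed.

Lemma upd_id rho r : upd rho r (rho r) = rho.
Proof. by upd_tac. Qed.

Lemma upd_upd rho r v w : upd (upd rho r v) r w = upd rho r w.
Proof. by upd_tac. Qed.

Definition cclear a : cmd T := CWhile a (CDec _ a).
Definition cmove a b : cmd T := CWhile a (CSeq (CDec _ a) (CInc _ b)).
Definition ccopy a b t : cmd T :=
  CSeq (CWhile a (CSeq (CDec _ a) (CSeq (CInc _ b) (CInc _ t)))) (cmove t a).

Section Basic.
Variable B : pred nat.
Lemma exec_clear a rho q : exec B (cclear a) rho q (3 * rho a).+1 (upd rho a 0) q.
Proof.
move E : (rho a) => n; elim: n rho E => [|n IH] rho E.
  by rewrite muln0 -{2}E upd_id; apply: ex_whz.
have -> : (3 * n.+1).+1 = (1 + (3 * n).+1).+2 by lia.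
apply: ex_whnz; first by rewrite E.
  exact: ex_dec.
by have := IH (upd rho a (rho a).-1); rewrite updE E upd_upd; apply.
Qed.

Lemma exec_move a b rho q : a != b -> (forall v, v <= rho b + rho a -> B v) ->
  exec B (cmove a b) rho q (4 * rho a).+1 (upd (upd rho a 0) b (rho b + rho a)) q.
Proof.
move=> /eqP ab; move E : (rho a) => n; elim: n rho E => [|n IH] rho E HB.
  have -> : upd (upd rho a 0) b (rho b + 0) = rho by upd_tac.
  by rewrite muln0; apply: ex_whz.
have -> : (4 * n.+1).+1 = ((1 + 1) + (4 * n).+1).+2 by lia.
apply: ex_whnz; first by rewrite E.
  by apply: ex_seq; [exact: ex_dec|apply: ex_inc; apply: HB; upds].
set rho2 := upd _ b _.
have := IH rho2; rewrite {1}/rho2.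
have -> : upd (upd rho2 a 0) b (rho2 b + n) = upd (upd rho a 0) b (rho b + n.+1).
  by rewrite /rho2; upd_tac.
apply; first by upds.
by move=> v Hv; apply: HB; move: Hv; rewrite /rho2; upds.
Qed.

Lemma exec_copy a b t rho q : a != b -> a != t -> b != t -> rho t = 0 ->
  (forall v, v <= rho b + rho a -> B v) ->
  exec B (ccopy a b t) rho q (9 * rho a).+2 (upd rho b (rho b + rho a)) q.
Proof.
move=> /eqP ab /eqP at_ /eqP bt t0 HB.
have -> : (9 * rho a).+2 = (5 * rho a).+1 + (4 * rho a).+1 by lia.
have H : forall rho q, (forall v, v <= rho b + rho a -> B v) ->
    (forall v, v <= rho t + rho a -> B v) ->
    exec B (CWhile a (CSeq (CDec _ a) (CSeq (CInc _ b) (CInc _ t))))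
    rho q (5 * rho a).+1 (upd (upd (upd rho a 0) b (rho b + rho a)) t (rho t + rho a)) q.
  move=> {t0 HB} {}rho {}q; move E : (rho a) => n; elim: n rho E => [|n IH] rho E HB1 HB2.
    have -> : upd (upd (upd rho a 0) b (rho b + 0)) t (rho t + 0) = rho by upd_tac.
    by rewrite muln0; apply: ex_whz.
  have -> : (5 * n.+1).+1 = ((1 + (1 + 1)) + (5 * n).+1).+2 by lia.
  apply: ex_whnz; first by rewrite E.
    apply: ex_seq; first exact: ex_dec.
    by apply: ex_seq; apply: ex_inc; [apply: HB1|apply: HB2]; upds.
  set rho2 := upd _ t _.
  have := IH rho2.
  have -> : upd (upd (upd rho2 a 0) b (rho2 b + n)) t (rho2 t + n)
    = upd (upd (upd rho a 0) b (rho b + n.+1)) t (rho t + n.+1).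
    by rewrite /rho2; upd_tac.
  apply; first by rewrite /rho2; upds.
    by move=> v Hv; apply: HB1; move: Hv; rewrite /rho2; upds.
  by move=> v Hv; apply: HB2; move: Hv; rewrite /rho2; upds.
apply: ex_seq; first by apply: H => // v Hv; apply: HB; lia.
set rho2 := upd _ t _.
have := @exec_move t a rho2 q.
have -> : upd (upd rho2 t 0) a (rho2 a + rho2 t) = upd rho b (rho b + rho a).
  by rewrite /rho2; upd_tac.
have -> : rho2 t = rho a by rewrite /rho2 updE t0.
apply; first by apply/eqP; lia.
by move=> v Hv; apply: HB; move: Hv; rewrite /rho2; upds.
Qed.

End Basic.

Notation exec := (@exec T xpredT).

Fixpoint cseqs (cs : seq (cmd T)) : cmd T :=
  if cs is c :: cs' then CSeq c (cseqs cs') else CSkip T.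

(** Calling convention: [args] hold the inputs, [out] is 0 on entry, and the registers from [fr] on
    are scratch space found and left at 0, so that calls can be nested and repeated in loops. *)
Fixpoint prf_cmd (g : prf) (args : seq nat) (out fr : nat) {struct g} : cmd T :=
  match g with
  | PZero => CSkip T
  | PSucc => CSeq (ccopy (nth 0 args 0) out fr) (CInc _ out)
  | PProj i => ccopy (nth 0 args i) out fr
  | PComp f gs =>
      let n := size gs in
      let fix go gs i :=
        if gs is g :: gs' then CSeq (prf_cmd g args (fr + i) (fr + n)) (go gs' i.+1)
        else CSkip T in
      CSeq (go gs 0) (CSeq (prf_cmd f (iota fr n) out (fr + n))
        (cseqs (map cclear (iota fr n))))
  | PRec g h =>
      let a0 := nth 0 args 0 in let rest := behead args in
      let cnt := fr in let idx := fr.+1 in let acc := fr.+2 in let tmp := fr.+3 in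
      let fr' := fr.+4 in
      CSeq (prf_cmd g rest acc fr') (CSeq (ccopy a0 cnt fr')
      (CSeq (CWhile cnt (CSeq (CDec _ cnt) (CSeq (prf_cmd h (idx :: acc :: rest) tmp fr')
         (CSeq (cclear acc) (CSeq (cmove tmp acc) (CInc _ idx))))))
      (CSeq (cmove acc out) (cclear idx))))
  | PMin f =>
      let idx := fr in let val := fr.+1 in let fr' := fr.+2 in
      CSeq (prf_cmd f (idx :: args) val fr')
      (CSeq (CWhile val (CSeq (cclear val) (CSeq (CInc _ idx) (prf_cmd f (idx :: args) val fr'))))
        (cmove idx out))
  end.

Definition computes g := forall xs y, prf_eval g xs y ->
  forall args out fr rho q, map rho args = xs -> all (fun a => a < fr) args ->
    out < fr -> out \notin args -> rho out = 0 -> (forall r, fr <= r -> rho r = 0) ->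
    exists n, exec (prf_cmd g args out fr) rho q n (upd rho out y) q.

(** The arguments of [PComp] form a list, hence the inner fixpoint that carries the hypothesis to
    its members. *)
Fixpoint prf_nested_ind (P : prf -> Prop)
  (H0 : P PZero) (H1 : P PSucc) (H2 : forall i, P (PProj i))
  (H3 : forall f gs, P f -> List.Forall P gs -> P (PComp f gs))
  (H4 : forall g h, P g -> P h -> P (PRec g h)) (H5 : forall f, P f -> P (PMin f))
  (g : prf) {struct g} : P g :=
  let rec := prf_nested_ind H0 H1 H2 H3 H4 H5 in
  match g with
  | PZero => H0
  | PSucc => H1
  | PProj i => H2 i
  | PComp f gs => H3 f gs (rec f)
      ((fix go gs : List.Forall P gs :=
        match gs with
        | [::] => List.Forall_nil P
        | g :: gs' => List.Forall_cons g (rec g) (go gs')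
        end) gs)
  | PRec g h => H4 g h (rec g) (rec h)
  | PMin f => H5 f (rec f)
  end.

Lemma map_upd_notin rho r v args : r \notin args -> map (upd rho r v) args = map rho args.
Proof.
move=> H; apply/eq_in_map => x Hx; apply: upd_ne; apply/eqP => E.
by move: H; rewrite -E Hx.
Qed.

Lemma notin_ge args fr r : all (fun a => a < fr) args -> fr <= r -> r \notin args.
Proof. by move=> /allP H Hr; apply/negP => /H; lia. Qed.

Lemma all_lt_le args fr fr' : all (fun a => a < fr) args -> fr <= fr' ->
  all (fun a => a < fr') args.
Proof. by move=> /allP H ?; apply/allP => x /H; lia. Qed.

Lemma exec_clears k fr rho q :
  exists n, exec (cseqs (map cclear (iota fr k))) rho q n
    (fun r => if (fr <= r) && (r < fr + k) then 0 else rho r) q.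
Proof.
elim: k fr rho => [|k IH] fr rho.
  exists 0; have -> : (fun r => if (fr <= r) && (r < fr + 0) then 0 else rho r) = rho.
    by apply: functional_extensionality => r; rewrite ifF //; lia.
  exact: ex_skip.
have [n Hn] := IH fr.+1 (upd rho fr 0).
have E : (fun r => if (fr < r) && (r < fr.+1 + k) then 0 else upd rho fr 0 r)
  = (fun r => if (fr <= r) && (r < fr + k.+1) then 0 else rho r).
  apply: functional_extensionality => r; rewrite /upd.
  case: (eqVneq r fr) => [->|Hr]; first by rewrite ltnn /= ifT //; lia.
  by congr (if _ then _ else _); lia.
rewrite E in Hn; eexists; apply: ex_seq; [exact: exec_clear|exact: Hn].
Qed.

Lemma computes_comp f gs : computes f -> List.Forall computes gs -> computes (PComp f gs).
Proof.
move=> Hf Hgs xs y He args out fr rho q Hm Ha Ho Hoa Hr0 Hfr.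
inversion He as [| | |f' gs' xs' ys y' Hes Hev E1 E2 E3| | |]; subst f' gs' xs' y' => {He}.
set N := size gs.
(* Generalised to the terms still to be computed: the [i] earlier results occupy the registers just
   below [fr + i], and the scratch space starts at [fr + N]. *)
have key : forall gs2 i rho1, List.Forall computes gs2 -> i + size gs2 = N ->
   forall ys2, prf_evals gs2 xs ys2 -> map rho1 args = xs ->
   (forall r, fr + i <= r -> rho1 r = 0) ->
   exists n, exec ((fix go gs i :=
        if gs is g :: gs' then CSeq (prf_cmd g args (fr + i) (fr + N)) (go gs' i.+1)
        else CSkip T) gs2 i) rho1 q n
     (fun r => if (fr + i <= r) then nth 0 ys2 (r - (fr + i)) else rho1 r) q /\ size ys2 = size gs2.
  elim=> [|g gs2 IH] i rho1 HF Hi ys2 He2 Hm1 Hz.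
    inversion He2; exists 0; split=> //.
    rewrite (_ : (fun r => _) = rho1); first exact: ex_skip.
    apply: functional_extensionality => r; case: ifP => // Hr; first by rewrite nth_nil Hz.
  inversion He2 as [|g' gs' xs' z zs Hz1 Hzs E1 E2 E3]; subst.
  inversion HF as [|g' l Hg HF']; subst.
  move: Hi => /= Hi.
  have ni : fr + i \notin args by apply: (notin_ge Ha); lia.
  have [|||||n1 Hn1] := Hg _ _ Hz1 args (fr + i) (fr + N) rho1 q Hm1.
  - by apply: (all_lt_le Ha); lia.
  - by lia.
  - exact: ni.
  - by apply: Hz; lia.
  - by move=> r Hr; apply: Hz; lia.
  have [|||n2 [Hn2 Hsz]] := IH i.+1 (upd rho1 (fr + i) z) HF' _ _ Hzs.
  - by lia.
  - by rewrite map_upd_notin.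
  - by move=> r Hr; rewrite upd_ne; [apply: Hz|apply/eqP]; lia.
  exists (n1 + n2); split; last by rewrite /= Hsz.
  apply: (ex_seq Hn1); rewrite (_ : (fun r => _) = 
    (fun r => if fr + i.+1 <= r then nth 0 zs (r - (fr + i.+1)) else upd rho1 (fr + i) z r)) //.
  apply: functional_extensionality => r; rewrite /upd.
  case: (eqVneq r (fr + i)) => [->|Hr]; first by rewrite leqnn subnn /= ifF //; lia.
  case: (leqP (fr + i) r) => Hr2; last by rewrite ifF //; lia.
  have -> : r - (fr + i) = (r - (fr + i.+1)).+1 by lia.
  by rewrite /= ifT //; lia.
have [n1 [Hn1 Hsz]] := key gs 0 rho Hgs (erefl _) ys Hes Hm ltac:(by move=> r; rewrite addn0; apply: Hfr).
move: Hn1; set rho1 := (fun r : nat => if fr + 0 <= r then _ else _) => Hn1.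
have [||||||n2 Hn2] := Hf _ _ Hev (iota fr N) out (fr + N) rho1 q.
- apply: (@eq_from_nth _ 0); rewrite size_map size_iota // => i Hi.
  rewrite (nth_map 0) ?size_iota // nth_iota // /rho1 ifT; last by lia.
  by congr (nth 0 ys _); lia.
- by apply/allP => x; rewrite mem_iota; lia.
- by lia.
- by rewrite mem_iota; lia.
- by rewrite /rho1 ifF //; lia.
- by move=> r Hr; rewrite /rho1 ifT; [apply: nth_default|]; lia.
have [n3 Hn3] := exec_clears N fr (upd rho1 out y) q.
exists (n1 + (n2 + n3)); apply: (ex_seq Hn1); apply: (ex_seq Hn2).
rewrite (_ : upd rho out y = (fun r => if (fr <= r) && (r < fr + N) then 0 else upd rho1 out y r)) //.
apply: functional_extensionality => r; rewrite /upd /rho1.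
case: (eqVneq r out) => [->|_]; first by rewrite ifF //; lia.
case: (leqP fr r) => Hr; last by rewrite ifF //; lia.
case: ifP => Hr2; first by rewrite Hfr.
rewrite ifT; last by lia.
by rewrite nth_default ?Hfr //; lia.
Qed.

Lemma computes_rec g h : computes g -> computes h -> computes (PRec g h).
Proof.
move=> Hg Hh xs y He args out fr rho q Hm Ha Ho Hoa Hr0 Hfr.
case: args Hm Ha Hoa => [|a rest] Hm Ha Hoa; first by rewrite -Hm in He; inversion He.
move: Hm => /= Hm; rewrite -Hm in He.
move: Ha => /= /andP[Ha Hrest].
(* values of the recursion at 0, .., rho a *)
have [F [F0 FS Fy]] : exists F : nat -> nat, [/\ prf_eval g (map rho rest) (F 0),
    forall i, i < rho a -> prf_eval h (i :: F i :: map rho rest) (F i.+1) & F (rho a) = y].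
  move: He; move: (rho a) => n; elim: n y => [|n IH] z He; inversion He; subst.
    by exists (fun=> z); split.
  match goal with H : prf_eval (PRec g h) (n :: _) _ |- _ => have [F [F0 FS Fy]] := IH _ H end.
  exists (fun i => if i == n.+1 then z else F i); split => //=.
    move=> i Hi; rewrite eqSS; case: (eqVneq i n) => [->|Hin].
      by rewrite ifF ?Fy //; lia.
    by rewrite ifF; [apply: FS|]; lia.
  by rewrite eqxx.
have nin : forall r, fr <= r -> r \notin rest by move=> r; apply: notin_ge.
have [fr' Efr'] : exists f, f = fr.+4 by exists fr.+4.
have Hrest' : all (fun a => a < fr') rest by apply: (all_lt_le Hrest); lia.
have [|||||n1 Hn1] := Hg _ _ F0 rest fr.+2 fr' rho q (erefl _).
- exact: Hrest'.
- by lia.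
- by apply: nin; lia.
- by apply: Hfr; lia.
- by move=> r Hr; apply: Hfr; lia.
(* Loop invariant: the passes left, the number of the pass, and the value reached. *)
pose S i := upd (upd (upd rho fr (rho a - i)) fr.+1 i) fr.+2 (F i).
have Hn2 := @exec_copy xpredT a fr fr' (upd rho fr.+2 (F 0)) q.
have E2 : upd (upd rho fr.+2 (F 0)) fr (upd rho fr.+2 (F 0) fr + upd rho fr.+2 (F 0) a) = S 0.
  have e1 : rho fr = 0 by apply: Hfr.
  have e2 : rho fr.+1 = 0 by apply: Hfr; lia.
  rewrite /S; apply: functional_extensionality => z; rewrite /upd.
  by repeat (case: eqP => ?; subst); try lia; rewrite ?e1 ?e2; try lia.
rewrite E2 in Hn2.
have {}Hn2 : exec (ccopy a fr fr') (upd rho fr.+2 (F 0)) q (9 * upd rho fr.+2 (F 0) a).+2 (S 0) q.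
  apply: Hn2 => //; [lia|lia|lia|].
  rewrite upd_ne.
    apply: Hfr; lia. lia.
have loop : forall k i, i + k = rho a ->
  exists n, exec (CWhile fr (CSeq (CDec _ fr) (CSeq (prf_cmd h (fr.+1 :: fr.+2 :: rest) fr.+3 fr')
         (CSeq (cclear fr.+2) (CSeq (cmove fr.+3 fr.+2) (CInc _ fr.+1)))))) (S i) q n (S (rho a)) q.
  elim=> [|k IH] i Hi.
    have -> : i = rho a by lia.
    by exists 1; apply: ex_whz; rewrite /S; upds.
  have [n Hn] := IH i.+1 ltac:(lia).
  set S1 := upd (S i) fr (S i fr).-1.
  have Hev := FS i ltac:(lia).
  have Em : map S1 (fr.+1 :: fr.+2 :: rest) = i :: F i :: map rho rest.
    have -> : map S1 (fr.+1 :: fr.+2 :: rest) = S1 fr.+1 :: S1 fr.+2 :: map S1 rest by [].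
    have -> : S1 fr.+1 = i by rewrite /S1 /S; upds.
    have -> : S1 fr.+2 = F i by rewrite /S1 /S; upds.
    by rewrite /S1 /S !map_upd_notin //; apply: nin; lia.
  have [|||||n3 Hn3] := Hh _ _ Hev (fr.+1 :: fr.+2 :: rest) fr.+3 fr' S1 q Em.
  - by rewrite /= Hrest'; lia.
  - by lia.
  - by rewrite !in_cons !negb_or (nin _ _) ?andbT; lia.
  - by rewrite /S1 /S; upds; apply: Hfr; lia.
  - by move=> r Hr; rewrite /S1 /S; upds; apply: Hfr; lia.
  eexists; apply: ex_whnz.
  - by rewrite /S; upds.
  - apply: ex_seq; first exact: ex_dec.
    apply: ex_seq; first exact: Hn3.
    apply: ex_seq; first exact: exec_clear.
    apply: ex_seq; first by apply: exec_move => //; lia.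
    exact: ex_inc.
  rewrite (_ : upd _ fr.+1 _ = S i.+1); first exact: Hn.
  have e1 : rho fr.+3 = 0 by apply: Hfr; lia.
  rewrite /S1 /S; apply: functional_extensionality => z; rewrite /upd.
  by repeat (case: eqP => ?; subst); try lia; rewrite ?e1; try lia.
have [n4 Hn4] := loop (rho a) 0 (erefl _).
rewrite /= -Efr'; eexists.
apply: (ex_seq Hn1); apply: (ex_seq Hn2); apply: (ex_seq Hn4).
rewrite (_ : upd rho out y = upd (upd (upd (S (rho a)) fr.+2 0) out (S (rho a) out + S (rho a) fr.+2)) fr.+1 0).
  by apply: ex_seq; [apply: exec_move => //; lia|exact: exec_clear].
have e1 : rho fr = 0 by apply: Hfr.
have e2 : rho fr.+1 = 0 by apply: Hfr; lia.
have e3 : rho fr.+2 = 0 by apply: Hfr; lia.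
rewrite /S; apply: functional_extensionality => z; rewrite /upd.
by repeat (case: eqP => ?; subst); try lia; rewrite ?e1 ?e2 ?e3; try lia.
Qed.

Lemma computes_min f : computes f -> computes (PMin f).
Proof.
move=> Hf xs y He args out fr rho q Hm Ha Ho Hoa Hr0 Hfr.
inversion He as [| | | | | |f' xs' n' H0 Hlt]; subst f' xs' n' => {He}.
have nin : forall r, fr <= r -> r \notin args by move=> r; apply: notin_ge.
have call : forall i v, prf_eval f (i :: xs) v ->
  exists n, exec (prf_cmd f (fr :: args) fr.+1 fr.+2) (upd rho fr i) q n (upd (upd rho fr i) fr.+1 v) q.
  move=> i v Hv; apply: (Hf _ _ Hv).
  - by rewrite /= updE map_upd_notin ?Hm // nin.
  - by rewrite /= (all_lt_le Ha) //; lia.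
  - by lia.
  - by rewrite in_cons negb_or nin; lia.
  - by rewrite upd_ne; [apply: Hfr|]; lia.
  - by move=> r Hr; rewrite upd_ne; [apply: Hfr|]; lia.
have e1 : rho fr = 0 by apply: Hfr.
have e2 : rho fr.+1 = 0 by apply: Hfr; lia.
have loop : forall k i v, i + k = y -> prf_eval f (i :: xs) v -> (k = 0 -> v = 0) ->
  exists n, exec (CWhile fr.+1 (CSeq (cclear fr.+1) (CSeq (CInc _ fr) (prf_cmd f (fr :: args) fr.+1 fr.+2))))
   (upd (upd rho fr i) fr.+1 v) q n (upd rho fr y) q.
  elim=> [|k IH] i v Hi Hv Hk.
    have -> : y = i by lia.
    exists 1; rewrite Hk // (_ : upd (upd rho fr i) fr.+1 0 = upd rho fr i).
      by apply: ex_whz; rewrite upd_ne //; lia.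
    apply: functional_extensionality => z; rewrite /upd.
    by repeat (case: eqP => ?; subst); try lia; rewrite ?e2.
  case: (eqVneq v 0) => [v0|v0].
    (* impossible: values below y are successors *)
    have [w Hw] := Hlt i ltac:(lia).
    suff : v = w.+1 by lia.
    (* Determinism is read off the compiled code: both evaluations drive the same program from the
       same state to its end, where the registers no longer change. *)
    have det : forall v w, prf_eval f (i :: xs) v -> prf_eval f (i :: xs) w -> v = w.
      move=> {Hv Hw v v0 w Hk} v w Hv Hw.
      have [n1 E1] := call i v Hv.
      have [n2 E2] := call i w Hw.
      have H1 := compile_runs (B := xpredT) (fun _ _ => isT) (prog := compile (prf_cmd f (fr :: args) fr.+1 fr.+2) 0) (k := 0) (fun _ _ => erefl) E1 (conj (fun _ => isT) isT).
      have H2 := compile_runs (B := xpredT) (fun _ _ => isT) (prog := compile (prf_cmd f (fr :: args) fr.+1 fr.+2) 0) (k := 0) (fun _ _ => erefl) E2 (conj (fun _ => isT) isT).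
      case: H1 => H1 _ _; case: H2 => H2 _ _; move: H1 H2; set st := step _; set s := (0, _, _) => {}H1 {}H2.
      have abs : forall k rho q, exists q', iter k st (0 + csize (prf_cmd f (fr :: args) fr.+1 fr.+2), rho, q)
         = (0 + csize (prf_cmd f (fr :: args) fr.+1 fr.+2), rho, q').
        elim=> [|m IHm] rho1 q1; first by exists q1.
        have [q' E] := IHm rho1 q1; rewrite iterS E /st /= nth_default ?size_compile //.
        by eexists.
      case: (leqP n1 n2) => Hn.
        have [q' E] := abs (n2 - n1) (upd (upd rho fr i) fr.+1 v) q.
        move: H2; rewrite -(subnK Hn) iterD H1 E => -[] /(congr1 (fun r => r fr.+1)).
        by rewrite !updE.
      have [q' E] := abs (n1 - n2) (upd (upd rho fr i) fr.+1 w) q.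
      move: H1; rewrite -(subnK (ltnW Hn)) iterD H2 E => -[] /(congr1 (fun r => r fr.+1)).
      by rewrite !updE.
    exact: det.
  have [w [Hw Hw0]] : exists w, prf_eval f (i.+1 :: xs) w /\ (k = 0 -> w = 0).
    case: k Hi IH Hk => [|k] Hi _ _.
      by exists 0; split=> //; rewrite (_ : i.+1 = y) //; lia.
    by have [w Hw] := Hlt i.+1 ltac:(lia); exists w.+1; split.
  have [n Hn] := IH i.+1 w ltac:(lia) Hw Hw0.
  have [n' Hn'] := call _ _ Hw.
  eexists; apply: ex_whnz; last exact: Hn.
    by rewrite updE; apply/eqP.
  apply: ex_seq; first exact: exec_clear.
  apply: ex_seq; first exact: ex_inc.
  rewrite (_ : upd (upd _ fr.+1 0) fr _ = upd rho fr i.+1); first exact: Hn'.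
  apply: functional_extensionality => z; rewrite /upd.
  by repeat (case: eqP => ?; subst); try lia; rewrite ?e2.
have [v [Hv Hv0]] : exists v, prf_eval f (0 :: xs) v /\ (y = 0 -> v = 0).
  case: (posnP y) => [y0|y0]; first by exists 0; split=> //; rewrite -{1}y0.
  by have [w Hw] := Hlt 0 y0; exists w.+1; split => //; lia.
have [n1 Hn1] := call 0 v Hv.
rewrite (_ : upd rho fr 0 = rho) in Hn1; last by rewrite -e1 upd_id.
have [n2 Hn2] := loop y 0 v (erefl _) Hv Hv0.
rewrite (_ : upd rho fr 0 = rho) in Hn2; last by rewrite -e1 upd_id.
eexists; apply: (ex_seq Hn1); apply: (ex_seq Hn2).
rewrite (_ : upd rho out y = upd (upd (upd rho fr y) fr 0) out (upd rho fr y out + upd rho fr y fr)).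
  by apply: exec_move => //; lia.
apply: functional_extensionality => z; rewrite /upd.
by repeat (case: eqP => ?; subst); try lia; rewrite ?e1 ?e2; try lia.
Qed.

Lemma prf_cmdP g : computes g.
Proof.
elim/prf_nested_ind: g.
- move=> xs y He args out fr rho q _ _ _ _ H0 _; inversion He; subst.
  by exists 0; rewrite (_ : upd rho out 0 = rho); [exact: ex_skip|upd_tac].
- move=> xs y He args out fr rho q Hm Ha Ho Hoa Hr0 Hfr; rewrite -Hm in He.
  case: args {Hm} Ha Hoa He => [|a args] /= Ha Hoa He; inversion He as [|x xs' Ex1 Ey| | | | |].
  move: Ha Hoa => /andP[Ha _]; rewrite in_cons negb_or => /andP[Hoa _].
  eexists; apply: ex_seq; first by apply: exec_copy => //; [| | |apply: Hfr]; lia.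
  rewrite (_ : upd rho out (rho a).+1 = upd (upd rho out (rho out + rho a)) out (upd rho out (rho out + rho a) out).+1).
    exact: ex_inc.
  by rewrite updE upd_upd Hr0.
- move=> i xs y He args out fr rho q Hm Ha Ho Hoa Hr0 Hfr; rewrite -Hm in He.
  inversion He as [| |i' xs' Hi E1 E2| | | |].
  move: Hi; rewrite size_map => Hi.
  have Hin : nth 0 args i \in args by apply: mem_nth.
  have Hlt := allP Ha _ Hin.
  have Hne : nth 0 args i != out by apply/eqP => E; rewrite -E Hin in Hoa.
  eexists; rewrite (nth_map 0) //.
  rewrite (_ : upd rho out (rho (nth 0 args i)) = upd rho out (rho out + rho (nth 0 args i))); last by rewrite Hr0.
  by apply: exec_copy => //; [| |apply: Hfr]; lia.
- exact: computes_comp.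
- exact: computes_rec.
- exact: computes_min.
Qed.

End PrfCompile.

(** * Simulation on a budget of steps *)

Section Fuel.
Variable T : Type.
Implicit Types (rho : nat -> nat) (q : seq T) (code : seq (instr T)) (s : state T).

Definition counter_instr f (i : instr T) :=
  match i with IInc r _ | IDec r _ | IJz r _ _ => r != f | _ => false end.

Section Fuelify.
Variables (K EX f : nat) (code : seq (instr T)).

Definition reloc (i : instr T) : instr T :=
  match i with
  | IInc r n => IInc _ r (K + 3 * n)
  | IDec r n => IDec _ r (K + 3 * n)
  | IJz r z nz => IJz _ r (K + 3 * z) (K + 3 * nz)
  | _ => IShow _ false
  end.

(** Every simulated step costs one unit of fuel, and a step raises a register by at most one. With
    fuel bounded by [e], an arbitrary computation thus stays within the zone. *)
Definition fuel_block a : seq (instr T) :=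
  [:: IJz _ f EX (K + 3 * a).+1; IDec _ f (K + 3 * a).+2;
      reloc (nth (IShow _ false) code a)].

Definition fuelify n := flatten (mkseq fuel_block n).

Lemma size_fuelify n : size (fuelify n) = 3 * n.
Proof.
elim: n => // n IH; rewrite /fuelify mkseqS flatten_rcons size_cat.
by rewrite -/(fuelify _) IH /= mulnS addnC.
Qed.

Lemma nth_fuelify n a j : a < n -> j < 3 ->
  nth (IShow _ false) (fuelify n) (3 * a + j) = nth (IShow _ false) (fuel_block a) j.
Proof.
elim: n => // n IH Ha Hj.
rewrite /fuelify mkseqS flatten_rcons -/(fuelify _) nth_cat size_fuelify.
case: ltnP => H; first by apply: IH => //; lia.
have -> : a = n by lia.
by rewrite addKn.
Qed.

Variable prog : seq (instr T).
Hypothesis at_K : code_at prog K (fuelify (size code)).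
Hypothesis wf : all (counter_instr f) code.

Definition fstate F q (s : state T) : state T := (K + 3 * s.1.1, upd s.1.2 f F, q).

Lemma at_fuelify a j : a < size code -> j < 3 ->
  nth (IShow _ false) prog (K + 3 * a + j) = nth (IShow _ false) (fuel_block a) j.
Proof.
move=> Ha Hj; rewrite -addnA at_K; first exact: nth_fuelify.
by rewrite size_fuelify; lia.
Qed.

Lemma fuel_step B F q s : s.1.1 < size code ->
  (forall r, r != f -> s.1.2 r <= B /\ (step code s).1.2 r <= B) -> F.+1 <= B -> size q <= B ->
  runs prog (fun v => v <= B) 3 (fstate F.+1 q s) (fstate F q (step code s)).
Proof.
case: s => [[pc rho] q0] /= Hpc HB HF Hq.
have b1 pc' v : v <= F.+1 -> bounded (fun v => v <= B) (pc', upd rho f v, q).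
  move=> Hv; split=> //= r; rewrite /upd; case: eqP => [_|/eqP Hr]; first by lia.
  by have [] := HB r Hr.
have e0 := at_fuelify Hpc (isT : 0 < 3).
have e1 := at_fuelify Hpc (isT : 1 < 3).
have e2 := at_fuelify Hpc (isT : 2 < 3).
rewrite addn0 in e0; rewrite addn1 in e1; rewrite addn2 in e2.
have Hi : counter_instr f (nth (IShow _ false) code pc).
  by apply: (all_nthP _ wf).
rewrite /fstate /=.
apply: runsS; [by rewrite /at_pc /= e0|exact: b1|].
rewrite /= e0 /= updE /=.
apply: runsS; [by rewrite /at_pc /= e1|exact: b1|].
rewrite /= e1 /= updE /= upd_upd.
have e2' := e2; move: e2; rewrite /=.
have HB' r : r != f -> (step code (pc, rho, q0)).1.2 r <= B by move=> /HB[].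
move: HB'; rewrite /=.
case: (nth _ code pc) Hi => //= [r n|r n|r z nz] Hr HB' e2.
- apply: runsS; [by rewrite /at_pc /= e2|exact: b1|].
  rewrite /= e2 (_ : upd (upd rho f F) r _ = upd (upd rho r (rho r).+1) f F).
    apply: runs0; split=> //= x; rewrite {1}/upd; case: eqP => [|/eqP Hx]; first by lia.
    exact: HB'.
  by move/eqP: Hr => Hr; upd_tac.
- apply: runsS; [by rewrite /at_pc /= e2|exact: b1|].
  rewrite /= e2 (_ : upd (upd rho f F) r _ = upd (upd rho r (rho r).-1) f F).
    apply: runs0; split=> //= x; rewrite {1}/upd; case: eqP => [|/eqP Hx]; first by lia.
    exact: HB'.
  by move/eqP: Hr => Hr; upd_tac.
- apply: runsS; [by rewrite /at_pc /= e2|exact: b1|].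
  rewrite /= e2 upd_ne // (_ : (if _ then _ else _) = K + 3 * (if rho r == 0 then z else nz)).
    by apply: runs0; apply: b1; lia.
  by case: ifP.
Qed.

Lemma fuel_exit B q s : s.1.1 < size code ->
  (forall r, r != f -> s.1.2 r <= B) -> size q <= B ->
  runs prog (fun v => v <= B) 1 (fstate 0 q s) (EX, upd s.1.2 f 0, q).
Proof.
case: s => [[pc rho] q0] /= Hpc HB Hq.
have e0 := at_fuelify Hpc (isT : 0 < 3); rewrite addn0 in e0.
have b1 pc' : bounded (fun v => v <= B) (pc', upd rho f 0, q).
  move=> //; split=> //= r; rewrite /upd; case: eqP => [_|/eqP Hr]; first by lia.
  exact: HB.
rewrite /fstate /=; apply: runsS; [by rewrite /at_pc /= e0|exact: b1|].
by rewrite /= e0 /= updE; apply: runs0.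
Qed.

Lemma fuel_run B F q s n : n <= F -> F <= B -> size q <= B ->
  (forall i, i < n -> (iter i (step code) s).1.1 < size code) ->
  (forall i r, i <= n -> r != f -> (iter i (step code) s).1.2 r <= B) ->
  runs prog (fun v => v <= B) (3 * n) (fstate F q s) (fstate (F - n) q (iter n (step code) s)).
Proof.
elim: n s F => [|n IH] s F Hn HF Hq Hpc HB.
  rewrite muln0 subn0; apply: runs0; split=> //= r; rewrite /upd; case: eqP => // /eqP Hr.
  exact: (HB 0).
case: F Hn HF => // F Hn HF; rewrite mulnS iterSr subSS.
apply: (@runs_trans _ _ _ _ _ _ (fstate F q (step code s))).
  apply: fuel_step => //; first exact: (Hpc 0).
  by move=> r Hr; split; [apply: (HB 0)|apply: (HB 1)].
apply: IH => //; first by lia.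
  by move=> i Hi; rewrite -iterSr; apply: Hpc.
by move=> i r Hi Hr; rewrite -iterSr; apply: HB.
Qed.

End Fuelify.

Definition writes (X : pred nat) (i : instr T) :=
  match i with IInc r _ | IDec r _ | IJz r _ _ => X r | _ => true end.

Lemma iter_step_growth code s i r : (iter i (step code) s).1.2 r <= s.1.2 r + i.
Proof.
elim: i => [|i IH]; first by rewrite addn0.
rewrite iterS; case: (iter i _ s) IH => [[pc rho] q] /= IH.
by case: (nth _ code pc) => /= *; rewrite ?/upd; repeat case: eqP => ?; subst; lia.
Qed.

Lemma iter_step_frame X code s i r : all (writes X) code -> ~~ X r ->
  (iter i (step code) s).1.2 r = s.1.2 r.
Proof.
move=> Hw Hr; elim: i => // i IH; rewrite iterS -IH.
case: (iter i _ s) => [[pc rho] q] /=.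
case: (ltnP pc (size code)) => Hpc; last by rewrite nth_default.
have := all_nthP (IShow _ false) Hw pc Hpc.
by case: (nth _ code pc) => //= r' n Hr'; rewrite upd_ne //; apply: contraNneq Hr => ->.
Qed.

Definition agree (X : pred nat) s s' :=
  s.1.1 = s'.1.1 /\ forall r, X r -> s.1.2 r = s'.1.2 r.

(** Compares a run inside the main loop, where other registers are occupied, with the run from a
    clean state, whose length depends on the argument alone. *)
Lemma iter_step_agree X code s s' i : all (writes X) code -> agree X s s' ->
  agree X (iter i (step code) s) (iter i (step code) s').
Proof.
move=> Hw H; elim: i => // i; rewrite !iterS.
case: (iter i _ s) => [[pc rho] q]; case: (iter i _ s') => [[pc' rho'] q'] [/= <- Hr].
case: (ltnP pc (size code)) => Hpc; last by rewrite nth_default.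
have := all_nthP (IShow _ false) Hw pc Hpc.
case: (nth _ code pc) => [r n|r n|r z nz|a n|n|b] //= Xr; split=> //=.
- by move=> x Hx; rewrite /upd; case: eqP => _; rewrite Hr.
- by move=> x Hx; rewrite /upd; case: eqP => _; rewrite Hr.
- by rewrite Hr.
Qed.

Fixpoint cregs (X : pred nat) (c : cmd T) :=
  match c with
  | CSkip => true
  | CInc r | CDec r => X r
  | CPush _ => false
  | CSeq c1 c2 => cregs X c1 && cregs X c2
  | CIf r c1 c2 => [&& X r, cregs X c1 & cregs X c2]
  | CWhile r c => X r && cregs X c
  end.

Lemma cregs_compile (X : pred nat) f c k : cregs X c -> X 0 -> ~~ X f ->
  all (writes X) (compile c k) /\ all (counter_instr f) (compile c k).
Proof.
move=> Hc X0 Hf.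
have Xf r : X r -> r != f by move=> Hr; apply: contraNneq Hf => <-.
have f0' := Xf 0 X0.
elim: c k Hc => //= [r|r|c1 IH1 c2 IH2|r c1 IH1 c2 IH2|r c IH] k.
- by move=> Hr; rewrite Hr Xf.
- by move=> Hr; rewrite Hr Xf.
- by move=> /andP[/(IH1 k)[H1 H2] /(IH2 (k + csize c1))[H3 H4]]; rewrite !all_cat H1 H2 H3 H4.
- move=> /and3P[Hr /(IH1 k.+1)[H1 H2] /(IH2 (k + csize c1).+2)[H3 H4]].
  by rewrite !all_cat /= H1 H2 H3 H4 Xf // X0 Hr f0'.
- by move=> /andP[Hr /(IH k.+1)[H1 H2]]; rewrite !all_rcons /= H1 H2 Xf // X0 Hr f0'.
Qed.

Lemma cregs_seqs X cs : all (cregs X) cs -> cregs X (cseqs cs).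
Proof. by elim: cs => //= c cs IH /andP[-> /IH]. Qed.

Lemma prf_cmd_regs (X : pred nat) g args out fr :
  all X args -> X 0 -> X out -> (forall r, fr <= r -> X r) -> cregs X (prf_cmd T g args out fr).
Proof.
move=> + X0; elim/prf_nested_ind: g args out fr => //=.
- move=> args out fr Ha Ho Hfr.
  have Hn : X (nth 0 args 0) by case: args Ha => //= a l /andP[].
  by rewrite Hn Ho Hfr.
- move=> i args out fr Ha Ho Hfr.
  have Hn : X (nth 0 args i).
    by case: (ltnP i (size args)) => H; [apply: (allP Ha); apply: mem_nth|rewrite nth_default].
  by rewrite Hn Ho Hfr.
- move=> f gs IHf IHgs args out fr Ha Ho Hfr.
  have Hio : all X (iota fr (size gs)) by apply/allP => x; rewrite mem_iota => /andP[/Hfr].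
  apply/and3P; split.
  + move: (size gs) 0 {Hio} => N.
    elim: IHgs => //= g gs' Hg _ IH i.
    rewrite IH andbT; apply: Hg => //; first by apply: Hfr; lia.
    by move=> r Hr; apply: Hfr; lia.
  + by apply: IHf => // r Hr; apply: Hfr; lia.
  + by apply: cregs_seqs; rewrite all_map; apply/allP => x /(allP Hio) /= ->.
- move=> g h IHg IHh args out fr Ha Ho Hfr.
  have Hn : X (nth 0 args 0) by case: args Ha => //= a l /andP[].
  have Hb : all X (behead args) by case: args Ha {Hn} => //= a l /andP[].
  rewrite IHg ?IHh ?Hn ?Ho ?Hfr //=; try (by move=> *; apply: Hfr; lia); try lia.
  by rewrite Hb !Hfr //; lia.
- move=> f IHf args out fr Ha Ho Hfr.
  rewrite !IHf ?Ho ?Hfr //=; try (by move=> *; apply: Hfr; lia); try lia.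
  + by rewrite Ha Hfr.
Qed.

End Fuel.

(** * Decoding a number into a word *)

Section Decode.
Variable Q0 : finType.
Implicit Types (rho : nat -> nat) (q : seq Q0).
Notation N := #|Q0|.
Let atmost e := (fun v : nat => v <= e) : pred nat.

(** One pass subtracts [#|Q0| + 1] from register 4 and counts it in the quotient, register 7, unless
    register 4 reaches 0 on the way; the place where it does names the letter. No digit is 0, so the
    last pass always names one. *)
Fixpoint cdigit (ls : seq Q0) : cmd Q0 :=
  if ls is a :: l then CSeq (CDec _ 4) (CIf 4 (cdigit l) (CPush a))
  else CSeq (CDec _ 4) (CInc _ 7).

Definition cquot := CWhile 4 (cdigit (enum Q0)).
Definition cdecode := CWhile 4 (CSeq cquot (cmove _ 7 4)).

Lemma exec_digit_push e a0 ls rho q : 0 < rho 4 -> rho 4 <= size ls -> size q < e ->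
  exists2 n, n <= 4 * size ls &
    exec (atmost e) (cdigit ls) rho q n (upd rho 4 0) (nth a0 ls (rho 4).-1 :: q).
Proof.
elim: ls rho => [|a l IH] rho /= H0 Hle Hq; first by lia.
case: (eqVneq (rho 4) 1) => [E|E].
  exists (1 + 1.+1); first by lia.
  apply: ex_seq; first exact: ex_dec.
  rewrite E /=.
  by apply: ex_ifz; [rewrite updE|apply: ex_push].
have [||n Hn He] := IH (upd rho 4 (rho 4).-1) _ _ Hq; rewrite ?updE; try lia.
exists (1 + n.+2); first by lia.
apply: ex_seq; first exact: ex_dec.
apply: ex_ifnz; first by rewrite updE; lia.
rewrite updE upd_upd in He.
by rewrite (_ : nth a0 (a :: l) (rho 4).-1 = nth a0 l (rho 4).-2) //; case: (rho 4) H0 E => [|[]].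
Qed.

Lemma exec_digit_quot e ls rho q : size ls < rho 4 -> rho 7 < e ->
  exists2 n, n <= 4 * (size ls).+1 &
    exec (atmost e) (cdigit ls) rho q n
      (upd (upd rho 4 (rho 4 - (size ls).+1)) 7 (rho 7).+1) q.
Proof.
elim: ls rho => [|a l IH] rho /= H0 H7.
  exists (1 + 1) => //; apply: ex_seq; first exact: ex_dec.
  by rewrite subn1 -[X in upd _ 7 X]/((upd rho 4 (rho 4).-1 7).+1); apply: ex_inc.
have [||n Hn He] := IH (upd rho 4 (rho 4).-1) _ _; rewrite ?updE ?upd_ne //; try lia.
exists (1 + n.+2); first by lia.
apply: ex_seq; first exact: ex_dec.
apply: ex_ifnz; first by rewrite updE; lia.
move: He; rewrite updE upd_upd upd_ne //.
by rewrite (_ : (rho 4).-1 - (size l).+1 = rho 4 - (size l).+2); last by lia.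
Qed.

Lemma size_enumQ : size (enum Q0) = N.
Proof. by rewrite -cardE. Qed.

Lemma exec_quot e (a : Q0) m rho q :
  rho 4 = (enum_rank a).+1 + N.+1 * m -> rho 7 + m <= e -> size q < e ->
  exists2 n, n <= (m.+1) * (4 * N.+1 + 2) + 1 &
    exec (atmost e) cquot rho q n (upd (upd rho 4 0) 7 (rho 7 + m)) (a :: q).
Proof.
elim: m rho => [|m IH] rho H4 H7 Hq.
  have Hr : enum_rank a < N := ltn_ord _.
  have [|||n Hn He] := @exec_digit_push e a (enum Q0) rho q; rewrite ?size_enumQ; try lia.
  rewrite size_enumQ in Hn.
  exists (n + 1).+2; first by lia.
  apply: ex_whnz; first by lia.
    exact: He.
  have -> : upd (upd rho 4 0) 7 (rho 7 + 0) = upd rho 4 0 by upd_tac.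
  rewrite (_ : (rho 4).-1 = enum_rank a) ?nth_enum_rank; last by lia.
  by apply: ex_whz; rewrite updE.
have [||n Hn He] := @exec_digit_quot e (enum Q0) rho q; rewrite ?size_enumQ; try lia.
rewrite size_enumQ in He Hn.
set rho1 := upd _ 7 _ in He.
have E4 : rho1 4 = (enum_rank a).+1 + N.+1 * m by rewrite /rho1 upd_ne // updE; lia.
have E7 : rho1 7 = (rho 7).+1 by rewrite /rho1 updE.
have [|n' Hn' He'] := IH _ E4 _ Hq; first by lia.
exists (n + n').+2; first by lia.
apply: ex_whnz; [by lia|exact: He|].
rewrite (_ : upd (upd rho 4 0) 7 (rho 7 + m.+1) = upd (upd rho1 4 0) 7 (rho1 7 + m)) //.
by rewrite /rho1; upd_tac.
Qed.

Lemma word_code_size (v : seq Q0) : size v <= word_code v.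
Proof. by elim: v => //= a v; rewrite -/(word_code v); nia. Qed.

(** The first letter is the least significant digit, so pushing reverses the word. This is wanted:
    letters emitted later stand farther to the left, and a word emitted from its last letter reads
    correctly from left to right. *)
Lemma exec_decode e (v : seq Q0) rho q :
  rho 4 = word_code v -> rho 7 = 0 -> word_code v <= e -> size q + size v <= e ->
  exists2 n, n <= size v * (e.+1 * (4 * N + 20)) + 1 &
    exec (atmost e) cdecode rho q n (upd rho 4 0) (catrev v q).
Proof.
elim: v rho q => [|a v IH] rho q H4 H7 He Hs.
  exists 1 => //; rewrite (_ : upd rho 4 0 = rho); last by upd_tac.
  exact: ex_whz.
move: H4 He Hs; rewrite /= -/(word_code v) => H4 He Hs.
have [||n1 Hn1 He1] := exec_quot (e := e) (q := q) H4; rewrite ?H7; try lia.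
set rho1 := upd _ 7 _ in He1.
have E7 : rho1 7 = word_code v by rewrite /rho1 updE H7.
have E4 : rho1 4 = 0 by rewrite /rho1 upd_ne // updE.
have He2 := @exec_move Q0 (atmost e) 7 4 rho1 (a :: q) isT.
set rho2 := upd _ 4 _ in He2.
have F4 : rho2 4 = word_code v by rewrite /rho2 updE E4 E7.
have F7 : rho2 7 = 0 by rewrite /rho2 upd_ne // updE.
have [||n3 Hn3 He3] := IH rho2 (a :: q) F4 F7; rewrite /=; try lia.
exists ((n1 + (4 * rho1 7).+1) + n3).+2.
  have H1 : (word_code v).+1 * (4 * N.+1 + 2) <= e.+1 * (4 * N + 6) by apply: leq_mul; lia.
  have H2 : e.+1 * (4 * N + 20) = e.+1 * (4 * N + 6) + e.+1 * 14 by rewrite -mulnDr -addnA.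
  move: Hn3; rewrite (mulSn (size v)); move: (size v * _) => S Hn3.
  move: H1 H2 Hn1; move: (e.+1 * (4 * N + 6)) (e.+1 * (4 * N + 20)) ((word_code v).+1 * _) => A C D.
  by rewrite E7; lia.
apply: ex_whnz; first by lia.
  by apply: ex_seq; [exact: He1|apply: He2 => u; rewrite E4 E7 /atmost; lia].
rewrite (_ : upd rho 4 0 = upd rho2 4 0) //.
by rewrite /rho2 /rho1; upd_tac.
Qed.

End Decode.

(** * Half and triangular root of the input *)

Section Prelude.
Variable Q0 : finType.
Implicit Types (rho : nat -> nat) (q : seq Q0).
Let atmost e := (fun v : nat => v <= e) : pred nat.

Definition ccopies : cmd Q0 :=
  CWhile 0 (CSeq (CDec _ 0) (CSeq (CInc _ 8) (CSeq (CInc _ 9) (CInc _ 3)))).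
Definition chalf : cmd Q0 := CWhile 8 (CSeq (CDec _ 8) (CSeq (CDec _ 8) (CInc _ 2))).
(** Subtracting 1, 2, 3, ... extracts a square root without multiplication. *)
Definition croot : cmd Q0 :=
  CWhile 9 (CSeq (CInc _ 1) (CSeq (ccopy Q0 1 10 11)
    (CWhile 10 (CSeq (CDec _ 10) (CDec _ 9))))).
Definition cprelude1 := CSeq ccopies (CSeq chalf croot).
Definition cprelude2 : cmd Q0 := CWhile 0 (CSeq (CDec _ 0) (CInc _ 3)).

(* Least k with 1 + 2 + ... + k >= b, counted from k upwards. *)
Fixpoint root_loop n k b :=
  if n is n'.+1 then if b == 0 then k else root_loop n' k.+1 (b - k.+1) else k.

Definition tri_root e := root_loop e 0 e.
Definition half_up e := (e.+1)./2.

Lemma root_loopP n k b e : b <= n -> k * k.+1 + 2 * b = 2 * e \/ b = 0 /\ k * k.-1 < 2 * e <= k * k.+1 ->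
  let K := root_loop n k b in 0 < e -> K * K.-1 < 2 * e <= K * K.+1.
Proof.
elim: n k b => [|n IH] k b Hb H /= e0.
  by case: H => [|[]] // H; case: k H => [|k] H; nia.
case: eqP => [b0|/eqP b0].
  by case: H => [|[]] // H; case: k H => [|k] H; nia.
apply: IH => //; first by lia.
case: H => [H|[]]; last by lia.
case: (leqP k.+1 b) => Hk; [left|right]; nia.
Qed.

Lemma tri_rootP e : 0 < e -> tri_root e * (tri_root e).-1 < 2 * e <= tri_root e * (tri_root e).+1.
Proof. by move=> e0; apply: (@root_loopP e 0 e) => //; left. Qed.

Lemma tri_root_le e : tri_root e <= e.
Proof.
case: (posnP e) => [->//|/tri_rootP]; case: (tri_root e) => [|[|k]] //=; nia.
Qed.

Lemma exec_copies e rho q : rho 0 + rho 8 <= e -> rho 0 + rho 9 <= e -> rho 0 + rho 3 <= e ->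
  exec (atmost e) ccopies rho q (6 * rho 0).+1
    (upd (upd (upd (upd rho 0 0) 8 (rho 8 + rho 0)) 9 (rho 9 + rho 0)) 3 (rho 3 + rho 0)) q.
Proof.
move E : (rho 0) => n; elim: n rho E => [|n IH] rho E H8 H9 H3.
  rewrite (_ : upd _ 3 _ = rho); last by upd_tac.
  by rewrite muln0; apply: ex_whz.
have -> : (6 * n.+1).+1 = ((1 + (1 + (1 + 1))) + (6 * n).+1).+2 by lia.
apply: ex_whnz; first by lia.
  apply: ex_seq; first exact: ex_dec.
  do 2 (apply: ex_seq; first by apply: ex_inc; rewrite /atmost; upds).
  by apply: ex_inc; rewrite /atmost; upds.
set rho2 := upd _ 3 _.
rewrite (_ : upd _ 3 _ = upd (upd (upd (upd rho2 0 0) 8 (rho2 8 + n)) 9 (rho2 9 + n)) 3 (rho2 3 + n)).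
  by apply: IH; rewrite /rho2; upds.
by rewrite /rho2; upd_tac.
Qed.

Lemma exec_half e rho q : rho 2 + rho 8 <= e ->
  exec (atmost e) chalf rho q (5 * half_up (rho 8)).+1
    (upd (upd rho 8 0) 2 (rho 2 + half_up (rho 8))) q.
Proof.
move E : (rho 8) => n; have [m] := ubnP n; elim: m n rho E => // m IH n rho E Hm H2.
case: n E Hm H2 => [|n] E Hm H2.
  rewrite (_ : upd _ 2 _ = rho); last by rewrite /half_up /=; upd_tac.
  by apply: ex_whz.
have En : half_up n.+1 = (half_up n.-1).+1 by rewrite /half_up; case: n {E Hm H2} => //= n; lia.
have -> : (5 * half_up n.+1).+1 = ((1 + (1 + 1)) + (5 * half_up n.-1).+1).+2 by rewrite En; lia.
apply: ex_whnz; first by lia.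
  do 2 (apply: ex_seq; first exact: ex_dec).
  by apply: ex_inc; rewrite /atmost; upds.
set rho2 := upd _ 2 _.
have := IH n.-1 rho2 _ _ _.
rewrite (_ : upd (upd rho2 _ _) 2 _ = upd (upd rho 8 0) 2 (rho 2 + half_up n.+1)).
  by apply; [rewrite /rho2; upds|lia|rewrite /rho2; upds].
by rewrite En /rho2; upd_tac.
Qed.

Lemma exec_subtract e rho q :
  exec (atmost e) (CWhile 10 (CSeq (CDec _ 10) (CDec _ 9))) rho q (4 * rho 10).+1
    (upd (upd rho 10 0) 9 (rho 9 - rho 10)) q.
Proof.
move E : (rho 10) => n; elim: n rho E => [|n IH] rho E.
  rewrite (_ : upd _ 9 _ = rho); last by upd_tac.
  by apply: ex_whz.
have -> : (4 * n.+1).+1 = ((1 + 1) + (4 * n).+1).+2 by lia.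
apply: ex_whnz; first by lia.
  by apply: ex_seq; exact: ex_dec.
set rho2 := upd _ 9 _.
rewrite (_ : upd _ 9 _ = upd (upd rho2 10 0) 9 (rho2 9 - n)).
  by apply: IH; rewrite /rho2; upds.
by rewrite /rho2; upd_tac.
Qed.

Lemma exec_root e rho q n : rho 9 <= n -> rho 10 = 0 -> rho 11 = 0 -> rho 1 + rho 9 <= e ->
  exists2 t, t <= n * (13 * e + 20) + 1 &
  exec (atmost e) croot rho q t (upd (upd rho 9 0) 1 (root_loop n (rho 1) (rho 9))) q.
Proof.
elim: n rho => [|n IH] rho H9 H10 H11 He.
  have H0 : rho 9 = 0 by lia.
  exists 1; first by lia.
  rewrite (_ : upd _ 1 _ = rho); last by rewrite /=; upd_tac.
  exact: ex_whz.
case: (eqVneq (rho 9) 0) => H0.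
  exists 1; first by lia.
  rewrite (_ : upd _ 1 _ = rho); first by apply: ex_whz.
  by rewrite /= H0 /=; upd_tac.
pose rho1 := upd rho 1 (rho 1).+1.
have E1 : exec (atmost e) (ccopy Q0 1 10 11) rho1 q (9 * rho1 1).+2 (upd rho1 10 (rho1 10 + rho1 1)) q.
  by apply: exec_copy => // v; rewrite /rho1 /atmost; upds.
pose rho2 := upd rho1 10 (rho1 10 + rho1 1).
pose rho3 := upd (upd rho2 10 0) 9 (rho2 9 - rho2 10).
have F1 : rho3 1 = (rho 1).+1 by rewrite /rho3 /rho2 /rho1; upds.
have F9 : rho3 9 = rho 9 - (rho 1).+1 by rewrite /rho3 /rho2 /rho1; upds.
have F10 : rho3 10 = 0 by rewrite /rho3 /rho2 /rho1; upds.
have F11 : rho3 11 = 0 by rewrite /rho3 /rho2 /rho1; upds.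
have [||||t Ht He'] := IH rho3; rewrite ?F1 ?F9 ?F10 ?F11 //; try lia.
exists ((1 + ((9 * rho1 1).+2 + (4 * rho2 10).+1)) + t).+2.
  have -> : rho1 1 = (rho 1).+1 by rewrite /rho1; upds.
  have -> : rho2 10 = (rho 1).+1 by rewrite /rho2 /rho1; upds.
  by rewrite (mulSn n); move: Ht; move: (n * _) => S Ht; lia.
apply: ex_whnz; first by lia.
  apply: ex_seq; first by apply: ex_inc; rewrite /atmost; lia.
  by apply: ex_seq; [exact: E1|exact: exec_subtract].
move: He'; rewrite F1 F9 (_ : upd _ 1 _ = upd (upd rho 9 0) 1 (root_loop n.+1 (rho 1) (rho 9))) //.
rewrite /= (negbTE H0) /rho3 /rho2 /rho1; upd_tac.
Qed.

(* The state reached by each prelude: the input [e] becomes the fuel (register 3),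
   and in the first mode registers 1 and 2 hold the two derived lengths. *)
Definition input e : nat -> nat := upd (fun=> 0) 0 e.

Lemma exec_prelude1 e : exists2 t, t <= e * (13 * e + 40) + 10 &
  exec (atmost e) cprelude1 (input e) ([::] : seq Q0) t
    (upd (upd (upd (fun=> 0) 3 e) 2 (half_up e)) 1 (tri_root e)) [::].
Proof.
have H1 := @exec_copies e (input e) [::].
set rho1 := upd _ 3 _ in H1.
have H2 := @exec_half e rho1 [::].
set rho2 := upd _ 2 _ in H2.
have h8 : rho1 8 = e by rewrite /rho1 /input; upds.
have h2 : rho1 2 = 0 by rewrite /rho1 /input; upds.
have [||||t Ht H3] := @exec_root e rho2 [::] e.
- by rewrite /rho2 /rho1 /input; upds.
- by rewrite /rho2 /rho1 /input; upds.
- by rewrite /rho2 /rho1 /input; upds.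
- by rewrite /rho2 /rho1 /input; upds.
exists ((6 * input e 0).+1 + ((5 * half_up (rho1 8)).+1 + t)).
  rewrite h8 /input updE.
  have : half_up e <= e by rewrite /half_up; lia.
  move: Ht; rewrite !mulnDr; move: (e * (13 * e)) (half_up e) => A B Ht HB; lia.
apply: ex_seq; first by apply: H1; rewrite /input; upds.
apply: ex_seq; first by apply: H2; rewrite h8 h2.
move: H3; rewrite (_ : upd _ 1 _ = upd (upd (upd (fun=> 0) 3 e) 2 (half_up e)) 1 (tri_root e)) //.
have -> : rho2 1 = 0 by rewrite /rho2 /rho1 /input; upds.
have -> : rho2 9 = e by rewrite /rho2 /rho1 /input; upds.
rewrite -/(tri_root e) /rho2 h8 h2 /rho1 /input.
apply: functional_extensionality => x; rewrite /upd /=; repeat (case: eqP => [?|?]; try lia).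
Qed.

Lemma exec_prelude2 e : exists2 t, t <= e * (13 * e + 40) + 10 &
  exec (atmost e) cprelude2 (input e) ([::] : seq Q0) t (upd (fun=> 0) 3 e) [::].
Proof.
have H := @exec_move Q0 (atmost e) 0 3 (input e) [::] isT.
exists (4 * input e 0).+1.
  by rewrite /input updE !mulnDr; move: (e * (13 * e)) => A; lia.
rewrite (_ : upd _ 3 _ = upd (upd (input e) 0 0) 3 (input e 3 + input e 0)).
  by apply: H => v; rewrite /atmost /input; upds.
by rewrite /input; apply: functional_extensionality => x; rewrite /upd /=; repeat (case: eqP => [?|?]; try lia).
Qed.

End Prelude.

Lemma iter_step_noout (T : Type) f (code : seq (instr T)) s i :
  all (counter_instr f) code -> s.2 = [::] -> (iter i (step code) s).2 = [::].
Proof.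
move=> Hw H; elim: i => // i; rewrite iterS; case: (iter i _ s) => [[pc rho] q] /= ->.
case: (ltnP pc (size code)) => Hpc; last by rewrite nth_default.
have := all_nthP (IShow _ false) Hw pc Hpc.
by case: (nth _ code pc).
Qed.

(** * Computing successive words until the fuel is spent *)

Section MainLoop.
Variables (Q0 : finType) (w : nat -> seq Q0) (F : prf).
Hypothesis HF : forall i, prf_eval F [:: i] (word_code (w i)).
Let atmost e := (fun v : nat => v <= e) : pred nat.

(** The leading jump keeps the body nonempty even if the term compiles to nothing. Hence [body_time]
    is positive and [total_time] strictly increasing. *)
Definition body : seq (instr Q0) := IJz _ 0 1 1 :: compile (prf_cmd Q0 F [:: 5] 6 12) 1.
Definition cadvance : cmd Q0 := CSeq (cclear _ 4) (CSeq (cmove _ 6 4) (CInc _ 5)).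
Definition exit_pc K := (K + 3 * size body + csize cadvance).+1.
(** Register 5 holds the current index, register 3 the fuel, register 4 the code of the last word
    completed, which is decoded when the fuel runs out. *)
Definition main_code K (b : bool) : seq (instr Q0) :=
  fuelify K (exit_pc K) 3 body (size body) ++ compile cadvance (K + 3 * size body) ++
  [:: IJz _ 0 K K] ++ compile (cdecode Q0) (exit_pc K) ++ [:: IShow _ b].

Definition used : pred nat := fun r => [|| r == 0, r == 5, r == 6 | 12 <= r].

Lemma body_wf : all (writes used) body /\ all (counter_instr 3) body.
Proof.
have H : cregs used (prf_cmd Q0 F [:: 5] 6 12).
  by apply: prf_cmd_regs => // r Hr; rewrite /used Hr !orbT.
by have [H1 H2] := @cregs_compile Q0 used 3 _ 1 H isT isT; rewrite /body /= H1 H2.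
Qed.

Definition index_only j := upd (fun=> 0) 5 j.

Definition body_state j i := iter i (step body) (0, index_only j, [::]).

Lemma body_halts j : exists n,
  body_state j n = (size body, upd (index_only j) 6 (word_code (w j)), [::]).
Proof.
have z r : 12 <= r -> index_only j r = 0 by move=> Hr; rewrite /index_only upd_ne; lia.
have [n Hn] := @prf_cmdP Q0 F [:: j] _ (HF j) [:: 5] 6 12 (index_only j) [::]
  (erefl _) isT isT isT (erefl _) z.
have [E _ _] := @compile_runs _ xpredT (fun _ _ => isT) body _ 1 _ _ _ _ _
  (fun _ _ => erefl) Hn (conj (fun _ => isT) isT).
exists n.+1; rewrite /body_state iterSr /=.
by rewrite E /body /= size_compile.
Qed.

Lemma body_exits j : exists n, size body <= (body_state j n).1.1.
Proof. by have [n E] := body_halts j; exists n; rewrite E. Qed.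

Definition body_time j := ex_minn (body_exits j).

Lemma body_timeP j :
  [/\ 0 < body_time j,
      forall i, i < body_time j -> (body_state j i).1.1 < size body &
      body_state j (body_time j) = (size body, upd (index_only j) 6 (word_code (w j)), [::])].
Proof.
rewrite /body_time; case: ex_minnP => n Hn Hmin.
have Hlt i : i < n -> (body_state j i).1.1 < size body.
  by move=> Hi; rewrite ltnNge; apply/negP => /Hmin; lia.
have [m Hm] := body_halts j.
have Hnm : n <= m by apply: Hmin; rewrite Hm.
split => //; first by case: n Hn {Hmin Hlt Hnm} => //.
have q0 : (body_state j n).2 = [::] by apply: (iter_step_noout _ body_wf.2).
have : forall k, iter k (step body) (body_state j n) = body_state j n.
  elim=> // k IH; rewrite iterS IH; case: (body_state j n) Hn q0 => [[pc rho] q] /= Hpc ->.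
  by rewrite nth_default.
by move/(_ (m - n)); rewrite /body_state -iterD subnK //; rewrite -/(body_state j m) Hm => <-.
Qed.

Definition total_time J := \sum_(i < J) body_time i.

Lemma total_timeS J : total_time J.+1 = total_time J + body_time J.
Proof. by rewrite /total_time big_ord_recr. Qed.

Lemma ltn_total_time J : total_time J < total_time J.+1.
Proof. by rewrite total_timeS; have [] := body_timeP J; lia. Qed.

Section Run.
Variables (prog : seq (instr Q0)) (K : nat) (b : bool) (e k h : nat).
Hypothesis at_K : code_at prog K (main_code K b).
Hypotheses (ke : k <= e) (he : h <= e).

Record loop_inv j fuel cd (rho : nat -> nat) : Prop := LoopInv {
  inv3 : rho 3 = fuel; inv5 : rho 5 = j; inv4 : rho 4 = cd;
  inv_0 : forall r, [|| r == 0, r == 6, r == 7 | 12 <= r] -> rho r = 0;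
  inv1 : rho 1 = k; inv2 : rho 2 = h;
  inv_e : forall r, rho r <= e }.

Lemma at_body : code_at prog K (fuelify K (exit_pc K) 3 body (size body)).
Proof. by move: at_K; rewrite /main_code => /code_at_cat[]. Qed.

Lemma at_tail : code_at prog (K + 3 * size body) (compile cadvance (K + 3 * size body) ++
  [:: IJz _ 0 K K] ++ compile (cdecode Q0) (exit_pc K) ++ [:: IShow _ b]).
Proof. by move: at_K; rewrite /main_code => /code_at_cat[_]; rewrite size_fuelify. Qed.

Lemma body_run j fuel cd rho n : loop_inv j fuel cd rho -> j + fuel <= e ->
  n <= fuel -> n <= body_time j ->
  let s := iter n (step body) (0, rho, [::]) in
  [/\ runs prog (atmost e) (3 * n) (K, rho, [::]) (fstate K 3 (fuel - n) [::] s),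
      s.1.1 = (body_state j n).1.1,
      forall r, s.1.2 r = if used r then (body_state j n).1.2 r else rho r &
      forall r, r != 3 -> s.1.2 r <= e].
Proof.
move=> I He Hn Hnj.
have Ag i : agree used (iter i (step body) (0, rho, [::])) (body_state j i).
  apply: iter_step_agree; first exact: body_wf.1.
  split=> //= r; rewrite /used /index_only /upd => /or4P[/eqP->|/eqP->|/eqP->|Hr].
  - by rewrite (inv_0 I).
  - by rewrite (inv5 I).
  - by rewrite (inv_0 I).
  by rewrite (inv_0 I) ?Hr ?orbT // ifF //; lia.
have Fr i r : ~~ used r -> (iter i (step body) (0, rho, [::])).1.2 r = rho r.
  by move=> Hr; apply: iter_step_frame Hr; apply: body_wf.1.
have Val i r : (iter i (step body) (0, rho, [::])).1.2 r = if used r then (body_state j i).1.2 r else rho r.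
  by case: ifP => [/(Ag i).2|/negbT/(Fr i)].
have Bd i r : i <= n -> r != 3 -> (iter i (step body) (0, rho, [::])).1.2 r <= e.
  move=> Hi Hr; rewrite Val; case: ifP => Hu; last exact: (inv_e I).
  have := iter_step_growth body (0, index_only j, [::]) i r; rewrite -/(body_state j i) /= /index_only /upd.
  by case: eqP => _; lia.
split => //; last by move=> r; apply: Bd.
  have -> : (K, rho, [::]) = fstate K 3 fuel [::] (0, rho, [::]).
    by rewrite /fstate /= muln0 addn0 -(inv3 I) upd_id.
  apply: (fuel_run at_body body_wf.2) => //.
  - by rewrite -(inv3 I); apply: (inv_e I).
  - move=> i Hi; rewrite (Ag i).1; have [_ H _] := body_timeP j; apply: H; lia.
exact: (Ag n).1.
Qed.

Lemma loop_step j fuel cd rho : loop_inv j fuel cd rho -> j + fuel <= e -> body_time j <= fuel ->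
  exists T rho', [/\ runs prog (atmost e) T (K, rho, [::]) (K, rho', [::]),
    loop_inv j.+1 (fuel - body_time j) (word_code (w j)) rho' & T <= 3 * body_time j + 7 * e + 10].
Proof.
move=> I He Ht; have [R E1 E2 E3] := body_run I He Ht (leqnn _).
have [t0 _ Eb] := body_timeP j.
move: R E1 E2 E3; set s := iter _ _ _; rewrite Eb /= => R E1 E2 E3.
set rho1 := upd s.1.2 3 (fuel - body_time j).
have {}R : runs prog (atmost e) (3 * body_time j) (K, rho, [::]) (K + 3 * size body, rho1, [::]).
  by move: R; rewrite /fstate E1.
have V r : rho1 r = if r == 3 then fuel - body_time j else if used r then upd (index_only j) 6 (word_code (w j)) r else rho r.
  by rewrite /rho1 /upd E2 /upd.
have [at1 /code_at_cons[at2 _]] := code_at_cat at_tail.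
have b1 r : rho1 r <= e.
  by have [H _] := runs_bounded_r R; apply: H.
have v6 : rho1 6 = word_code (w j) by rewrite V /= updE.
have v5 : rho1 5 = j by rewrite V /= upd_ne // /index_only updE.
have Ex : exec (atmost e) cadvance rho1 [::] ((3 * rho1 4).+1 + ((4 * rho1 6).+1 + 1))
   (upd (upd (upd rho1 6 0) 4 (word_code (w j))) 5 j.+1) [::].
  apply: ex_seq; first exact: exec_clear.
  apply: ex_seq.
    have := @exec_move Q0 (atmost e) 6 4 (upd rho1 4 0) [::] isT.
    rewrite updE upd_ne // add0n; apply=> v Hv; rewrite /atmost; apply: leq_trans Hv _; exact: b1.
  rewrite v6 (_ : upd (upd (upd rho1 4 0) 6 0) 4 (word_code (w j)) = upd (upd rho1 6 0) 4 (word_code (w j))); last by upd_tac.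
  by have := @ex_inc Q0 (atmost e) 5 (upd (upd rho1 6 0) 4 (word_code (w j))) [::];
    rewrite !upd_ne // v5; apply; rewrite /atmost; lia.
have R2 := compile_runs (fun v H => leq_trans (leq_pred v) H) at1 Ex (runs_bounded_r R).
set rho2 := upd _ 5 _ in R2 Ex.
exists (3 * body_time j + ((3 * rho1 4).+1 + ((4 * rho1 6).+1 + 1) + 1)), rho2; split.
- apply: (runs_trans R); apply: (runs_trans R2).
  rewrite size_compile in at2.
  apply: runsS; [by rewrite /at_pc /= at2|exact: (runs_bounded_r R2)|].
  rewrite /= at2 /= if_same_jump; apply: runs0.
  by have [] := runs_bounded_r R2.
- split; rewrite /rho2.
  + by rewrite !upd_ne // V.
  + by rewrite updE.
  + by rewrite upd_ne // updE.
  + move=> r Hr; rewrite /upd; case: eqP => [Er|_]; first by rewrite Er in Hr.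
    case: eqP => [Er|_]; first by rewrite Er in Hr.
    case: eqP => [//|/eqP r6].
    rewrite V; case: eqP => [Er|_]; first by rewrite Er in Hr.
    case: ifP => Hu; last exact: (inv_0 I).
    by rewrite upd_ne // /index_only /upd; case: eqP => // Er; rewrite Er in Hr.
  + by rewrite !upd_ne // V /= (inv1 I).
  + by rewrite !upd_ne // V /= (inv2 I).
  + by have [H _] := runs_bounded_r R2 => r; apply: H.
- by have := b1 4; have := b1 6; lia.
Qed.

Lemma loop_exit j fuel cd rho : loop_inv j fuel cd rho -> j + fuel <= e -> fuel < body_time j ->
  exists rho', [/\ runs prog (atmost e) (3 * fuel + 1) (K, rho, [::]) (exit_pc K, rho', [::]) &
    [/\ rho' 4 = cd, rho' 7 = 0 & rho' 2 = h]].
Proof.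
move=> I He Ht; have [R E1 E2 E3] := body_run I He (leqnn _) (ltnW Ht).
have [_ Hpc _] := body_timeP j.
move: R E1 E2 E3; set s := iter _ _ _ => R E1 E2 E3; rewrite subnn in R.
exists (upd s.1.2 3 0); split; last by rewrite !upd_ne // !E2 /= (inv4 I) (inv2 I) (inv_0 I).
have P : s.1.1 < size body by rewrite E1; apply: Hpc.
by apply: (runs_trans R); apply: (fuel_exit at_body body_wf.2 P E3).
Qed.

Lemma loop_runs fuel j cd rho : loop_inv j fuel cd rho -> j + fuel <= e ->
  exists T J rho', [/\ runs prog (atmost e) T (K, rho, [::]) (exit_pc K, rho', [::]),
    T <= fuel * (7 * e + 20) + 3 * e + 1,
    j <= J, total_time J <= total_time j + fuel < total_time J.+1 &
    [/\ rho' 4 = (if J == j then cd else word_code (w J.-1)), rho' 7 = 0 & rho' 2 = h]].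
Proof.
have [m] := ubnP fuel; elim: m fuel j cd rho => // m IH fuel j cd rho Hm I He.
case: (leqP (body_time j) fuel) => Ht.
  have [t0 _ _] := body_timeP j.
  have [T1 [rho1 [R1 I1 HT1]]] := loop_step I He Ht.
  have [||T2 [J [rho2 [R2 HT2 HJ HJ' [v4 v7 v2]]]]] := IH _ _ _ _ _ I1; try lia.
  exists (T1 + T2), J, rho2; split.
  - exact: (runs_trans R1 R2).
  - have -> : fuel * (7 * e + 20) = (fuel - body_time j) * (7 * e + 20) + body_time j * (7 * e + 20).
      by rewrite -mulnDl subnK.
    have : 1 * (7 * e + 20) <= body_time j * (7 * e + 20) by rewrite leq_mul2r t0 orbT.
    have : body_time j * 3 <= body_time j * 20 by rewrite leq_mul2l orbT.
    have : body_time j * (7 * e + 20) = body_time j * (7 * e) + body_time j * 20 by rewrite mulnDr.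
    have : 1 * (7 * e) <= body_time j * (7 * e) by rewrite leq_mul2r t0 orbT.
    move: HT2; move: ((fuel - body_time j) * _) (body_time j * (7 * e)) (body_time j * (7 * e + 20)) => A B C; lia.
  - by lia.
  - by move: HJ'; rewrite total_timeS; lia.
  - split=> //; rewrite v4; case: eqP => [->|HJ1]; last by rewrite ifF //; lia.
    by rewrite ifF //; lia.
have [rho1 [R1 V]] := loop_exit I He Ht.
exists (3 * fuel + 1), j, rho1; split => //.
- by move: (fuel * _) => A; lia.
- by rewrite total_timeS; lia.
- by rewrite eqxx.
Qed.

Lemma main_runs rho J : loop_inv 0 e 0 rho ->
  total_time J.+1 <= e < total_time J.+2 ->
  exists T rho', [/\ runs prog (atmost e) T (K, rho, [::])
      (exit_pc K + csize (cdecode Q0), rho', rev (w J)),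
    nth (IShow _ false) prog (exit_pc K + csize (cdecode Q0)) = IShow _ b,
    T <= e.+1 * (e.+1 * (4 * #|Q0| + 40)) + 10 & rho' 2 = h].
Proof.
move=> I HJ.
have [T1 [J' [rho1 [R1 HT1 _ HJ' [v4 v7 v2]]]]] := loop_runs I (leqnn e).
rewrite /total_time big_ord0 -/(total_time _) -/(total_time _) add0n in HJ'.
have mono : {homo total_time : a c / a <= c}.
  by apply: homo_leq => //; [exact: leq_trans|move=> i; apply: ltnW; apply: ltn_total_time].
have EJ : J' = J.+1.
  apply/eqP; rewrite eqn_leq; apply/andP; split; rewrite leqNgt; apply/negP => Hlt.
    by have := mono _ _ Hlt; lia.
  by have := mono _ _ Hlt; lia.
rewrite EJ /= in v4.
(* The code was produced within the fuel, so it is a register value, bounded by [e]; this bounds the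
   time of decoding. *)
have b4 : word_code (w J) <= e by rewrite -v4; apply: (runs_bounded_r R1).1.
have [|n Hn Ex] := @exec_decode Q0 e (w J) rho1 [::] v4 v7 b4.
  by rewrite add0n; apply: leq_trans (word_code_size _) b4.
have [_ /code_at_cons[_ H3]] := code_at_cat at_tail.
rewrite size_compile -/(exit_pc K) in H3.
have [at3 /code_at_cons[at4 _]] := code_at_cat H3.
have R2 := compile_runs (fun v H => leq_trans (leq_pred v) H) at3 Ex (runs_bounded_r R1).
rewrite size_compile in at4.
exists (T1 + n), (upd rho1 4 0); split; last by rewrite upd_ne.
- by rewrite /rev; apply: (runs_trans R1).
- exact: at4.
- have : size (w J) * (e.+1 * (4 * #|Q0| + 20)) <= e * (e.+1 * (4 * #|Q0| + 20)).
    by apply: leq_mul => //; apply: leq_trans (word_code_size _) b4.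
  have : e * (e.+1 * (4 * #|Q0| + 20)) + e * (e.+1 * 20) = e * (e.+1 * (4 * #|Q0| + 40)).
    by rewrite -!mulnDr -addnA.
  have : e.+1 * (e.+1 * (4 * #|Q0| + 40)) = e * (e.+1 * (4 * #|Q0| + 40)) + e.+1 * (4 * #|Q0| + 40).
    by rewrite mulSn addnC.
  have : e.+1 * 40 <= e.+1 * (4 * #|Q0| + 40) by apply: leq_mul => //; lia.
  have : e * (7 * e + 20) <= e * (e.+1 * 20) by apply: leq_mul => //; lia.
  move: HT1 Hn; move: (e * (7 * e + 20)) (size (w J) * _) (e * (e.+1 * (4 * #|Q0| + 20))) (e * (e.+1 * 20)) (e * (e.+1 * (4 * #|Q0| + 40))) (e.+1 * (4 * #|Q0| + 40)) (e.+1 * (e.+1 * _)).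
  by move=> A1 A2 A3 A4 A5 A6 A7; lia.
Qed.

End Run.
End MainLoop.

(** * Inverse of an increasing running time *)

Section SlowInverse.
Variable t : nat -> nat.
Hypothesis t_incr : forall J, t J < t J.+1.

Fixpoint slow_inverse e :=
  if e is e'.+1 then (if t (slow_inverse e').+1 <= e then (slow_inverse e').+1 else slow_inverse e')
  else 0.

Lemma slow_inverse_step e : slow_inverse e.+1 <= (slow_inverse e).+1.
Proof. by rewrite /=; case: ifP. Qed.

Lemma slow_inverse_mono e : slow_inverse e <= slow_inverse e.+1.
Proof. by rewrite /=; case: ifP. Qed.

Lemma slow_inverseP e : t 0 <= e -> t (slow_inverse e) <= e < t (slow_inverse e).+1.
Proof.
elim: e => [|e IH] H /=.
  by have := t_incr 0; lia.
case: (leqP (t 0) e) => He.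
  have /andP[H1 H2] := IH He; case: ifP => H3.
    by rewrite H3 /=; have := t_incr (slow_inverse e).+1; lia.
  by have := leqW H1; move: H3 => /negbT; lia.
have s0 : forall n, n < t 0 -> slow_inverse n = 0.
  elim=> // n IHn Hn /=; rewrite IHn; last by lia.
  by rewrite ifF //; have := t_incr 0; lia.
rewrite s0 //; case: ifP => H3; first by have := t_incr 0; lia.
by have := t_incr 0; lia.
Qed.

Lemma slow_inverse_unbounded n : exists E, forall e, E <= e -> n <= slow_inverse e.
Proof.
have mono : {homo slow_inverse : a c / a <= c}.
  by apply: homo_leq => //; [exact: leq_trans|exact: slow_inverse_mono].
exists (maxn (t 0) (t n)) => e He; rewrite leqNgt; apply/negP => Hlt.
have /andP[_ H] : t (slow_inverse e) <= e < t (slow_inverse e).+1 by apply: slow_inverseP; lia.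
have tm : {homo t : a c / a <= c}.
  by apply: homo_leq => //; [exact: leq_trans|move=> i; apply: ltnW].
by have := tm _ _ Hlt; lia.
Qed.

End SlowInverse.

(** Steps of at most one skip no index: every large index is the value at some epoch, as [slow_surj]
    shows, so every word far enough in the sequence gets displayed. *)
Definition slow (i : nat -> nat) :=
  (forall e, i e.+1 <= (i e).+1) /\ (forall n, exists E, forall e, E <= e -> n <= i e).

(** All that the automaton has to know of the program. The threshold of the test is in register 1,
    the exponent of the date that ends the first mode in register 2. The times are quadratic in [e],
    whereas the epochs are exponentially long. *)
Record program_spec (Q0 : finType) (w w' : nat -> seq Q0) (prog : seq (instr Q0))
    (start2 c e0 : nat) (i1 i2 : nat -> nat) : Prop := ProgramSpec {
  spec_slow1 : slow i1;
  spec_slow2 : slow i2;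
  spec_mode1 : forall e, e0 <= e -> exists T1 T2 s1 s2,
    [/\ runs prog (fun v => v <= e) T1 (0, input e, [::]) s1,
        (exists n, at_pc prog s1 = ITest _ n) /\ s1.1.2 1 = tri_root e,
        runs prog (fun v => v <= e) T2 (step prog s1) s2,
        [/\ at_pc prog s2 = IShow _ true, s2.1.2 2 = half_up e & s2.2 = rev (w (i1 e))] &
        T1 + T2 < c * (e.+1 * e.+1)];
  spec_mode2 : forall e, e0 <= e -> exists T s,
    [/\ runs prog (fun v => v <= e) T (start2, input e, [::]) s,
        at_pc prog s = IShow _ false, s.2 = rev (w' (i2 e)) &
        T < c * (e.+1 * e.+1)] }.

Section WholeProgram.
Variables (Q0 : finType) (w w' : nat -> seq Q0) (F F' : prf).
Hypothesis HF : forall i, prf_eval F [:: i] (word_code (w i)).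
Hypothesis HF' : forall i, prf_eval F' [:: i] (word_code (w' i)).

Let K1 := (csize (cprelude1 Q0)).+1.
Let A2 := K1 + size (main_code Q0 F K1 true).
Let K2 := A2 + csize (cprelude2 Q0).

Definition whole_program : seq (instr Q0) :=
  compile (cprelude1 Q0) 0 ++ ITest _ K1 :: main_code Q0 F K1 true ++
  compile (cprelude2 Q0) A2 ++ main_code Q0 F' K2 false.

Lemma whole_program_at :
  [/\ code_at whole_program 0 (compile (cprelude1 Q0) 0),
      nth (IShow _ false) whole_program (csize (cprelude1 Q0)) = ITest _ K1,
      code_at whole_program K1 (main_code Q0 F K1 true),
      code_at whole_program A2 (compile (cprelude2 Q0) A2) &
      code_at whole_program K2 (main_code Q0 F' K2 false)].
Proof.
have : code_at whole_program 0 whole_program by move=> i _.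
rewrite {2}/whole_program => /code_at_cat[H1].
rewrite size_compile add0n => /code_at_cons[H2] /code_at_cat[H3] /code_at_cat[H4].
by rewrite size_compile.
Qed.

Lemma whole_program_spec : exists c e0 i1 i2,
  program_spec w w' whole_program A2 c e0 i1 i2.
Proof.
have [a1 a2 a3 a4 a5] := whole_program_at.
pose t1 J := total_time HF J.+1.
pose t2 J := total_time HF' J.+1.
have t1i J : t1 J < t1 J.+1 by apply: ltn_total_time.
have t2i J : t2 J < t2 J.+1 by apply: ltn_total_time.
have pd e v : v <= e -> v.-1 <= e by move=> H; apply: leq_trans (leq_pred v) H.
have bin e p : bounded (fun v => v <= e) (p, input e, [::] : seq Q0).
  by split=> //= r; rewrite /input /upd; case: eqP.
(* The constant is 40 for the prelude, [4 * #|Q0| + 40] for loop and decoding, and 120 for the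
   additive terms. The bound on [e] is such that the first word is completed within the fuel. *)
exists (4 * #|Q0| + 200), (maxn 1 (maxn (t1 0) (t2 0))), (slow_inverse t1), (slow_inverse t2).
have time e T : T <= e * (13 * e + 40) + 10 -> forall T',
    T' <= e.+1 * (e.+1 * (4 * #|Q0| + 40)) + 10 -> 0 < e ->
    T + T' < (4 * #|Q0| + 200) * (e.+1 * e.+1).
  move=> H T' H' e0.
  have : e * (13 * e + 40) <= e.+1 * (e.+1 * 40).
    by apply: leq_mul; lia.
  have : e.+1 * (e.+1 * 40) + e.+1 * (e.+1 * (4 * #|Q0| + 40)) + 120 * (e.+1 * e.+1)
    = (4 * #|Q0| + 200) * (e.+1 * e.+1).
    by move: (e.+1) => p; lia.
  have : 1 * 1 <= e.+1 * e.+1 by apply: leq_mul.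
  move: H H'; move: (e * (13 * e + 40)) (e.+1 * (e.+1 * 40)) (e.+1 * (e.+1 * (4 * #|Q0| + 40))) (e.+1 * e.+1) (_ * _).
  by move=> A B C D G; lia.
split.
- split; [exact: slow_inverse_step|exact: slow_inverse_unbounded].
- split; [exact: slow_inverse_step|exact: slow_inverse_unbounded].
- move=> e He.
  have [T1 HT1 X1] := @exec_prelude1 Q0 e.
  have R1 := compile_runs (pd e) a1 X1 (bin e 0).
  rewrite add0n in R1; set rho1 := upd _ 1 _ in R1.
  have I : @loop_inv e (tri_root e) (half_up e) 0 e 0 rho1.
    split; rewrite /rho1 //.
      by move=> r Hr; rewrite !upd_ne //; apply/eqP => E; rewrite E in Hr.
    by move=> r; have [H _] := runs_bounded_r R1; apply: H.
  have te : t1 0 <= e by lia.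
  have he : half_up e <= e by rewrite /half_up; lia.
  have [T2 [rho2 [R2 E2 HT2 V2]]] := main_runs a3 (tri_root_le e) he I (slow_inverseP t1i te).
  exists T1, T2, (csize (cprelude1 Q0), rho1, [::]), (exit_pc Q0 F K1 + csize (cdecode Q0), rho2, rev (w (slow_inverse t1 e))).
  split; [exact: R1| | | |by apply: time => //; lia].
  + by split; [exists K1; exact: a2|].
  + by rewrite /step a2.
  + by split => //; exact: E2.
- move=> e He.
  have [T1 HT1 X1] := @exec_prelude2 Q0 e.
  have R1 := compile_runs (pd e) a4 X1 (bin e A2).
  set rho1 := upd _ 3 _ in R1.
  have I : @loop_inv e 0 0 0 e 0 rho1.
    split; rewrite /rho1 //.
      by move=> r Hr; rewrite !upd_ne //; apply/eqP => E; rewrite E in Hr.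
    by move=> r; have [H _] := runs_bounded_r R1; apply: H.
  have te : t2 0 <= e by lia.
  have [T2 [rho2 [R2 E2 HT2 V2]]] := main_runs a5 (leq0n e) (leq0n e) I (slow_inverseP t2i te).
  exists (T1 + T2), (exit_pc Q0 F' K2 + csize (cdecode Q0), rho2, rev (w' (slow_inverse t2 e))).
  split; [exact: (runs_trans R1 R2)| |by []|by apply: time => //; lia].
  exact: E2.
Qed.

End WholeProgram.

Lemma program_exists (Q0 : finType) (w w' : nat -> seq Q0) :
  growing_computable w -> growing_computable w' ->
  exists prog start2 c e0 i1 i2, @program_spec Q0 w w' prog start2 c e0 i1 i2.
Proof.
move=> [_ [F HF]] [_ [F' HF']].
have [c [e0 [i1 [i2 H]]]] := whole_program_spec HF HF'.
by do 6 eexists; apply: H.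
Qed.

(** * The automaton *)

(* A register with value [v] is a mark at distance [v] from the base; the letters of the
   queue occupy the cells at distances [0, 1, ...]. *)
Section Ops.
Variables (Q0 : finType) (m P : nat).
Notation reg := 'I_m.+1.

Inductive op :=
| Nop | Inc of reg | Put of reg | Dec of reg | Rem of reg | Push of Q0 | Rot of Q0 | Test.

Definition op_code o : 'I_8 * option reg * option Q0 :=
  match o with
  | Nop => (inord 0, None, None) | Inc j => (inord 1, Some j, None)
  | Put j => (inord 2, Some j, None) | Dec j => (inord 3, Some j, None)
  | Rem j => (inord 4, Some j, None) | Push a => (inord 5, None, Some a)
  | Rot a => (inord 6, None, Some a) | Test => (inord 7, None, None)
  end.

Definition op_decode (c : 'I_8 * option reg * option Q0) : option op :=
  match (val c.1.1, c.1.2, c.2) with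
  | (0, _, _) => Some Nop | (1, Some j, _) => Some (Inc j)
  | (2, Some j, _) => Some (Put j) | (3, Some j, _) => Some (Dec j)
  | (4, Some j, _) => Some (Rem j) | (5, _, Some a) => Some (Push a)
  | (6, _, Some a) => Some (Rot a) | (7, _, _) => Some Test
  | _ => None
  end.

Lemma op_codeK : pcancel op_code op_decode.
Proof. by case=> [|j|j|j|j|a|a|]; rewrite /op_decode /= inordK. Qed.

HB.instance Definition _ := Finite.copy op (pcan_type op_codeK).

(* [ctl] is the control state of a base cell ([None] for a zone cell); [vir] tells whether the
   cell belonged to the initial zone; [dig] is a digit of the clock; [sg] is the signal just
   sent to the right (carry, flag, operation), where the flag is [Some false] when armed and
   [Some true] when fired; [ls] is the signal sent to the left: [Some None] kills the base,
   [Some (Some b)] restarts it in the first ([b = true]) or second mode. *)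
Record cell := Cell {
  ctl : option 'I_P.+1;
  vir : bool;
  dig : bool;
  mk : {ffun reg -> bool};
  sto : option Q0;
  sg : option (bool * option bool * op);
  ls : option (option bool) }.

Definition cell_code c := (ctl c, vir c, dig c, mk c, sto c, sg c, ls c).
Definition cell_decode c :=
  let: (a1, a2, a3, a4, a5, a6, a7) := c in Cell a1 a2 a3 a4 a5 a6 a7.
Lemma cell_codeK : cancel cell_code cell_decode. Proof. by case. Qed.
HB.instance Definition _ := Finite.copy cell (can_type cell_codeK).

End Ops.
Arguments Nop {Q0 m}. Arguments Test {Q0 m}.
Arguments Inc {Q0 m}. Arguments Put {Q0 m}. Arguments Dec {Q0 m}. Arguments Rem {Q0 m}.
Arguments Push {Q0 m}. Arguments Rot {Q0 m}.

Section Automaton.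
Variables (Q0 : finType) (m P : nat) (prog : seq (instr Q0)) (start2 : nat).
Notation reg := 'I_m.+1.
Notation op := (op Q0 m).
Notation cell := (cell Q0 m P).
Notation kind := (option cell).

Definition rin : reg := inord 0.
Definition rk : reg := inord 1.
Definition rh : reg := inord 2.

Definition is_base (k : kind) := if k is Some c then isSome (ctl c) else false.
Definition is_zone (k : kind) := if k is Some c then ~~ isSome (ctl c) else false.
Definition lsin (r : kind) :=
  if r is Some c then if ctl c is None then ls c else None else None.
Definition mark_of (r : kind) j := if r is Some c then mk c j else false.
Definition sto_of (r : kind) := if r is Some c then sto c else None.

Definition set_mark (mk : {ffun reg -> bool}) j b : {ffun reg -> bool} :=
  [ffun i => if i == j then b else mk i].
Definition no_mark : {ffun reg -> bool} := [ffun=> false].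
Definition in_mark : {ffun reg -> bool} := [ffun i => i == rin].
Definition base_marks : {ffun reg -> bool} := [ffun i => i != rin].

(* Effect of an operation on a cell with right neighbour [r]: the new marks, the new letter,
   the operation sent on, and whether the cell has failed the test. *)
Definition apply_op (o : op) (ok : bool) (mk : {ffun reg -> bool}) (sto : option Q0) (r : kind) :=
  match o with
  | Nop => (mk, sto, Nop, false)
  | Inc j => if mk j then (set_mark mk j false, sto, Put j, false) else (mk, sto, Inc j, false)
  | Put j => (set_mark mk j true, sto, Nop, false)
  | Dec j => if mark_of r j then (set_mark mk j true, sto, Rem j, false)
             else (mk, sto, Dec j, false)
  | Rem j => (set_mark mk j false, sto, Nop, false)
  | Push a => (mk, Some a, if sto is Some b then Push b else Nop, false)
  | Rot a => if sto_of r is Some b then (mk, Some b, Rot a, false)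
             else (mk, Some a, Nop, false)
  | Test => if mk rk then (mk, sto, Nop, false)
            else if ok then (mk, sto, Test, false) else (mk, sto, Nop, true)
  end.

Definition is_reset (li : option (option bool)) := if li is Some (Some _) then true else false.

(** A zone cell without left neighbour vanishes, so the zone of a dead base is erased. An armed flag
    fires when a carry leaves the cell marked by [rh] at distance [h], that is when [2 ^ h] divides
    the new clock value; at the last cell the fired flag turns into the restart in the second mode.
    A signal coming from the right takes precedence over a new one. *)
Definition zone_next (z : cell) (l r : kind) : kind :=
  if l is Some lc then
    let li := lsin r in
    let rst := is_reset li in
    if sg lc is Some (ca, fl, o) then
      let: (mk', sto', o', die) := apply_op (if rst then Nop else o) (vir z) (mk z) (sto z) r in
      let co := ca && dig z in
      let fl' := if rst then None
                 else if [&& co, fl == Some false & mk z rh] then Some true else fl in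
      let fire := (fl' == Some true) && ~~ is_zone r in
      let gen := if (co && is_base r) || die then Some None
                 else if fire then Some (Some false) else None in
      Some (Cell None (vir z) (ca (+) dig z)
        (if rst then no_mark else if fire then in_mark else mk')
        (if rst || fire then None else sto')
        (Some (co, fl', o')) (if li is Some _ then li else gen))
    else Some (Cell None (vir z) (dig z) (if rst then no_mark else mk z)
           (if rst then None else sto z) None li)
  else None.

(** The new last cell bears the mark of register 0, so its own distance is the input [e], and it
    sends the restart that begins the computation. *)
Definition none_next (l : kind) : kind :=
  if l is Some lc then
    if sg lc is Some (true, _, _) then
      Some (Cell None false true in_mark None None (Some (Some true)))
    else None
  else None.

Definition issue (pc : nat) (b : cell) : op * nat * option bool :=
  match nth (IShow _ false) prog pc with
  | IInc r n => (Inc (inord r), n, None)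
  | IDec r n => (if mk b (inord r) then Nop else Dec (inord r), n, None)
  | IJz r z nz => (Nop, if mk b (inord r) then z else nz, None)
  | IPush a n => (Push a, n, None)
  | ITest n => (Test, n, None)
  | IShow fl => (if sto b is Some a then Rot a else Nop, pc, if fl then Some false else None)
  end.

(** The left neighbour does not occur: an agent depends on its right half-line only. [base_marks]
    puts every register but the input at 0. *)
Definition base_next (b : cell) (pc : 'I_P.+1) (r : kind) : kind :=
  if is_base r then None else
  match lsin r with
  | Some None => None
  | Some (Some md) =>
      Some (Cell (Some (inord (if md then 0 else start2))) (vir b) (dig b) base_marks None
        (Some (true, None, Nop)) None)
  | None =>
      let: (o, pc', fl) := issue pc b in
      let: (mk', sto', o', _) := apply_op o true (mk b) (sto b) r in
      Some (Cell (Some (inord pc')) (vir b) (dig b) mk' sto' (Some (true, fl, o')) None)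
  end.

Definition base_idle (b : cell) : kind :=
  Some (Cell (ctl b) (vir b) (dig b) (mk b) (sto b) None None).

Definition local (active : bool) (l c r : kind) : kind :=
  if c is Some z then
    if ctl z is Some pc then if active then base_next z pc r else base_idle z
    else zone_next z l r
  else none_next l.

(** Bases act in every second half-step only, which separates consecutive signals by an idle
    half-step. Signals can run two cells per step of the automaton, letters one. *)
Definition half_step active (C : nat -> kind) : nat -> kind :=
  fun z => local active (if z is z'.+1 then C z' else None) (C z) (C z.+1).

Fixpoint kinds (C : nat -> kind) t : nat -> kind :=
  if t is t'.+1 then half_step (~~ odd t') (kinds C t') else C.

Notation Q := (Q0 * kind)%type.

Definition next_letter (y : Q) : Q0 :=
  if y.2 is Some c then
    if ctl c is Some _ then if sto c is Some a then a else y.1 else y.1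
  else y.1.

Definition global (c : nat -> Q) : nat -> Q := fun z =>
  (if z is z'.+1 then next_letter (c z') else (c 0).1,
   half_step false (half_step true (fun i => (c i).2)) z).

Definition automaton : ca Q := @Ca Q 2 (fun y =>
  let k i := (tnth y (inord i)).2 in
  (next_letter (tnth y (inord 1)),
   local false (local true (k 0) (k 1) (k 2)) (local true (k 1) (k 2) (k 3))
     (local true (k 2) (k 3) (k 4)))).

Lemma kinds_global c t : (fun i => (iter t global c i).2) = kinds (fun i => (c i).2) t.*2.
Proof.
elim: t => // t IH; rewrite doubleS /= odd_double /= -IH.
by [].
Qed.

Lemma size_ca_img (v : seq Q) : size (ca_img automaton v) = size v - 4.
Proof. by case: v => // x v; rewrite size_map size_iota. Qed.

Lemma nth_ca_img d (v : seq Q) i : i + 4 < size v ->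
  nth d (ca_img automaton v) i = global (nth d v) i.+2.
Proof.
case: v => // x v Hi; set u := x :: v in Hi *.
have E : nth d (ca_img automaton u) i =
    rule automaton [tuple nth x u (i + j) | j < 5].
  by rewrite /= (nth_map 0) ?size_iota ?nth_iota //; move: Hi; rewrite /u /=; lia.
have Hs j : j < 5 -> nth x u (i + j) = nth d u (i + j).
  by move=> Hj; apply: set_nth_default; apply: leq_trans Hi; rewrite ltnS leq_add2l.
rewrite E /= !tnth_mktuple !inordK // !Hs //.
by rewrite !addnS addn0.
Qed.

(** Images of finite words are read in the dynamics on the half-line: cell [i] of the image lies at
    [i + 2 * t], out of reach of the artificial left boundary. *)
Lemma iter_ca_img d (v : seq Q) t :
  size (iter t (ca_img automaton) v) = size v - 4 * t /\
  forall i, i + 4 * t < size v ->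
    nth d (iter t (ca_img automaton) v) i = iter t global (nth d v) (i + 2 * t).
Proof.
elim: t => [|t [IHs IH]]; first by split=> [|i _]; rewrite /= ?subn0 ?addn0.
split; first by rewrite iterS size_ca_img IHs; lia.
move=> i Hi; rewrite !iterS nth_ca_img; last by rewrite IHs; lia.
have -> : i + 2 * t.+1 = (i + 2 * t).+2 by lia.
rewrite /global /half_step /=.
have E j : j <= 4 -> nth d (iter t (ca_img automaton) v) (i + j) = iter t global (nth d v) (i + 2 * t + j).
  by move=> Hj; rewrite IH; [congr (iter _ _ _ _)|]; lia.
move: (E 0 isT) (E 1 isT) (E 2 isT) (E 3 isT) (E 4 isT).
by rewrite !addnS !addn0 => -> -> -> -> ->.
Qed.

End Automaton.

(** * Clock zones *)

Definition bit v i := odd (v %/ 2 ^ i).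

(** Adding 1 with ripple carry: the carry reaches bit [i] exactly when [2 ^ i] divides [v.+1]. *)
Lemma bitS_carry v i : bit v.+1 i = (2 ^ i %| v.+1) (+) bit v i /\
  (2 ^ i.+1 %| v.+1) = (2 ^ i %| v.+1) && bit v i.
Proof.
have p0 : 0 < 2 ^ i by rewrite expn_gt0.
rewrite /bit expnS; move: (2 ^ i) p0 => p p0; set q := v %/ p.
case: (ltnP (v %% p).+1 p) => H.
  have E : v.+1 = q * p + (v %% p).+1 by lia.
  have Hn : p %| v.+1 = false by rewrite E dvdn_addr ?dvdn_mull // gtnNdvd.
  rewrite Hn; split; first by rewrite E divnMDl // (divn_small H) addn0.
  by apply/negP => /(dvdn_trans (dvdn_mull 2 (dvdnn p))); rewrite Hn.
have E : v.+1 = q.+1 * p by rewrite mulSn; lia.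
rewrite E dvdn_mull // mulnK //; split=> //.
by rewrite dvdn_pmul2r // dvdn2 /= negbK.
Qed.

Section InZone.
Variables (L0 V0 : nat).

(** Whether the [m]-th carry finds a zone cell at distance [d]: a cell beyond the initial ones is
    created when the clock value becomes [2 ^ d.-1]. *)
Definition in_zone d m := (d <= L0) || (2 ^ d.-1 <= V0 + m).

Lemma in_zone_le d d' m : d' <= d -> in_zone d m -> in_zone d' m.
Proof.
move=> H /orP[Hd|Hd]; apply/orP; [left; lia|right].
by apply: leq_trans Hd; rewrite leq_exp2l //; lia.
Qed.

Lemma in_zoneS d m : in_zone d m -> in_zone d m.+1.
Proof. by rewrite /in_zone => /orP[->//|H]; apply/orP; right; lia. Qed.

Lemma in_zone_new d m : 0 < d -> in_zone d.-1 m -> ~~ in_zone d m ->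
  in_zone d m.+1 = (2 ^ d.-1 %| (V0 + m).+1) /\ (in_zone d m.+1 -> V0 + m.+1 = 2 ^ d.-1).
Proof.
rewrite /in_zone !negb_or => d0 H1 /andP[/negbTE HL]; rewrite -ltnNge HL /= => Hv.
split; last by lia.
rewrite addnS; case: (ltnP (V0 + m).+1 (2 ^ d.-1)) => H.
  by rewrite gtnNdvd.
by have -> : (V0 + m).+1 = 2 ^ d.-1; [lia|rewrite dvdnn].
Qed.

Lemma in_zone_pred d m : in_zone d m -> in_zone d.-1 m.
Proof. by apply: in_zone_le; lia. Qed.

End InZone.

Section Dynamics.
Variables (Q0 : finType) (m0 P : nat) (prog : seq (instr Q0)) (start2 : nat).
Notation op := (op Q0 m0).
Notation cell := (cell Q0 m0 P).
Notation kind := (option cell).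
Notation local := (@local Q0 m0 P prog start2).

Definition carry_of (k : kind) :=
  if k is Some c then if sg c is Some (ca, _, _) then ca else false else false.
Definition has_sg (k : kind) := if k is Some c then isSome (sg c) else false.
Definition dig_of (k : kind) := if k is Some c then dig c else false.
Definition vir_of (k : kind) := if k is Some c then vir c else false.
Definition ls_of (k : kind) := if k is Some c then ls c else None.

Lemma is_base_zone (k : kind) : is_base k -> is_zone k = false.
Proof. by case: k => //= c ->. Qed.

Lemma zone_step act (l c r : kind) : is_zone c -> isSome l ->
  let c' := local act l c r in
  [/\ is_zone c', dig_of c' = carry_of l (+) dig_of c,
      carry_of c' = carry_of l && dig_of c, has_sg c' = has_sg l & vir_of c' = vir_of c].
Proof.
case: c => //= z; case: (ctl z) => //= _; case: l => //= lc _; rewrite /carry_of.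
case: (sg lc) => [[[ca fl] o]|] //=.
by case: (apply_op _ _ _ _ _) => [[[mk' sto'] o'] die].
Qed.

Lemma zone_step_ls act (l c r : kind) v : is_zone c -> isSome l -> lsin r = Some v ->
  ls_of (local act l c r) = Some v.
Proof.
case: c => //= z; case: (ctl z) => //= _; case: l => //= lc _; rewrite /ls_of => Hr.
case: (sg lc) => [[[ca fl] o]|] //=.
by case: (apply_op _ _ _ _ _) => [[[mk' sto'] o'] die]; rewrite Hr.
Qed.

Lemma zone_step_idle act (l c r : kind) : is_zone c -> isSome l -> ~~ has_sg l ->
  ls_of (local act l c r) = lsin r.
Proof.
case: c => //= z; case: (ctl z) => //= _; case: l => //= lc _; rewrite /ls_of.
by case: (sg lc).
Qed.

Lemma zone_step_collide act (l c r : kind) : is_zone c -> isSome l -> is_base r ->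
  carry_of (local act l c r) -> ls_of (local act l c r) = Some None.
Proof.
case: c => //= z; case: (ctl z) => //= _; case: l => //= lc _.
case: r => //= rc; case: (ctl rc) => //= a _; rewrite /ls_of /carry_of.
case: (sg lc) => [[[ca fl] o]|] //=.
by case: (apply_op _ _ _ _ _) => [[[mk' sto'] o'] die] /= ->.
Qed.

Lemma none_step act (l r : kind) :
  local act l None r =
  if carry_of l then Some (Cell None false true (in_mark m0) None None (Some (Some true))) else None.
Proof. by rewrite /= /carry_of; case: l => //= lc; case: (sg lc) => [[[[] fl] o]|]. Qed.

Lemma base_step act (l c r : kind) : is_base c -> ~~ is_zone (local act l c r).
Proof.
case: c => //= z; case E: (ctl z) => [pc|] //= _; case: act; last by rewrite /= E.
rewrite /base_next; case: (is_base r) => //; case: (lsin r) => [[md|]|] //.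
case: (issue _ _ _) => [[o pc'] fl] /=.
by case: (apply_op _ _ _ _ _) => [[[mk' sto'] o'] die].
Qed.

Lemma not_zone_step act (l c r : kind) : ~~ is_zone c -> ~~ carry_of l ->
  ~~ is_zone (local act l c r).
Proof.
case E : c => [z|] Hz Hl; last by rewrite none_step (negbTE Hl).
by apply: base_step; move: Hz; rewrite /= negbK.
Qed.

Lemma nonbase_step act (l c r : kind) : ~~ is_base c -> ~~ is_base (local act l c r).
Proof.
case: c => [z|] /=; last first.
  by move=> _; rewrite /none_next; case: l => // lc; case: (sg lc) => [[[[] ?] ?]|].
case: (ctl z) => //= _; rewrite /zone_next; case: l => // lc.
case: (sg lc) => [[[ca fl] o]|] //.
by case: (apply_op _ _ _ _ _) => [[[mk' sto'] o'] die].
Qed.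

Lemma base_two_steps (l l' k r r' : kind) : is_base k ->
  let k1 := local true l k r in is_base k1 ->
  [/\ ~~ is_base r, lsin r <> Some None, carry_of k1, has_sg k1 & ~~ has_sg (local false l' k1 r')].
Proof.
case: k => //= b; case Eb: (ctl b) => [pc|] //= _; rewrite /base_next.
case: (is_base r) => //; case El : (lsin r) => [[md|]|] //=.
case: (issue _ _ _) => [[o pc'] fl] /=.
by case: (apply_op _ _ _ _ _) => [[[mk' sto'] o'] die].
Qed.

Section Config.
Variable C : nat -> kind.
Notation K := (kinds prog start2 C).

Definition left_of t d := if d is d'.+1 then K t d' else None.

Lemma K_step t d : K t.+1 d = local (~~ odd t) (left_of t d) (K t d) (K t d.+1).
Proof. by case: d. Qed.

Lemma base_back t z t' : t <= t' -> is_base (K t' z) -> is_base (K t z).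
Proof.
move=> /subnK <-; elim: (t' - t) => // k IH; rewrite addSn K_step => H; apply: IH.
by apply: contraLR H; exact: nonbase_step.
Qed.

Definition alive n := is_base (K n.*2 0).

Lemma alive_at n t : alive n -> t <= n.*2 -> is_base (K t 0).
Proof. by move=> A H; apply: base_back A. Qed.

Lemma alive_step n m : alive n -> m < n ->
  [/\ ~~ is_base (K m.*2 1), lsin (K m.*2 1) <> Some None,
      is_base (K m.*2.+1 0) /\ carry_of (K m.*2.+1 0),
      has_sg (K m.*2.+1 0) & ~~ has_sg (K m.*2.+2 0)].
Proof.
move=> A Hm; have B0 : is_base (K m.*2 0) by apply: (alive_at A); lia.
have B1 : is_base (K m.*2.+1 0) by apply: (alive_at A); lia.
have E1 : K m.*2.+1 0 = local true None (K m.*2 0) (K m.*2 1) by rewrite K_step odd_double.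
have E2 : K m.*2.+2 0 = local false None (K m.*2.+1 0) (K m.*2.+1 1).
  by rewrite K_step oddS odd_double.
rewrite E1 in B1; have [H1 H2 H3 H4 H5] := base_two_steps None (K m.*2.+1 1) B0 B1.
by rewrite -E1 -E2 in H3 H4 H5 B1 *; split.
Qed.

Definition zones D t := forall c, 0 < c <= D -> is_zone (K t c).

Lemma zones_step D t : is_base (K t 0) -> zones D t -> zones D t.+1.
Proof.
move=> B0 H c Hc; rewrite K_step.
have : isSome (left_of t c).
  case: c Hc => // -[|c] Hc /=; first by case: (K t 0) B0.
  by have := H c.+1 ltac:(lia); case: (K t c.+1).
by move=> Hl; have [] := zone_step (~~ odd t) (K t c.+1) (H c Hc) Hl.
Qed.

Lemma zones_diag D s : is_base (K (s + D) 0) ->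
  (forall c, 0 < c <= D -> is_zone (K (s + c) c)) -> zones D (s + D).
Proof.
elim: D => [|D IH] B H c Hc; first by lia.
case: (eqVneq c D.+1) => [->|Hne]; first by apply: H; lia.
rewrite addnS; apply: zones_step; [by apply: base_back B; lia| |]; last first.
  by instantiate (1 := D); lia.
by apply: IH => [|c' Hc']; [apply: base_back B|apply: H]; lia.
Qed.

Lemma lsin_zone (k : kind) : is_zone k -> lsin k = ls_of k.
Proof. by case: k => //= c; case: (ctl c). Qed.

Lemma signal_travels D t v : zones D t -> ls_of (K t D) = Some v -> 0 < D ->
  is_base (K (t + D.-1) 0) -> lsin (K (t + D.-1) 1) = Some v.
Proof.
elim: D t => // -[|D] IH t H E _ B; first by rewrite addn0 lsin_zone //; apply: H.
have B' : is_base (K t 0) by apply: base_back B; lia.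
have Z1 := zones_step B' H.
move: B; rewrite /= addnS -addSn => B; apply: (IH t.+1) => //.
  by move=> c Hc; apply: Z1; lia.
rewrite K_step; apply: zone_step_ls; first by apply: H; lia.
  case: D {IH B Z1 E} H => [|D] H /=; last by have := H D.+1 ltac:(lia); case: (K t D.+1).
  by case: (K t 0) B'.
by rewrite lsin_zone //; apply: H; lia.
Qed.

Section Skeleton.
Variables (n L0 V0 : nat).
Hypothesis A : alive n.
Hypothesis init : forall d, 0 < d <= L0 -> is_zone (K d d) /\ dig_of (K d d) = bit V0 d.-1.
Hypothesis init_end : ~~ is_zone (K L0.+1 L0.+1).
Hypothesis V0_lt : V0 < 2 ^ L0.

Notation in_zone := (in_zone L0 V0).

(** Half-step [2 * m + d] at distance [d] lies on the path of the [m]-th carry. On this path the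
    digits spell [V0 + m] before the carry and [V0 + m + 1] after it, and an idle half-step
    follows. *)
Record skeleton d m : Prop := Skeleton {
  sk_pre : is_zone (K (m.*2 + d) d) = in_zone d m;
  sk_dig : in_zone d m -> dig_of (K (m.*2 + d) d) = bit (V0 + m) d.-1;
  sk_post : is_zone (K (m.*2 + d).+1 d) = in_zone d m.+1;
  sk_post_dig : in_zone d m.+1 -> dig_of (K (m.*2 + d).+1 d) = bit (V0 + m.+1) d.-1;
  sk_carry : in_zone d m -> carry_of (K (m.*2 + d).+1 d) = (2 ^ d %| (V0 + m).+1);
  sk_sg : in_zone d m -> has_sg (K (m.*2 + d).+1 d);
  sk_idle : is_zone (K (m.*2 + d).+2 d) = in_zone d m.+1;
  sk_idle_dig : in_zone d m.+1 -> dig_of (K (m.*2 + d).+2 d) = bit (V0 + m.+1) d.-1;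
  sk_idle_sg : is_zone (K (m.*2 + d).+2 d) -> ~~ has_sg (K (m.*2 + d).+2 d);
  sk_new : in_zone d m.+1 -> ~~ in_zone d m ->
    K (m.*2 + d).+1 d = Some (Cell None false true (in_mark m0) None None (Some (Some true))) }.


(** A carry meeting a foreign base would send back a kill signal, which would reach its own base
    before half-step [2 * (m + d)], although this base is alive at [n]. *)
Lemma carry_into_base d m : 0 < d -> m + d <= n ->
  (forall c, 0 < c < d -> skeleton c m) -> in_zone d.-1 m ->
  carry_of (left_of (m.*2 + d) d) -> ~~ is_base (K (m.*2 + d) d).
Proof.
case: d => // d _ Hmd Hsk Hin /= Hc; apply/negP => Hb.
have Hm : m < n by lia.
case: d Hmd Hsk Hin Hc Hb => [|d] Hmd Hsk Hin Hc Hb.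
  have [H _ _ _ _] := alive_step A Hm.
  by move/negP: H; apply; apply: base_back Hb; lia.
have sk := Hsk d.+1 ltac:(lia).
have Zd : zones d.+1 (m.*2 + d.+1).
  apply: zones_diag; first by apply: (alive_at A); lia.
  move=> c Hc'; rewrite (sk_pre (Hsk c ltac:(lia))); apply: in_zone_le Hin => /=; lia.
have Ez : is_zone (K (m.*2 + d.+1) d.+1) by apply: Zd; lia.
have El : isSome (left_of (m.*2 + d.+1) d.+1).
  case: d {Hmd Hsk Hin Hc Hb sk Ez} Zd => [|d] Zd /=; last first.
    by have := Zd d.+1 ltac:(lia); case: (K _ d.+1).
  by have : is_base (K (m.*2 + 1) 0); [apply: (alive_at A); lia|case: (K _ 0)].
have Eb : is_base (K (m.*2 + d.+1) d.+2) by apply: base_back Hb; lia.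
have Els : ls_of (K (m.*2 + d.+1).+1 d.+1) = Some None.
  rewrite K_step; apply: zone_step_collide => //.
  by rewrite -K_step -addnS.
have Z' : zones d.+1 (m.*2 + d.+1).+1 by apply: zones_step Zd; apply: (alive_at A); lia.
have := signal_travels Z' Els isT.
have -> : (m.*2 + d.+1).+1 + d.+1.-1 = (m + d.+1).*2 by lia.
move=> H; have [_ Hn _ _ _] : [/\ ~~ is_base (K (m + d.+1).*2 1), lsin (K (m + d.+1).*2 1) <> Some None,
   is_base (K (m + d.+1).*2.+1 0) /\ carry_of (K (m + d.+1).*2.+1 0),
   has_sg (K (m + d.+1).*2.+1 0) & ~~ has_sg (K (m + d.+1).*2.+2 0)] by apply: alive_step; lia.
by apply: Hn; apply: H; apply: (alive_at A); lia.
Qed.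

Lemma skeleton_step d m : 0 < d -> m + d <= n -> in_zone d.-1 m ->
  (forall c, 0 < c < d -> skeleton c m) ->
  is_zone (K (m.*2 + d) d) = in_zone d m ->
  (in_zone d m -> dig_of (K (m.*2 + d) d) = bit (V0 + m) d.-1) ->
  skeleton d m.
Proof.
move=> d0 Hmd Hin Hsk Hz Hdig.
have Hm : m < n by lia.
have [_ _ [Hb1 Hc1] Hs1 Hs2] := alive_step A Hm.
have B2 : is_base (K m.*2.+2 0) by apply: (alive_at A); lia.
have [l1 l2 l3] : [/\ isSome (left_of (m.*2 + d) d),
    carry_of (left_of (m.*2 + d) d) = (2 ^ d.-1 %| (V0 + m).+1) & has_sg (left_of (m.*2 + d) d)].
  case: d d0 Hmd Hin Hsk {Hz Hdig} => // -[|d] _ Hmd Hin Hsk /=.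
    rewrite addn1 expn0 dvd1n Hc1; split=> //.
    by move: Hb1; case: (kinds _ _ _ m.*2.+1 0).
  have sk := Hsk d.+1 ltac:(lia); rewrite addnS.
  split; [|exact: (sk_carry sk)|exact: (sk_sg sk)].
  by have := sk_post sk; rewrite (in_zoneS Hin); case: (K _ d.+1).
have [l4 l5] : isSome (left_of (m.*2 + d).+1 d) /\ ~~ has_sg (left_of (m.*2 + d).+1 d).
  case: d d0 Hmd Hin Hsk {Hz Hdig l1 l2 l3} => // -[|d] _ Hmd Hin Hsk.
    by rewrite addn1 /left_of; split; [move: B2; case: (kinds _ _ _ m.*2.+2 0)|].
  have sk := Hsk d.+1 ltac:(lia); rewrite addnS.
  have Z : is_zone (K (m.*2 + d.+1).+2 d.+1) by rewrite (sk_idle sk) (in_zoneS Hin).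
  by split; [move: Z; rewrite /left_of; case: (K _ d.+1)|exact: (sk_idle_sg sk Z)].
have l6 : ~~ carry_of (left_of (m.*2 + d).+1 d).
  by move: l5; rewrite /has_sg /carry_of; case: (left_of _ _) => // c; case: (sg c).
have idle (Ez : is_zone (K (m.*2 + d).+1 d)) :
    [/\ is_zone (K (m.*2 + d).+2 d), dig_of (K (m.*2 + d).+2 d) = dig_of (K (m.*2 + d).+1 d) &
      ~~ has_sg (K (m.*2 + d).+2 d)].
  rewrite K_step; have [H1 H2 _ H3 _] := zone_step (~~ odd (m.*2 + d).+1) (K (m.*2 + d).+1 d.+1) Ez l4.
  by rewrite H1 H2 H3 (negbTE l6).
have no_sg_idle : is_zone (K (m.*2 + d).+2 d) -> ~~ has_sg (K (m.*2 + d).+2 d).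
  move=> H; case Ez : (is_zone (K (m.*2 + d).+1 d)); first by have [] := idle Ez.
  have := not_zone_step (~~ odd (m.*2 + d).+1) (K (m.*2 + d).+1 d.+1) (negbT Ez) l6.
  by rewrite -K_step H.
have [Eb1 Eb2] := bitS_carry (V0 + m) d.-1; rewrite prednK // in Eb2.
case Ein : (in_zone d m); rewrite Ein in Hz.
  have [p1 p2 p3 p4 _] := zone_step (~~ odd (m.*2 + d)) (K (m.*2 + d) d.+1) Hz l1.
  rewrite -K_step l2 (Hdig Ein) l3 in p1 p2 p3 p4.
  have [q1 q2 q3] := idle p1.
  have InS := in_zoneS Ein.
  split; rewrite ?Hz ?p1 ?q1 ?Ein ?InS // => _.
  - exact: Hdig.
  - by rewrite p2 addnS Eb1.
  - by rewrite p3 Eb2.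
  - by rewrite q2 p2 addnS Eb1.
have [N1 N2] := in_zone_new d0 Hin (negbT Ein).
case Ec : (in_zone d m.+1).
  rewrite Ec in N1; have Hc : carry_of (left_of (m.*2 + d) d) by rewrite l2 -N1.
  have Hnb := carry_into_base d0 Hmd Hsk Hin Hc.
  have En : K (m.*2 + d) d = None.
    by move: Hz Hnb; case: (K _ d) => //= c; case: (ctl c).
  have Enew : K (m.*2 + d).+1 d = Some (Cell None false true (in_mark m0) None None (Some (Some true))).
    by rewrite K_step En none_step Hc.
  have p1 : is_zone (K (m.*2 + d).+1 d) by rewrite Enew.
  have [q1 q2 q3] := idle p1.
  have Ebit : bit (V0 + m.+1) d.-1 = true by rewrite (N2 Ec) /bit divnn expn_gt0.
  by split; rewrite ?Hz ?p1 ?q1 ?Ein ?Ec ?q2 ?Enew ?Ebit.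
have Hnc : ~~ carry_of (left_of (m.*2 + d) d) by rewrite l2 -N1 Ec.
have p1 : ~~ is_zone (K (m.*2 + d).+1 d) by rewrite K_step; apply: not_zone_step; rewrite ?Hz.
have q1 : ~~ is_zone (K (m.*2 + d).+2 d) by rewrite K_step; apply: not_zone_step.
split; rewrite ?Hz ?(negbTE p1) ?(negbTE q1) ?Ein ?Ec //.
Qed.

(** A cell is created without a signal of its own, so the zone cannot grow by a second cell before
    the next carry arrives. *)
Lemma beyond_zone d m : 0 < d -> m + d <= n -> in_zone d.-1 m.+1 -> ~~ in_zone d.-1 m ->
  (forall d, 0 < d -> m + d <= n -> in_zone d.-1 m -> skeleton d m) ->
  ~~ is_zone (K (m.+1.*2 + d) d).
Proof.
case: d => // -[|d] _ Hmd Hin Hnot IH; first by move: Hnot; rewrite /in_zone.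
have Hin' : in_zone d m.
  move: Hin Hnot; rewrite /in_zone /= !negb_or => /orP[->//|H] /andP[H1 H2].
  case: d H H1 H2 {Hmd} => [|d] H H1 H2; first by rewrite leq0n.
  apply/orP; right; rewrite /=; move: H H2; rewrite /= expnS; have := expn_gt0 2 d; lia.
have sk := IH d.+1 isT ltac:(lia) Hin'.
have En : K (m.*2 + d.+1) d.+1 = None.
  have Z := sk_pre sk; rewrite (negbTE Hnot) in Z.
  have Zp := sk_post sk; rewrite Hin K_step in Zp.
  case E : (K (m.*2 + d.+1) d.+1) Z Zp => [c|] // Z Zp.
  have Hb : is_base (Some c) by move: Z => /= /negbFE.
  by have := base_step (~~ odd (m.*2 + d.+1)) (left_of (m.*2 + d.+1) d.+1) (K (m.*2 + d.+1) d.+2) Hb; rewrite Zp.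
have Z0 : ~~ is_zone (K (m.*2 + d.+1).+1 d.+2).
  rewrite K_step /left_of En; case: (K _ d.+2) => [c|] //.
  case Eb : (is_base (Some c)); first exact: base_step.
  by move: Eb; rewrite /=; case: (ctl c).
have Z1 : ~~ is_zone (K (m.*2 + d.+1).+2 d.+2).
  by rewrite K_step /left_of; apply: not_zone_step => //; rewrite (sk_new sk Hin Hnot).
have -> : m.+1.*2 + d.+2 = (m.*2 + d.+1).+3 by lia.
rewrite K_step /left_of; apply: not_zone_step => //.
have Zi : is_zone (K (m.*2 + d.+1).+2 d.+1) by rewrite (sk_idle sk).
have := sk_idle_sg sk Zi; rewrite /has_sg /carry_of.
by case: (kinds _ _ _ _ _) => // c; case: (sg c).
Qed.

(** Induction on the carry, then along its path. The bound [m + d <= n] is a light cone: news from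
    there needs until half-step [2 * (m + d)] to come back to the base. *)
Lemma skeletonP m d : 0 < d -> m + d <= n -> in_zone d.-1 m -> skeleton d m.
Proof.
elim: m d => [|m IHm]; elim/ltn_ind => d IHd d0 Hmd Hin.
  have Hlow c : 0 < c < d -> skeleton c 0.
    by move=> Hc; apply: IHd; [lia|lia|lia|apply: in_zone_le Hin; lia].
  case: (leqP d L0) => HL.
    have [|i1 i2] := @init d; first by lia.
    apply: skeleton_step => //; rewrite add0n ?addn0 //.
    by rewrite i1 /in_zone HL.
  have Ed : d = L0.+1.
    move: Hin; rewrite /in_zone addn0 => /orP[H|H]; first by lia.
    case: (leqP d L0.+1) => H'; first by lia.
    have : 2 ^ L0 <= 2 ^ d.-2 by rewrite leq_exp2l //; lia.
    have : 2 ^ d.-2 <= 2 ^ d.-1.-1 by rewrite leq_exp2l.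
    case: d {IHd d0 Hmd Hlow HL} H H' => [|[|d]] //= H H'.
    by rewrite leq_exp2l // => Hl; lia.
  have Nin : in_zone d 0 = false.
    by rewrite /in_zone addn0 Ed /= ltnn /=; apply/negbTE; rewrite -ltnNge.
  by apply: skeleton_step => //; rewrite ?Nin // add0n Ed; apply: negbTE.
have Hlow c : 0 < c < d -> skeleton c m.+1.
  by move=> Hc; apply: IHd; [lia|lia|lia|apply: in_zone_le Hin; lia].
case Em : (in_zone d.-1 m).
  have sk := IHm d d0 ltac:(lia) Em.
  have Et : m.+1.*2 + d = (m.*2 + d).+2 by lia.
  by apply: skeleton_step => //; rewrite Et; [apply: (sk_idle sk)|apply: (sk_idle_dig sk)].
have Nz := @beyond_zone d m d0 ltac:(lia) Hin (negbT Em) (fun d H1 H2 H3 => IHm d H1 H2 H3).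
have Nin : in_zone d m.+1 = false.
  apply/negP => H; move: Hin (negbT Em) H; rewrite /in_zone !negb_or => Hin /andP[H1 H2].
  case: d d0 {IHd Hmd Hlow Em Nz} Hin H1 H2 => // -[|d] _ //= _ H1 H2 /orP[H|H]; first by lia.
  by move: H H2; rewrite expnS; have := expn_gt0 2 d; lia.
by apply: skeleton_step => //; rewrite ?Nin //; apply: negbTE.
Qed.

End Skeleton.
End Config.
End Dynamics.

(** * One instruction as an operation travelling through the zone *)

Section Simulation.
Variables (Q0 : finType) (m0 P : nat) (prog : seq (instr Q0)) (start2 : nat).
Hypothesis m0_ge : 2 <= m0.
Notation reg := 'I_m0.+1.
Notation op := (op Q0 m0).
Notation cell := (cell Q0 m0 P).
Notation kind := (option cell).
Implicit Types (A : state Q0) (d : nat).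

Definition instr_ok (i : instr Q0) :=
  match i with
  | IInc r n | IDec r n => (r <= m0) && (n <= P)
  | IJz r z nz => [&& r <= m0, z <= P & nz <= P]
  | IPush _ n | ITest n => n <= P
  | IShow _ => true
  end.

Definition represents (mk : {ffun reg -> bool}) (sto : option Q0) A d :=
  (forall j : reg, mk j = (A.1.2 (val j) == d)) /\ sto = nth None (map Some A.2) d.

(* The operation leaving the cell at distance [d] while instruction [at_pc prog A] is executed. *)
Definition outop A d : op :=
  match at_pc prog A with
  | IInc r _ => if d < A.1.2 r then Inc (inord r) else if d == A.1.2 r then Put (inord r) else Nop
  | IDec r _ => if d.+1 < A.1.2 r then Dec (inord r)
                else if d.+1 == A.1.2 r then Rem (inord r) else Nop
  | IJz _ _ _ => Nop
  | IPush _ _ => if nth None (map Some A.2) d is Some b then Push b else Nop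
  | ITest _ => if d < A.1.2 1 then Test else Nop
  | IShow _ => if A.2 is a :: q then if d < size q then Rot a else Nop else Nop
  end.

Lemma inord_eq r (j : reg) : r <= m0 -> (j == inord r) = (val j == r).
Proof. by move=> H; rewrite -val_eqE /= inordK. Qed.

Lemma nth_some_lt (q : seq Q0) d : d < size q -> exists b, nth None (map Some q) d = Some b.
Proof.
case: q => // a q H; exists (nth a (a :: q) d).
by rewrite (nth_map a).
Qed.

Lemma nth_some_ge (q : seq Q0) d : size q <= d -> nth None (map Some q) d = None.
Proof. by move=> H; rewrite nth_default ?size_map. Qed.

Lemma nth_rot1 (a : Q0) q d : nth None (map Some (rot 1 (a :: q))) d =
  if d < size q then nth None (map Some q) d else if d == size q then Some a else None.
Proof.
rewrite rot1_cons map_rcons nth_rcons size_map.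
by case: ltnP.
Qed.

(** When the operation is at distance [d] it has not yet reached the right neighbour, which still
    represents the old state [A]; this makes the look-ahead of [Dec] and [Rot] correct. *)
Lemma apply_op_zone e A d (marks : {ffun reg -> bool}) (x : option Q0) (r : kind) (ok : bool) :
  instr_ok (at_pc prog A) ->
  bounded (fun v => v <= e) A -> 0 < d <= e -> represents marks x A d ->
  (d < e -> exists2 c, r = Some c & represents (mk c) (sto c) A d.+1) ->
  (outop A d.-1 = Test -> d < A.1.2 1 -> ok) ->
  exists mk' sto', apply_op (outop A d.-1) ok marks x r = (mk', sto', outop A d, false) /\
    represents mk' sto' (step prog A) d.
Proof.
case: A => [[pc rho] q] /=; rewrite /outop /at_pc /= => Hok [Hrho Hq] Hd [Hmk Hsto] Hr Htest.
case: d Hd Hmk Hsto Hr Htest => // d Hd Hmk Hsto Hr Htest; rewrite /= in Hrho Hq Hmk Hsto Htest *.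
case: (nth _ prog pc) Hok Htest => [r' n|r' n|r' z nz|a n|n|b] /= Hok Htest.
- move/andP: Hok => [Hok _].
  have Hj : marks (inord r') = (rho r' == d.+1) by rewrite Hmk inordK.
  case: (ltnP d (rho r')) => H1.
    rewrite /= Hj eq_sym; case: eqP => H2.
      have -> : (d.+1 < rho r') = false by lia.
      do 2 eexists; split; first by [].
      split => // j; rewrite ffunE inord_eq // /upd /=.
      by case: eqP => [_|//]; lia.
    have -> : (d.+1 < rho r') = true by lia.
    do 2 eexists; split; first by [].
    split => // j; rewrite Hmk /upd /=; case: (nat_of_ord j =P r') => [->|//].
    by lia.
  have -> : d.+1 < rho r' = false by lia.
  have -> : (d.+1 == rho r') = false by lia.
  case: eqP => H2; rewrite /=; (do 2 eexists; split; first by []); split => // j.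
    rewrite ffunE inord_eq // /upd /=; case: eqP => [_|//].
    by rewrite H2 eqxx.
  rewrite Hmk /upd /=; case: (nat_of_ord j =P r') => [->|//].
  by lia.
- move/andP: Hok => [Hok _].
  case: (ltnP d.+1 (rho r')) => H1.
    have Hde : d.+1 < e by have := Hrho r'; rewrite /=; lia.
    have [c -> [Hc _]] := Hr Hde.
    have Hj : mk c (inord r') = (rho r' == d.+2) by rewrite Hc /= inordK.
    rewrite /= Hj eq_sym; case: eqP => H2.
      have -> : (d.+2 < rho r') = false by lia.
      do 2 eexists; split; first by [].
      split => // j; rewrite ffunE inord_eq // /upd /=.
      by case: eqP => [_|//]; lia.
    have -> : (d.+2 < rho r') = true by lia.
    do 2 eexists; split; first by [].
    split => // j; rewrite Hmk /upd /=; case: (nat_of_ord j =P r') => [->|//].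
    by lia.
  have -> : d.+2 < rho r' = false by lia.
  have -> : (d.+2 == rho r') = false by lia.
  case: eqP => H2; rewrite /=; (do 2 eexists; split; first by []); split => // j.
    rewrite ffunE inord_eq // /upd /=; case: eqP => [_|//].
    by rewrite -H2; lia.
  rewrite Hmk /upd /=; case: (nat_of_ord j =P r') => [->|//].
  by lia.
- by do 2 eexists; split; first by [].
- case E : (nth None (map Some q) d) => [b|].
    by rewrite /= Hsto; do 2 eexists; split; first by [].
  have Hqd : size q <= d.
    by rewrite leqNgt; apply/negP => H; have [b Hb] := nth_some_lt H; rewrite E in Hb.
  rewrite /= [nth None _ d.+1]nth_some_ge; last by lia.
  do 2 eexists; split; first by [].
  by split => //; rewrite Hsto /= E nth_some_ge //; lia.
- case: (ltnP d (rho 1)) => H1; last first.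
    have -> : d.+1 < rho 1 = false by lia.
    by do 2 eexists; split; first by [].
  have Hj : marks (rk m0) = (rho 1 == d.+1) by rewrite Hmk inordK //; lia.
  rewrite /= Hj; case: eqP => H2.
    rewrite H2 ltnn; by do 2 eexists; split; first by [].
  have H3 : d.+1 < rho 1 by lia.
  rewrite H3; move: Htest; rewrite H1 => -> //.
  by do 2 eexists; split; first by [].
- case: q {Htest} Hq Hsto Hr => [|a q] Hq Hsto Hr.
    by rewrite /=; do 2 eexists; split; first by [].
  case: (ltnP d (size q)) => H1.
    case: (ltnP d.+1 (size q)) => H2.
      have [c -> [_ Hc]] := Hr ltac:(by move: Hq; rewrite /=; lia).
      have [a' Hb] := nth_some_lt H2.
      rewrite /= in Hc; rewrite /= Hc Hb.
      do 2 eexists; split; first by [].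
      by split => //; rewrite nth_rot1 H2 Hb.
    have Ed : d.+1 = size q by lia.
    have [c -> [_ Hc]] := Hr ltac:(by move: Hq; rewrite /=; lia).
    rewrite /= in Hc; rewrite /= Hc nth_some_ge //.
    do 2 eexists; split; first by [].
    by split => //; rewrite nth_rot1 Ed ltnn eqxx.
  have -> : d.+1 < size q = false by lia.
  rewrite /=; do 2 eexists; split; first by [].
  split => //; rewrite nth_rot1 Hsto /= ifF; last by lia.
  by rewrite ifF ?nth_some_ge //; lia.
Qed.

Definition armed A := if at_pc prog A is IShow true then Some false else None.

Lemma issue_base e A (b : cell) (r : kind) : instr_ok (at_pc prog A) -> 0 < e ->
  bounded (fun v => v <= e) A -> represents (mk b) (sto b) A 0 ->
  (exists2 c, r = Some c & represents (mk c) (sto c) A 1) ->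
  let: (o, pc', fl) := issue prog A.1.1 b in
  exists mk' sto' die, [/\ apply_op o true (mk b) (sto b) r = (mk', sto', outop A 0, die),
    represents mk' sto' (step prog A) 0, pc' = (step prog A).1.1 & fl = armed A].
Proof.
case: A => [[pc rho] q] /=; rewrite /outop /armed /at_pc /issue /= => Hok e0 [Hrho Hq] [Hmk Hsto] [c -> [Hc Hcs]].
rewrite /= in Hmk Hsto Hc Hcs Hrho Hq.
case: (nth _ prog pc) Hok => [r' n|r' n|r' z nz|a n|n|s] /= Hok.
- move/andP: Hok => [Hok _].
  have Hj : mk b (inord r') = (rho r' == 0) by rewrite Hmk inordK.
  rewrite Hj; case: posnP => H1.
    rewrite H1 /=; do 3 eexists; split; try by [].
    by split => // j; rewrite ffunE inord_eq // /upd /=; case: eqP.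
  do 3 eexists; split; try by [].
  split => // j; rewrite Hmk /upd /=; case: (nat_of_ord j =P r') => // ->.
  by lia.
- move/andP: Hok => [Hok _].
  have Hj : mk b (inord r') = (rho r' == 0) by rewrite Hmk inordK.
  have Hj2 : mk c (inord r') = (rho r' == 1) by rewrite Hc inordK.
  rewrite Hj; case: posnP => H1.
    rewrite H1 /=; do 3 eexists; split; try by [].
    by split => // j; rewrite Hmk /upd /=; case: (nat_of_ord j =P r') => // ->; rewrite H1.
  rewrite /= Hj2; case: eqP => H2.
    rewrite H2 /=; do 3 eexists; split; try by [].
    split => // j; rewrite ffunE inord_eq // /upd /=.
    by case: eqP => // _; rewrite ?H2.
  have -> : 1 < rho r' by lia.
  do 3 eexists; split; try by [].
  split => // j; rewrite Hmk /upd /=; case: (nat_of_ord j =P r') => // ->.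
  by lia.
- move/and3P: Hok => [Hok _ _]; rewrite Hmk inordK //.
  by do 3 eexists; split; try by [].
- rewrite Hsto; do 3 eexists; split; try by [].
- have Hj : mk b (rk m0) = (rho 1 == 0) by rewrite Hmk inordK //; lia.
  rewrite Hj; case: posnP => H1; do 3 eexists; split; try by [].
- case: q Hq Hsto Hcs => [|a q] Hq Hsto Hcs; rewrite Hsto /=.
    by do 3 eexists; split; try by []; case: s.
  rewrite Hcs /=; case: q Hq Hcs {Hsto} => [|a' q] Hq Hcs /=.
    by do 3 eexists; split; try by []; case: s.
  by do 3 eexists; split; try by []; case: s.
Qed.

Lemma step_pc_ok A : all instr_ok prog -> A.1.1 <= P -> (step prog A).1.1 <= P.
Proof.
case: A => [[pc rho] q] /= Hok Hpc.
case: (ltnP pc (size prog)) => H; last by rewrite nth_default.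
have := all_nthP (IShow _ false) Hok pc H.
case: (nth _ prog pc) => [r n|r n|r z nz|a n|n|b] //=; try by case/andP.
by case/and3P; case: eqP.
Qed.

Lemma at_pc_ok A : all instr_ok prog -> instr_ok (at_pc prog A).
Proof.
move=> Hok; rewrite /at_pc; case: (ltnP A.1.1 (size prog)) => H; last by rewrite nth_default.
exact: (all_nthP _ Hok).
Qed.

End Simulation.

Local Arguments kinds : simpl never.

(** * The space-time wedge between two restarts *)

Section Segment.
Variables (Q0 : finType) (m0 P : nat) (prog : seq (instr Q0)) (start2 : nat).
Hypothesis m0_ge : 2 <= m0.
Hypothesis prog_ok : all (instr_ok m0 P) prog.
Hypothesis start2_ok : start2 <= P.
Notation cell := (cell Q0 m0 P).
Notation kind := (option cell).
Notation local := (@local Q0 m0 P prog start2).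

Lemma zone_step_reset act (l : kind) (z : cell) (r : kind) md : ctl z = None -> has_sg l ->
  lsin r = Some (Some md) -> exists ca vi di,
  local act l (Some z) r =
    Some (Cell None vi di (no_mark m0) None (Some (ca, None, Nop)) (Some (Some md))).
Proof.
move=> Ez; rewrite /local Ez /zone_next; case: l => //= lc; case: (sg lc) => //= -[[ca fl] o] _ ->.
by rewrite /=; do 3 eexists.
Qed.

Lemma zone_step_keep act (l : kind) (z : cell) (r : kind) : ctl z = None -> isSome l ->
  ~~ has_sg l -> lsin r = None ->
  local act l (Some z) r = Some (Cell None (vir z) (dig z) (mk z) (sto z) None None).
Proof.
by move=> Ez; rewrite /local Ez /zone_next; case: l => //= lc _; case: (sg lc) => //= _ ->.
Qed.

Lemma zone_step_main act (lc z : cell) (r : kind) ca fl o :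
  ctl z = None -> sg lc = Some (ca, fl, o) -> lsin r = None ->
  let: (mk', sto', o', die) := apply_op o (vir z) (mk z) (sto z) r in
  let co := ca && dig z in
  let fl' := if [&& co, fl == Some false & mk z (rh m0)] then Some true else fl in
  let fire := (fl' == Some true) && ~~ is_zone r in
  local act (Some lc) (Some z) r = Some (Cell None (vir z) (ca (+) dig z)
     (if fire then in_mark m0 else mk') (if fire then None else sto') (Some (co, fl', o'))
     (if (co && is_base r) || die then Some None else if fire then Some (Some false) else None)).
Proof.
move=> Ez El Er; rewrite /local Ez /zone_next El Er /=.
by case: (apply_op _ _ _ _ _) => [[[mk' sto'] o'] die].
Qed.

Lemma base_step_reset (l : kind) (b : cell) (r : kind) md : is_base (Some b) ->
  ~~ is_base r -> lsin r = Some (Some md) ->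
  local true l (Some b) r = Some (Cell (Some (inord (if md then 0 else start2))) (vir b) (dig b)
     (base_marks m0) None (Some (true, None, Nop)) None).
Proof.
by rewrite /= /base_next; case: (ctl b) => // pc _ /negbTE -> ->.
Qed.

Lemma base_step_main (l : kind) (b : cell) pc (r : kind) : ctl b = Some pc ->
  ~~ is_base r -> lsin r = None ->
  let: (o, pc', fl) := issue prog pc b in
  let: (mk', sto', o', _) := apply_op o true (mk b) (sto b) r in
  local true l (Some b) r =
    Some (Cell (Some (inord pc')) (vir b) (dig b) mk' sto' (Some (true, fl, o')) None).
Proof.
move=> Eb /negbTE Hr El; rewrite /local Eb /base_next Hr El.
case: (issue _ _ _) => [[o pc'] fl].
by case: (apply_op _ _ _ _ _) => [[[mk' sto'] o'] die].
Qed.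

Section Config.
Variable C : nat -> kind.
Notation K := (kinds prog start2 C).
Notation left_of := (left_of prog start2 C).
Variables (n L0 V0 : nat).
Hypothesis A : alive prog start2 C n.
Hypothesis init : forall d, 0 < d <= L0 -> is_zone (K d d) /\ dig_of (K d d) = bit V0 d.-1.
Hypothesis init_end : ~~ is_zone (K L0.+1 L0.+1).
Hypothesis V0_lt : V0 < 2 ^ L0.
Notation in_zone := (in_zone L0 V0).

Let sk d m (d0 : 0 < d) (Hmd : m + d <= n) (Hin : in_zone d.-1 m) :=
  skeletonP A init init_end V0_lt d0 Hmd Hin.

Lemma after_none t d : K t d = None -> ~~ is_zone (K t.+1 d.+1).
Proof.
move=> E; rewrite K_step /left_of E; case: (K t d.+1) => [c|] //.
case Eb : (is_base (Some c)); first exact: base_step.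
by move: Eb; rewrite /=; case: (ctl c).
Qed.

Lemma none_before_zone t d : ~~ is_zone (K t d) -> is_zone (K t.+1 d) -> K t d = None.
Proof.
rewrite K_step; case: (K t d) => // c; rewrite /= negbK => Hb.
have := @base_step Q0 m0 P prog start2 (~~ odd t) (left_of t d) (Some c) (K t d.+1) Hb.
by move=> /negbTE ->.
Qed.

Lemma lsin_not_zone (k : kind) : ~~ is_zone k -> lsin k = None.
Proof. by case: k => //= c; case: (ctl c). Qed.

Lemma zones_at d m : m + d <= n -> in_zone d m -> zones prog start2 C d (m.*2 + d).
Proof.
move=> Hmd Hin; apply: zones_diag; first by apply: (alive_at A); lia.
move=> c Hc; have Hc' : in_zone c m by apply: in_zone_le Hin; lia.
rewrite (sk_pre (sk _ _ (in_zone_pred Hc'))) //; lia.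
Qed.

Lemma no_die d m : 0 < d -> m + d < n -> in_zone d m ->
  ls_of (K (m.*2 + d).+1 d) <> Some None.
Proof.
move=> d0 Hmd Hin Els.
have Zd := zones_at (ltnW Hmd) Hin.
have Z' : zones prog start2 C d (m.*2 + d).+1 by apply: zones_step Zd; apply: (alive_at A); lia.
have := signal_travels Z' Els d0.
have -> : (m.*2 + d).+1 + d.-1 = (m + d).*2 by lia.
have [_ Hn _ _ _] := alive_step A Hmd.
by move=> H; apply: Hn; apply: H; apply: (alive_at A); lia.
Qed.

(** Signals to the left are born at the passage of a carry and keep that parity of time plus
    distance, so an idle half-step meets none. Signals of the initial configuration are excluded by
    [L0 <= m + d]. *)
Lemma idle_ls m d : 0 < d -> m + d <= n -> in_zone d m -> L0 <= m + d ->
  lsin (K (m.*2 + d).+1 d.+1) = None.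
Proof.
elim: m d => [|m IH] d d0 Hmd Hin HL.
  move: Hin; rewrite /in_zone addn0 => /orP[H|H].
    have -> : d = L0 by lia.
    by apply: lsin_not_zone.
  case: (ltnP L0 d) => Hd; last first.
    have -> : d = L0 by lia.
    by apply: lsin_not_zone.
  have : 2 ^ L0 <= 2 ^ d.-1 by rewrite leq_exp2l //; lia.
  lia.
have Et : (m.+1.*2 + d).+1 = (m.*2 + d.+1).+2 by lia.
rewrite Et.
case Em : (in_zone d m); last first.
  apply: lsin_not_zone; rewrite -Et -addnS.
  apply: (@beyond_zone _ _ _ _ _ C n L0 V0 A init_end V0_lt d.+1) => //=; try lia; try by rewrite Em.
  by move=> d' H1 H2 H3; apply: sk.
have S1 := @sk d.+1 m isT ltac:(lia) Em.
case Ez : (is_zone (K (m.*2 + d.+1).+2 d.+1)); last by apply: lsin_not_zone; rewrite Ez.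
have Hin1 : in_zone d.+1 m.+1 by rewrite -(sk_idle S1).
rewrite lsin_zone // K_step.
have Zp : is_zone (K (m.*2 + d.+1).+1 d.+1) by rewrite (sk_post S1).
have Sd := @sk d m d0 ltac:(lia) (in_zone_pred Em).
have El : left_of (m.*2 + d.+1).+1 d.+1 = K (m.*2 + d).+2 d by rewrite /left_of addnS.
have Zi : is_zone (K (m.*2 + d).+2 d) by rewrite (sk_idle Sd).
rewrite zone_step_idle //.
- case En : (in_zone d.+1 m); first by apply: IH => //; lia.
  have := sk_new S1 Hin1 (negbT En); move=> Enew.
  apply: lsin_not_zone; apply: after_none.
  by apply: none_before_zone; rewrite ?(sk_pre S1) ?En // (sk_post S1).
- by rewrite El; move: Zi; case: (K _ d).
- by rewrite El; apply: (sk_idle_sg Sd).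
Qed.

Variables (md : bool) (m1 e M : nat).
Hypotheses (e_gt0 : 0 < e) (e_m1 : e <= m1) (L0_e : L0 <= e).
Hypothesis in_e : in_zone e (m1 - e).+1.
Hypothesis in_e' : in_zone e.-1 (m1 - e).
Hypothesis gen : exists vi di si,
  K ((m1 - e).*2 + e).+1 e = Some (Cell None vi di (in_mark m0) None si (Some (Some md))).
(** The restart born at distance [e] moves one cell per half-step, erases marks and letters, and
    turns the operations of the previous computation that it meets into [Nop]. It is at the base at
    half-step [2 * m1]. *)
Lemma reset_front d : m1 <= n -> 0 < d < e -> exists ca vi di,
  K ((m1 - d).*2 + d).+1 d =
    Some (Cell None vi di (no_mark m0) None (Some (ca, None, Nop)) (Some (Some md))).
Proof.
move=> m1n; have [k] := ubnP (e - d); elim: k d => // k IH d Hk Hd.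
have Hin : in_zone d (m1 - d).
  have : in_zone d (m1 - e) by apply: in_zone_le in_e'; lia.
  by rewrite /in_zone => /orP[->//|H]; apply/orP; right; lia.
have S1 := @sk d (m1 - d) ltac:(lia) ltac:(lia) (in_zone_pred Hin).
have Hr : lsin (K ((m1 - d).*2 + d) d.+1) = Some (Some md).
  have -> : (m1 - d).*2 + d = ((m1 - d.+1).*2 + d.+1).+1 by lia.
  case: (ltnP d.+1 e) => Hde.
    by have [|ca [vi [di ->]]] := IH d.+1 ltac:(lia); first by lia.
  have -> : d.+1 = e by lia.
  by have [vi [di [si ->]]] := gen.
have Zc : is_zone (K ((m1 - d).*2 + d) d) by rewrite (sk_pre S1).
rewrite K_step; case Ec : (K _ d) Zc => [c|] //= Zc.
have Ecc : ctl c = None by case: (ctl c) Zc.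
apply: (zone_step_reset _ Ecc _ Hr).
case: d Hk Hd Hin S1 Hr Ec => // -[|d] Hk Hd Hin S1 Hr Ec.
  rewrite /left_of /= addn1; have [|_ _ _ H _] := @alive_step _ _ _ _ _ _ _ (m1 - 1) A; first lia.
  by [].
have Hin' : in_zone d.+1 (m1 - d.+2) by apply: in_zone_le Hin.
have S2 := @sk d.+1 (m1 - d.+2) isT ltac:(lia) (in_zone_pred Hin').
by rewrite /left_of addnS; apply: (sk_sg S2).
Qed.

Lemma reset_arrives : m1 <= n -> lsin (K m1.*2 1) = Some (Some md).
Proof.
move=> m1n; have -> : m1.*2 = ((m1 - 1).*2 + 1).+1 by lia.
case: (ltnP 1 e) => He.
  by have [//|//|ca [vi [di ->]]] := @reset_front 1.
have [vi [di [si]]] := gen; have -> : e = 1 by lia.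
by move=> ->.
Qed.

Hypotheses (m1_n : m1 < n) (m1_M : m1 < M).
Hypothesis no_ext : forall m, m + e < M -> V0 + m < 2 ^ e.

Definition run_state m : state Q0 :=
  iter (m - m1.+1) (step prog) (if md then 0 else start2, input e, [::]).

Hypothesis run_bounded : forall m, m < M -> bounded (fun v => v <= e) (run_state m).
Hypothesis no_fire : forall m, m1 < m -> m + e < M -> at_pc prog (run_state m) = IShow _ true ->
  ~~ ((0 < (run_state m).1.2 2 <= e) && (2 ^ (run_state m).1.2 2 %| (V0 + m).+1)).

Definition flag m d : option bool :=
  if m <= m1 then None
  else if armed prog (run_state m) is Some _ then
    Some ((0 < (run_state m).1.2 2 <= d) && (2 ^ (run_state m).1.2 2 %| (V0 + m).+1))
  else None.

Definition sent m d : op Q0 m0 := if m <= m1 then Nop else outop m0 prog (run_state m) d.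

(** Being alive at [n] says nothing about the tip [m + d = n] of the light cone. The two lethal
    events there, a failed test and a collision at the end of the zone, are excluded by hypothesis;
    survival at [n + 1] will follow from it. *)
Hypothesis safe : forall d m, 0 < d <= e -> m1 < m + d < M -> (m + d = n)%N ->
  (m1 < m -> outop m0 prog (run_state m) d.-1 = Test -> d < (run_state m).1.2 1 ->
     vir_of (K (m.*2 + d) d)) /\
  (d = e -> V0 + m.+1 = 2 ^ e -> ~~ is_base (K (m.*2 + d) d.+1)).

Definition pre d m := exists2 c, K (m.*2 + d) d = Some c &
  represents (mk c) (sto c) (run_state m) d /\
  ctl c = if d is 0 then Some (inord (run_state m).1.1) else None.

Definition post d m := exists2 c, K (m.*2 + d).+1 d = Some c &
  [/\ represents (mk c) (sto c) (run_state m.+1) d,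
      ctl c = if d is 0 then Some (inord (run_state m.+1).1.1) else None,
      m1 < m + d -> ls c = None &
      (m1 < m + d) || (d < e) -> exists ca, sg c = Some (ca, flag m d, sent m d)].

Lemma in_wedge d m : d <= e -> m1 < m + d -> in_zone d m.
Proof.
move=> Hd Hm; have H : in_zone e m.
  move: in_e; rewrite /in_zone => /orP[->//|H]; apply/orP; right; lia.
exact: in_zone_le H.
Qed.

Lemma reset_base : exists vi di, K m1.*2.+1 0 =
  Some (Cell (Some (inord (if md then 0 else start2))) vi di (base_marks m0) None
    (Some (true, None, Nop)) None).
Proof.
have Hr := reset_arrives (ltnW m1_n).
have [Hnb _ [Hb _] _ _] := @alive_step _ _ _ _ _ _ _ m1 A ltac:(lia).
have B0 : is_base (K m1.*2 0) by apply: (alive_at A); lia.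
rewrite K_step odd_double; case: (K m1.*2 0) B0 => // b B0.
by rewrite (base_step_reset _ B0 Hnb Hr); do 2 eexists.
Qed.

Lemma run_stateS m : run_state m.+1 = if m <= m1 then run_state m else step prog (run_state m).
Proof.
rewrite /run_state; case: leqP => H.
  by have -> : m.+1 - m1.+1 = m - m1.+1 by lia.
by have -> : m.+1 - m1.+1 = (m - m1.+1).+1 by lia.
Qed.

Lemma run_state_start m : m <= m1.+1 -> run_state m = (if md then 0 else start2, input e, [::]).
Proof. by move=> H; rewrite /run_state; have -> : m - m1.+1 = 0 by lia. Qed.

Lemma run_state_pc m : (run_state m).1.1 <= P.
Proof.
rewrite /run_state; elim: (m - _) => [|k IH]; first by rewrite /=; case: md.
by rewrite iterS; exact: (step_pc_ok prog_ok).
Qed.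

Lemma represents_start (mk : {ffun 'I_m0.+1 -> bool}) d : (forall j : 'I_m0.+1, mk j = (input e j == d)) ->
  represents mk None (if md then 0 else start2, input e, [::] : seq Q0) d.
Proof. by move=> H; split=> //; rewrite nth_nil. Qed.

(** The wave of the restart itself lays down the initial state: no mark on its way, the mark of
    register 0 left behind at distance [e], all other marks at the base. *)
Lemma post_boundary d : d <= e -> post d (m1 - d).
Proof.
move=> Hd; have Hs : run_state (m1 - d).+1 = (if md then 0 else start2, input e, [::]).
  by apply: run_state_start; lia.
have Hf d' : flag (m1 - d) d' = None by rewrite /flag leq_subr.
have Ho d' : sent (m1 - d) d' = Nop by rewrite /sent leq_subr.
have F : (m1 < m1 - d + d) = false by lia.
rewrite /post Hs F /= Hf Ho.
case: (posnP d) => [d0|d0].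
  have [vi [di]] := reset_base; rewrite d0 subn0 addn0 => ->; eexists; first by [].
  split=> //=; last by eexists.
  apply: represents_start => j; rewrite /base_marks ffunE -val_eqE /= inordK // /input /upd.
  by case: eqP => _ //=; case: e e_gt0.
case: (ltnP d e) => Hde.
  have [||ca [vi [di ->]]] := @reset_front d; [exact: ltnW|by rewrite d0|].
  eexists; first by []; split => //=; last by eexists.
    apply: represents_start => j; rewrite /no_mark ffunE /input /upd.
    by case: ifP => _; apply/esym/eqP; lia.
  by case: (d) d0.
have Ed : d = e by lia.
have [vi [di [si]]] := gen; rewrite Ed => ->; eexists; first by [].
split=> //=.
  apply: represents_start => j; rewrite /in_mark ffunE -val_eqE /= inordK // /input /upd.
  by case: eqP => _; rewrite ?eqxx //; symmetry; apply/eqP; lia.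
by case: (e) e_gt0.
Qed.

Lemma after_new d m : 0 < d -> m + d <= n -> in_zone d.-1 m -> ~~ in_zone d m -> in_zone d m.+1 ->
  ~~ is_zone (K (m.*2 + d).+1 d.+1) /\ ~~ is_zone (K (m.*2 + d).+2 d.+1).
Proof.
move=> d0 Hmd Hp Hn Hin; have S1 := sk d0 Hmd Hp.
have Z : ~~ is_zone (K (m.*2 + d).+1 d.+1).
  apply: after_none; apply: none_before_zone; first by rewrite (sk_pre S1).
  by rewrite (sk_post S1).
split=> //; rewrite K_step /left_of; apply: not_zone_step => //.
by rewrite (sk_new S1 Hin Hn).
Qed.

Lemma pre_next d m : d <= e -> m1 <= m + d -> m + d <= n -> 0 < d \/ m < n -> post d m -> pre d m.+1.
Proof.
move=> Hd Hm Hn Hor [c Ec [Hrep Hctl _ _]].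
have Et : m.+1.*2 + d = (m.*2 + d).+2 by lia.
rewrite /pre Et; case: d Hd Hm Hn Hor Ec Hctl Hrep Et => [|d] Hd Hm Hn Hor Ec Hctl Hrep Et.
  exists (Cell (ctl c) (vir c) (dig c) (mk c) (sto c) None None) => //.
  by rewrite K_step Ec addn0 /= odd_double /local Hctl /base_idle Hctl.
have Hp : in_zone d m.
  case: (ltnP m1 (m + d.+1)) => H; first by apply: (@in_zone_pred _ _ d.+1); apply: in_wedge.
  case: (eqVneq d.+1 e) => [E|Hne].
    by have := in_e'; rewrite -E /=; have -> : m1 - d.+1 = m by lia.
  have := in_e'; have -> : m1 - e = m - (e - d.+1) by lia.
  by move=> H'; have : in_zone d (m - (e - d.+1)); [apply: in_zone_le H'; lia|
    rewrite /in_zone => /orP[->//|H'']; apply/orP; right; lia].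
have Sd := sk (isT : 0 < d.+1) Hn Hp.
have Hin : in_zone d.+1 m.+1 by apply: in_wedge; lia.
have Hr : lsin (K (m.*2 + d.+1).+1 d.+2) = None.
  case E : (in_zone d.+1 m); first by apply: idle_ls => //; lia.
  by apply: lsin_not_zone; have [] := after_new _ Hn Hp (negbT E) Hin.
exists (Cell None (vir c) (dig c) (mk c) (sto c) None None); last by [].
rewrite K_step Ec; apply: zone_step_keep => //; rewrite /left_of.
  case: d {Hd Hm Hctl Hrep Et Sd Hr Ec Hor} Hn Hp Hin => [|d] Hn Hp Hin.
    by have : is_base (K (m.*2 + 1).+1 0); [apply: (alive_at A); lia|case: (K _ 0)].
  have Sd := @sk d.+1 m isT ltac:(lia) (in_zone_pred Hp).
  have : is_zone (K (m.*2 + d.+1).+2 d.+1) by rewrite (sk_idle Sd) in_zoneS.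
  by rewrite (addnS _ d.+1); case: (K _ d.+1).
case: d {Hd Hm Hctl Hrep Et Sd Hr Ec Hor} Hn Hp Hin => [|d] Hn Hp Hin.
  have [_ _ _ _] := @alive_step _ _ _ _ _ _ _ m A ltac:(lia).
  by rewrite addn1.
have Sd := @sk d.+1 m isT ltac:(lia) (in_zone_pred Hp).
rewrite (addnS _ d.+1); apply: (sk_idle_sg Sd).
by rewrite (sk_idle Sd) in_zoneS.
Qed.

Lemma post_base m : m1 < m -> m < M -> m < n -> pre 0 m -> post 1 m.-1 -> post 0 m.
Proof.
move=> Hm HM Hn [b Eb [Hrep Hctl]] [c Ec [Hrep1 Hctl1 Hls1 _]].
have Et : (m.-1.*2 + 1).+1 = m.*2 by lia.
have Em : m.-1.+1 = m by lia.
rewrite Et in Ec; rewrite Em in Hrep1 Hctl1; rewrite addn0 in Eb.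
have Hr : lsin (Some c) = None by rewrite /= Hctl1 Hls1 //; lia.
have Hnb : ~~ is_base (Some c) by rewrite /= Hctl1.
have := base_step_main None Hctl Hnb Hr.
have Hok := at_pc_ok (run_state m) prog_ok.
have := issue_base m0_ge Hok e_gt0 (run_bounded HM) Hrep (ex_intro2 _ _ c erefl Hrep1).
have -> : nat_of_ord (inord (run_state m).1.1 : 'I_P.+1) = (run_state m).1.1.
  by rewrite inordK // ltnS run_state_pc.
case: (issue _ _ _) => [[o pc'] fl] [mk' [sto' [die [-> Hrep' -> ->]]]] Hs.
rewrite /post addn0; exists (Cell (Some (inord (step prog (run_state m)).1.1)) (vir b) (dig b) mk' sto'
  (Some (true, armed prog (run_state m), outop m0 prog (run_state m) 0)) None).
  by rewrite K_step Eb Ec odd_double -Hs.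
rewrite run_stateS leqNgt Hm /=; split=> // _; exists true.
rewrite /flag /sent leqNgt Hm /=.
rewrite /armed; case: (at_pc _ _) => // -[] //=.
by rewrite leqn0 lt0n; case: eqP.
Qed.

Lemma right_end m : m1 < m + e -> m + e < M -> m + e <= n -> ~~ is_zone (K (m.*2 + e) e.+1).
Proof.
move=> H1 H2 Hn; have Et : m.*2 + e = (m.-1.*2 + e.+1).+1 by lia.
have Nin : in_zone e.+1 m = false.
  by rewrite /in_zone /=; have := no_ext H2; lia.
case E : (in_zone e m.-1).
  have S1 := @sk e.+1 m.-1 isT ltac:(lia) E.
  have Em : m.-1.+1 = m by lia.
  by rewrite Et (sk_post S1) Em Nin.
have Hp : in_zone e.-1 m.-1.
  move: in_e'; rewrite /in_zone => /orP[->//|H]; apply/orP; right; lia.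
have Hin : in_zone e m.-1.+1.
  have -> : m.-1.+1 = m by lia.
  by apply: in_wedge.
have [_] := @after_new e m.-1 e_gt0 ltac:(lia) Hp (negbT E) Hin.
by have -> : (m.-1.*2 + e).+2 = m.*2 + e by lia.
Qed.

Lemma flagS d m : m1 < m ->
  flag m d.+1 = if [&& 2 ^ d.+1 %| (V0 + m).+1, flag m d == Some false & (run_state m).1.2 2 == d.+1]
                then Some true else flag m d.
Proof.
move=> Hm; rewrite /flag leqNgt Hm /=; case: (armed _ _) => [b|]; last by rewrite andbF.
set h := _ 2; case: (ltngtP h d.+1) => Hh; rewrite ?andbF.
- have E1 : h <= d by lia.
  by rewrite E1.
- have E1 : h <= d = false by lia.
  by rewrite E1 !andbF.
by rewrite Hh ltnn /= ?leqnn /= ?andbT; case: (2 ^ d.+1 %| _).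
Qed.

Lemma post_zone d m : 0 < d <= e -> m1 < m + d < M -> m + d <= n -> pre d m -> post d.-1 m ->
  (d < e -> post d.+1 m.-1) -> post d m.
Proof.
case: d => // d /= Hd Hm Hn [z Ez [Hrep Hctl]] [lc Elc [_ _ _ Hsg]] Hright.
have [Hde1 HmM] : d.+1 <= e /\ m + d.+1 < M by lia.
have Hin : in_zone d.+1 m by apply: in_wedge; lia.
have S1 := sk (isT : 0 < d.+1) Hn (in_zone_pred Hin).
have [ca Hlc] := Hsg ltac:(lia).
rewrite -addnS in Elc.
have Hr : lsin (K (m.*2 + d.+1) d.+2) = None /\
    (d.+1 < e -> exists2 c, K (m.*2 + d.+1) d.+2 = Some c & ctl c = None /\
         represents (mk c) (sto c) (run_state m) d.+2).
  case: (ltnP d.+1 e) => Hde; last first.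
    have Ed : e = d.+1 by lia.
    by split=> //; apply: lsin_not_zone; rewrite -Ed; apply: right_end; lia.
  have [c Ec [Hc1 Hc2 Hc3 _]] := Hright Hde.
  have Em : m.-1.+1 = m by lia.
  have Et : (m.-1.*2 + d.+2).+1 = m.*2 + d.+1 by lia.
  rewrite Et in Ec; rewrite Em in Hc1; split; first by rewrite Ec /= Hc2 Hc3 //; lia.
  by move=> _; exists c.
case: Hr => Hr1 Hr2.
have Hstep := zone_step_main (~~ odd (m.*2 + d.+1)) Hctl Hlc Hr1.
have Hop : exists mk' sto', apply_op (sent m d) (vir z) (mk z) (sto z) (K (m.*2 + d.+1) d.+2) =
    (mk', sto', sent m d.+1, false) /\ represents mk' sto' (run_state m.+1) d.+1.
  rewrite run_stateS /sent; case: leqP => Hmm.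
    by exists (mk z), (sto z).
  apply: (apply_op_zone m0_ge (e := e) (d := d.+1)) => //.
  - exact: at_pc_ok.
  - by apply: run_bounded; lia.
  - by move=> Hde; have [c Ec [_ Hc]] := Hr2 Hde; exists c.
  - move=> Ht Hd1; case Ev : (vir z) => //.
    case: (eqVneq (m + d.+1) n) => [En|Hne].
      have [|||H _] := @safe d.+1 m; [lia|lia|by []|].
      by have := H Hmm Ht Hd1; rewrite Ez /= Ev.
    have Hlt : m + d.+1 < n by lia.
    case: (no_die (isT : 0 < d.+1) Hlt Hin).
    rewrite K_step Ez /left_of Elc.
    move: Hstep; rewrite /sent leqNgt Hmm /=; rewrite /= in Ht; rewrite Ht /= Ev.
    have -> : mk z (rk m0) = false.
      by have [-> _] := Hrep; rewrite /rk /= inordK; [apply/eqP|]; lia.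
    by rewrite /= => ->; rewrite /= orbT.
have [mk' [sto' [Eop Hrep']]] := Hop; rewrite Eop in Hstep.
have Eco : ca && dig z = (2 ^ d.+1 %| (V0 + m).+1).
  rewrite -(sk_carry S1 Hin) K_step Ez /left_of Elc.
  by rewrite Hstep.
have Efl : (if [&& ca && dig z, flag m d == Some false & mk z (rh m0)] then Some true else flag m d) =
    flag m d.+1.
  have [Hmk _] := Hrep; rewrite Hmk /rh /= inordK ?ltnS //.
  case: (leqP m m1) => Hmm; first by rewrite /flag Hmm andbF.
  by rewrite flagS // Eco.
have Hz : is_zone (K (m.*2 + d.+1) d.+2) = (d.+1 < e).
  case: (ltnP d.+1 e) => Hde; last first.
    have Ed : e = d.+1 by apply/eqP; rewrite eqn_leq Hde.
    by apply: negbTE; rewrite -Ed; apply: right_end; rewrite Ed //; case/andP: Hm.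
  by have [c -> [Hc _]] := Hr2 Hde; rewrite /= Hc.
have Hfire : (flag m d.+1 == Some true) && ~~ is_zone (K (m.*2 + d.+1) d.+2) = false.
  rewrite Hz -leqNgt; apply/negbTE/negP => /andP[/eqP Hf Hde].
  have Ed : d.+1 = e by apply/eqP; rewrite eqn_leq Hde1.
  move: Hf; rewrite /flag; case: (leqP m m1) => // Hmm.
  case Ea : (armed _ _) => [b|] // -[] Hf.
  have Eat : at_pc prog (run_state m) = IShow _ true.
    by move: Ea; rewrite /armed; case: (at_pc _ _) => // -[].
  have Hme : m + e < M by rewrite -Ed.
  by have := no_fire Hmm Hme Eat; rewrite -Ed Hf.
have Hcol : ca && dig z && is_base (K (m.*2 + d.+1) d.+2) = false.
  apply/negbTE/negP => /andP[Hco Hb].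
  have Hde : d.+1 = e.
    apply/eqP; rewrite eqn_leq Hde1 /=.
    by rewrite leqNgt -Hz; move: Hb; case: (K _ d.+2) => //= c; case: (ctl c).
  have Hme : m + e < M by rewrite -Hde HmM.
  rewrite Eco in Hco; have V1 : V0 + m.+1 = 2 ^ e.
    by apply/eqP; rewrite addnS eqn_leq (no_ext Hme) -Hde dvdn_leq.
  case: (eqVneq (m + d.+1) n) => [En|Hne].
    have [|||_ H] := @safe d.+1 m; rewrite ?Hd ?Hm //.
    by have := H Hde V1; rewrite Hb.
  have Hlt : m + d.+1 < n by rewrite ltn_neqAle Hne.
  case: (no_die (isT : 0 < d.+1) Hlt Hin).
  rewrite K_step Ez /left_of Elc Hstep /=.
  by rewrite Eco Hco Hb.
cbv beta iota zeta in Hstep; rewrite Efl Hfire in Hstep; rewrite /post K_step Ez /left_of Elc Hstep; eexists; first by [].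
split=> //=.
- by rewrite Hcol.
- by move=> _; eexists.
Qed.

(** Induction on [i = m + d], and for fixed [i] from the last cell down to the base, because the
    cell at [(d, m)] reads its right neighbour as the previous carry left it, at
    [(d + 1, m - 1)]. *)
Lemma wedge i : m1 < i -> i < M -> i <= n ->
  (forall d, d <= e -> pre d (i - d)) /\ (forall d, d <= e -> 0 < d \/ i < n -> post d (i - d)).
Proof.
elim: i => // i IH Hi HM Hn.
have Hpost d : d <= e -> m1 <= i -> 0 < d \/ i < n -> post d (i - d).
  move=> Hd H Hor; case: (ltnP m1 i) => H1; first by have [_ H2] := IH H1 ltac:(lia) ltac:(lia); apply: H2.
  have -> : i = m1 by lia.
  exact: post_boundary.
have Hpre d : d <= e -> pre d (i.+1 - d).
  move=> Hd; have -> : i.+1 - d = (i - d).+1 by lia.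
  by apply: pre_next => //; [lia|lia|right; lia|apply: Hpost => //; right; lia].
split=> // d; have [k] := ubnP (e - d); elim: k d => // k IHk d Hk Hd Hor.
case: d Hk Hd Hor => [|d] Hk Hd Hor.
  rewrite subn0; apply: post_base => //; first by case: Hor.
    by have := Hpre 0 isT; rewrite subn0.
  have -> : i.+1.-1 = i.+1 - 1 by lia.
  by apply: IHk => //; [lia|left].
apply: post_zone => //; try lia.
- exact: Hpre.
- by rewrite subSS /=; apply: Hpost; [lia|lia|right; lia].
- move=> Hde; have -> : (i.+1 - d.+1).-1 = i.+1 - d.+2 by lia.
  by apply: IHk; [lia|lia|left].
Qed.

End Config.
End Segment.

(** * The runs of the program in its two modes *)

Section Runs.
Variables (Q0 : finType) (w w' : nat -> seq Q0) (prog : seq (instr Q0)).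
Variables (start2 c e0 : nat) (i1 i2 : nat -> nat).
Hypothesis spec : program_spec w w' prog start2 c e0 i1 i2.

Definition run_time e := c * (e.+1 * e.+1).

Lemma show_loop b e (s : state Q0) : at_pc prog s = IShow _ b -> bounded (fun v => v <= e) s ->
  forall i, let s' := iter i (step prog) s in
  [/\ at_pc prog s' = IShow _ b, s'.1.2 = s.1.2, s'.2 = iter i (rot 1) s.2 &
      bounded (fun v => v <= e) s'].
Proof.
move=> Hs Hb; elim=> [|i [H1 H2 H3 H4]] //=.
set s' := iter i _ s in H1 H2 H3 H4 *; clearbody s'.
case: s' H1 H2 H3 H4 => [[pc rho] q] /= H1 H2 H3 [H4 H5]; move: (H1); rewrite /at_pc /= => E.
by rewrite E /=; split=> //=; [rewrite H3|split; rewrite //= size_rot].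
Qed.

Lemma mode1_run e : e0 <= e -> exists t1 t2,
  let s i := iter i (step prog) (0, input e, [::]) in
  [/\ t1 < t2 <= run_time e,
      (exists n, at_pc prog (s t1) = ITest _ n) /\ (s t1).1.2 1 = tri_root e,
      forall i, i < t2 -> i <> t1 -> plain (at_pc prog (s i)),
      forall i, t2 <= i -> [/\ at_pc prog (s i) = IShow _ true, (s i).1.2 2 = half_up e &
                              (s i).2 = iter (i - t2) (rot 1) (rev (w (i1 e)))] &
      forall i, bounded (fun v => v <= e) (s i)].
Proof.
move=> He; have [T1 [T2 [s1 [s2 [[E1 B1 P1] Ht [E2 B2 P2] [H1 H2 H3] HT]]]]] := spec_mode1 spec He.
exists T1, (T1 + T2).+1; rewrite /=.
have Es i : T1 < i -> iter i (step prog) (0, input e, [::]) = iter (i - T1.+1) (step prog) (step prog s1).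
  move=> Hi; have {1}-> : i = (i - T1.+1) + T1.+1 by lia.
  by rewrite iterD /= E1.
have Es2 i : T1 + T2 < i -> iter i (step prog) (0, input e, [::]) = iter (i - (T1 + T2).+1) (step prog) s2.
  move=> Hi; rewrite Es; last by lia.
  have -> : i - T1.+1 = (i - (T1 + T2).+1) + T2 by lia.
  by rewrite iterD E2.
have Bs2 : bounded (fun v => v <= e) s2 by rewrite -E2; apply: B2.
split; first by rewrite /run_time; lia.
- by rewrite E1.
- move=> i Hi Hne; case: (ltnP i T1) => HiT; first exact: P1.
  by rewrite Es; [apply: P2|]; lia.
- move=> i Hi; rewrite Es2 //.
  have [-> -> -> _] := show_loop H1 Bs2 (i - (T1 + T2).+1).
  by rewrite H2 H3.
- move=> i; case: (leqP i T1) => HiT; first exact: B1.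
  case: (ltnP (T1 + T2) i) => Hi; last by rewrite Es //; apply: B2; lia.
  by rewrite Es2 //; have [] := show_loop H1 Bs2 (i - (T1 + T2).+1).
Qed.

Lemma mode2_run e : e0 <= e -> exists t2,
  let s i := iter i (step prog) (start2, input e, [::]) in
  [/\ t2 <= run_time e,
      forall i, i < t2 -> plain (at_pc prog (s i)),
      forall i, t2 <= i -> at_pc prog (s i) = IShow _ false /\
                           (s i).2 = iter (i - t2) (rot 1) (rev (w' (i2 e))) &
      forall i, bounded (fun v => v <= e) (s i)].
Proof.
move=> He; have [T [s2 [[E B P] H1 H2 HT]]] := spec_mode2 spec He.
have Es i : T <= i -> iter i (step prog) (start2, input e, [::]) = iter (i - T) (step prog) s2.
  move=> Hi; have {1}-> : i = (i - T) + T by lia.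
  by rewrite iterD E.
have Bs2 : bounded (fun v => v <= e) s2 by rewrite -E; apply: B.
exists T; split => //; first exact: ltnW.
- move=> i Hi; rewrite Es //.
  by have [-> _ -> _] := show_loop H1 Bs2 (i - T); rewrite H2.
- move=> i; case: (leqP i T) => HiT; first exact: B.
  by rewrite Es; [have [] := show_loop H1 Bs2 (i - T)|lia].
Qed.

End Runs.

(** * Epochs of a living base *)

Local Arguments local : simpl never.

Section EpochTimes.
Variables (V0 e : nat).

(* The [e]-th cell is created by the carry issued at time [ext]. *)
Definition ext := 2 ^ e.-1 - V0.+1.
(** The summand [e] is the way of the restart back to the base. [end_1] belongs to the carry with
    clock value [2 ^ e.-1 + 2 ^ half_up e], the first one after [ext] at which the flag can fire;
    [end_2] is [start_1] of the next epoch. *)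
Definition start_1 := ext + e.
Definition end_1 := ext + 2 ^ half_up e + e.
Definition end_2 := ext + 2 ^ e.-1 + e.+1.

Lemma extE L0 : V0 < 2 ^ L0 -> L0 < e -> V0 + ext.+1 = 2 ^ e.-1.
Proof.
move=> H He; have : 2 ^ L0 <= 2 ^ e.-1 by rewrite leq_exp2l //; lia.
by rewrite /ext; lia.
Qed.

Lemma pow_half : 5 <= e -> 4 * 2 ^ half_up e <= 2 * 2 ^ e.-1.
Proof.
move=> e_big; have -> : 4 = 2 ^ 2 by [].
rewrite -expnD -expnS leq_exp2l // /half_up; lia.
Qed.

Lemma pow_e : 5 <= e -> 2 ^ e = 2 * 2 ^ e.-1.
Proof. by move=> e_big; rewrite -expnS; congr (_ ^ _); lia. Qed.

Lemma pow_pos k : 0 < 2 ^ k.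
Proof. by rewrite expn_gt0. Qed.

End EpochTimes.

Section Epoch.
Variables (Q0 : finType) (m0 P : nat) (prog : seq (instr Q0)) (start2 : nat).
Hypothesis m0_ge : 2 <= m0.
Hypothesis prog_ok : all (instr_ok m0 P) prog.
Hypothesis start2_ok : start2 <= P.
Variables (w w' : nat -> seq Q0) (c e0 : nat) (i1 i2 : nat -> nat).
Hypothesis spec : program_spec w w' prog start2 c e0 i1 i2.
Notation cell := (cell Q0 m0 P).
Notation kind := (option cell).

Variable C : nat -> kind.
Notation K := (kinds prog start2 C).

Lemma alive_next n : alive prog start2 C n -> ~~ is_base (K n.*2 1) ->
  lsin (K n.*2 1) <> Some None -> alive prog start2 C n.+1.
Proof.
rewrite /alive => Hb Hr Hl.
have : is_base (K n.*2.+1 0).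
  rewrite K_step odd_double; case: (K n.*2 0) Hb => // b; rewrite /local /=; case: (ctl b) => // pc _; rewrite /base_next (negbTE Hr).
  case: (lsin _) Hl => [[v|]|] //= _.
  case: (issue _ _ _) => [[o pc'] fl] /=.
  by case: (apply_op _ _ _ _ _) => [[[mk' sto'] o'] die].
rewrite doubleS [K n.*2.+2 0]K_step oddS odd_double.
by case: (K n.*2.+1 0) => // b; rewrite /local /=; case E: (ctl b) => //; rewrite /base_idle /= E.
Qed.

Lemma sent_test act (l : kind) (z : cell) (r : kind) c' ca fl : ctl z = None ->
  local prog start2 act l (Some z) r = Some c' -> sg c' = Some (ca, fl, Test) -> vir z.
Proof.
rewrite /local => ->; rewrite /zone_next; case: l => // lc.
case: (sg lc) => [[[ca' fl'] o]|]; last by case=> <-.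
set o0 := if is_reset _ then _ else o.
case E: (apply_op _ _ _ _ _) => [[[mk' sto'] o'] die] [<-] /= [_ _ Eo].
move: E; rewrite {}Eo; case: o0 => [|j|j|j|j|a|a|] /=; try by case.
- by case: (mk z j).
- by case: (mark_of r j).
- by case: (sto z).
- by case: (sto_of r).
by case: (mk z _) => //; case: (vir z).
Qed.

Lemma vir_zone_init t d : is_zone (K t d) -> vir_of (K t d) -> is_zone (C d).
Proof.
elim: t => // t IH; rewrite K_step; case E : (K t d) IH => [z|] IH.
  case Ez : (ctl z) => [pc|].
    have Hb : is_base (Some z) by rewrite /= Ez.
    by have /negbTE -> := @base_step Q0 m0 P prog start2 (~~ odd t) (left_of prog start2 C t d) _ (K t d.+1) Hb.
  have Hz : is_zone (Some z) by rewrite /= Ez.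
  case El : (left_of prog start2 C t d) => [l|]; last by rewrite /local Ez.
  have [_ _ _ _ ->] := @zone_step Q0 m0 P prog start2 (~~ odd t) (Some l) (Some z) (K t d.+1) Hz isT.
  by move=> _; apply: IH.
by rewrite none_step; case: (carry_of _).
Qed.

Variables (n L0 V0 : nat).
Hypothesis A : alive prog start2 C n.
Hypothesis init : forall d, 0 < d <= L0 -> is_zone (K d d) /\ dig_of (K d d) = bit V0 d.-1.
Hypothesis init_end : ~~ is_zone (K L0.+1 L0.+1).
Hypothesis V0_lt : V0 < 2 ^ L0.
Notation in_zone := (in_zone L0 V0).

Variable e : nat.
Hypotheses (e_ge : e0 <= e) (e_big : 5 <= e) (L0_e : L0 < e).
Hypothesis e_time : run_time c e + 2 * e + 10 < 2 ^ half_up e.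

Notation ext := (ext V0 e).
Notation start_1 := (start_1 V0 e).
Notation end_1 := (end_1 V0 e).
Notation end_2 := (end_2 V0 e).
Let extE := extE V0_lt L0_e.
Let pow_half := pow_half e_big.
Let pow_e := pow_e e_big.

Lemma in_zone_ext : [/\ in_zone e.-1 ext, in_zone e ext = false & in_zone e ext.+1].
Proof.
have E := extE; rewrite /in_zone; split.
- apply/orP; right; have -> : e.-1 = e.-2.+1 by lia.
  have : 2 ^ e.-1 = 2 * 2 ^ e.-2 by rewrite -expnS; congr (_ ^ _); lia.
  by have := pow_pos e.-2; rewrite /=; lia.
- have -> : e <= L0 = false by lia.
  by rewrite /=; lia.
- by apply/orP; right; rewrite E.
Qed.

Lemma gen_1 : ext + e <= n -> exists vi di si,
  K ((start_1 - e).*2 + e).+1 e = Some (Cell None vi di (in_mark m0) None si (Some (Some true))).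
Proof.
move=> Hn; have [H1 H2 H3] := in_zone_ext.
have -> : start_1 - e = ext by rewrite /start_1; lia.
have S := skeletonP A init init_end V0_lt (ltac:(lia) : 0 < e) Hn H1.
rewrite (sk_new S H3) ?H2 //.
by do 3 eexists.
Qed.

Notation st1 := (run_state prog start2 true start_1 e).
Notation st2 := (run_state prog start2 false end_1 e).

Definition safe_1 := forall d m, 0 < d < tri_root e -> m + d = n -> start_1 < m -> n < end_1 ->
  (exists k, at_pc prog (st1 m) = ITest _ k) -> vir_of (K (m.*2 + d) d).

Definition safe_2 := forall m, m + e = n -> end_1 < n -> V0 + m.+1 = 2 ^ e ->
  ~~ is_base (K (m.*2 + e) e.+1).

Lemma e_start : e <= start_1. Proof. by rewrite /start_1; lia. Qed.
Lemma e_end : e <= end_1. Proof. by rewrite /end_1; lia. Qed.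
Lemma start_end : start_1 < end_1.
Proof. by rewrite /start_1 /end_1; have := pow_pos (half_up e); lia. Qed.
Lemma end_end : end_1 < end_2.
Proof. by rewrite /end_2 /end_1; have := pow_half; lia. Qed.

Lemma in_start : in_zone e (start_1 - e).+1 /\ in_zone e.-1 (start_1 - e).
Proof.
have [H1 H2 H3] := in_zone_ext.
by have -> : start_1 - e = ext by rewrite /start_1; lia.
Qed.

Lemma in_end : in_zone e (end_1 - e).+1 /\ in_zone e.-1 (end_1 - e).
Proof.
have [H1 H2 H3] := in_zone_ext.
have -> : end_1 - e = ext + 2 ^ half_up e by rewrite /end_1; lia.
have H k : in_zone e (ext.+1 + k) by elim: k => [|k IH]; rewrite ?addn0 // addnS; apply: in_zoneS.
split; first by rewrite -addSn.
have := pow_pos (half_up e); case: (2 ^ _) => // k _.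
by rewrite addnS -addSn; apply: in_zone_pred.
Qed.

Lemma no_ext_1 m : m + e < end_1.+1 -> V0 + m < 2 ^ e.
Proof.
have := extE; have := pow_half; have := pow_e; rewrite /end_1; have := pow_pos (half_up e).
by move: (2 ^ e) (2 ^ e.-1) (2 ^ half_up e); lia.
Qed.

Lemma no_ext_2 m : m + e < end_2 -> V0 + m < 2 ^ e.
Proof.
have := extE; have := pow_e; rewrite /end_2.
by move: (2 ^ e) (2 ^ e.-1); lia.
Qed.

(** Register 2 holds [half_up e], and no clock value strictly between [2 ^ e.-1] and
    [2 ^ e.-1 + 2 ^ half_up e] is a multiple of [2 ^ half_up e]. *)
Lemma no_fire_1 m : start_1 < m -> m + e < end_1 -> at_pc prog (st1 m) = IShow _ true ->
  ~~ ((0 < (st1 m).1.2 2 <= e) && (2 ^ (st1 m).1.2 2 %| (V0 + m).+1)).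
Proof.
move=> H1 H2 H3; have [t1 [t2 [Ht [[k Hk] _] Hpl Hsh _]]] := mode1_run spec e_ge.
have Hm : t2 <= m - start_1.+1.
  case: leqP => // Hlt; case: (m - start_1.+1 =P t1) => [E|Hne].
    by move: H3; rewrite /run_state E Hk.
  by have := Hpl _ Hlt Hne; rewrite -/(st1 m) H3.
have [_ -> _] := Hsh _ Hm; rewrite -/(st1 m) negb_and; apply/orP; right.
have E : (V0 + m).+1 = 2 ^ e.-1 + (m - ext).
  by have := extE; move: H1; rewrite /start_1; move: (2 ^ _); lia.
rewrite E dvdn_addr; last by apply: dvdn_exp2l; rewrite /half_up; lia.
by rewrite gtnNdvd //; move: H1 H2; rewrite /start_1 /end_1; move: (2 ^ _); lia.
Qed.

Lemma bounded_1 m : bounded (fun v => v <= e) (st1 m).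
Proof. by have [t1 [t2 [_ _ _ _ H]]] := mode1_run spec e_ge; apply: H. Qed.

Lemma bounded_2 m : bounded (fun v => v <= e) (st2 m).
Proof. by have [t2 [_ _ _ H]] := mode2_run spec e_ge; apply: H. Qed.

Lemma outop_test (s : state Q0) d : outop m0 prog s d = Test -> exists k, at_pc prog s = ITest _ k.
Proof.
rewrite /outop; case: (at_pc _ _) => [r k|r k|r z nz|a k|k|b]; try (by exists k); try by [].
- by case: ifP => // _; case: ifP.
- by case: ifP => // _; case: ifP.
- by case: (nth _ _ _).
- by case: (s.2) => // a q; case: ifP.
Qed.

Lemma wedge_1 : start_1 < n -> safe_1 -> forall i, start_1 < i < end_1 -> i <= n ->
  (forall d, d <= e -> pre prog start2 C true start_1 e d (i - d)) /\
  (forall d, d <= e -> 0 < d \/ i < n -> post prog start2 C V0 true start_1 e d (i - d)).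
Proof.
move=> Hn Hs i /andP[Hi1 Hi2] Hin.
have [I1 I2] := in_start.
have G := gen_1 (ltac:(rewrite /start_1 in Hn; lia) : ext + e <= n).
apply: (wedge m0_ge prog_ok start2_ok A init init_end V0_lt (ltac:(lia) : 0 < e) e_start
  (ltnW L0_e) I1 I2 G Hn start_end) => //.
- by move=> m Hm; apply: no_ext_1; lia.
- by move=> m _; apply: bounded_1.
- exact: no_fire_1.
- move=> d m Hd Hm Emd; split; last first.
    move=> Ed V1; have H : m.+1 + e < end_1.+1 by rewrite addSn ltnS; case/andP: Hm => _; rewrite Ed.
    by have := no_ext_1 H; rewrite V1 ltnn.
  move=> Hm1 /outop_test Ht Hd1; apply: Hs => //; last by rewrite -Emd; case/andP: Hm.
  case/andP: Hd => -> _ /=; move: Hd1 Ht.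
  have [t1 [t2 [Ht [[k Hk] Hr] Hpl Hsh _]]] := mode1_run spec e_ge.
  rewrite /run_state; case: (m - start_1.+1 =P t1) => [->|Hne]; first by rewrite Hr.
  case: (ltnP (m - start_1.+1) t2) => Hlt.
    by move=> _ [k' Hk']; have := Hpl _ Hlt Hne; rewrite Hk'.
  by move=> _ [k' Hk']; have [H _ _] := Hsh _ Hlt; move: H; rewrite Hk'.
Qed.

Lemma safe_1_later : end_1 <= n -> safe_1.
Proof. by move=> H d m _ _ _; rewrite ltnNge H. Qed.

(** By [e_time] the program displays, and has armed the flag, before the clock reads
    [2 ^ e.-1 + 2 ^ half_up e]. The carry of that date passes the mark of register 2 without leaving
    the zone, and the flag fires at the last cell. *)
Lemma gen_2 : end_1 <= n -> exists vi di si,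
  K ((end_1 - e).*2 + e).+1 e = Some (Cell None vi di (in_mark m0) None si (Some (Some false))).
Proof.
move=> Hn; have Hsn : start_1 < n by apply: leq_trans Hn; exact: start_end.
set m := end_1 - e; have Em : m = ext + 2 ^ half_up e by rewrite /m /end_1; lia.
have Eme : m + e = end_1 by rewrite Em /end_1; lia.
have Hh : e + 10 < 2 ^ half_up e by move: e_time; lia.
have Hi : start_1 < end_1.-1 < end_1 by rewrite /end_1 /start_1; move: Hh; move: (2 ^ _); lia.
have [_ W] := wedge_1 Hsn (safe_1_later Hn) Hi ltac:(lia).
have We := W e (leqnn e) (or_introl _ : 0 < e \/ _).
have We1 := W e.-1 (leq_pred e) (or_introl _ : 0 < e.-1 \/ _).
have [I1 I2] := in_start.
have [z Ez [Hrep Hctl]] : pre prog start2 C true start_1 e e m.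
  have -> : m = (end_1.-1 - e).+1 by lia.
  apply: (pre_next m0_ge prog_ok start2_ok A init init_end V0_lt (ltac:(lia) : 0 < e) e_start
    (ltnW L0_e) I1 I2 Hsn start_end); first by []; try lia.
  by apply: We; lia.
have [lc Elc [_ _ _ Hsg]] : post prog start2 C V0 true start_1 e e.-1 m.
  have -> : m = end_1.-1 - e.-1 by lia.
  by apply: We1; lia.
have [ca Hlc] := Hsg ltac:(lia).
have Hms : start_1 < m by rewrite Em /start_1; lia.
have [t1 [t2 [Ht [[k Hk] Hr] Hpl Hsh _]]] := mode1_run spec e_ge.
have Hmt : t2 <= m - start_1.+1 by rewrite Em /start_1; move: e_time Ht; lia.
have [S1 S2 _] := Hsh _ Hmt; rewrite -/(st1 m) in S1 S2.
have V1 : (V0 + m).+1 = 2 ^ e.-1 + 2 ^ half_up e by have := extE; rewrite Em; lia.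
have Hf : flag prog start2 V0 true start_1 e m e.-1 = Some true.
  rewrite /flag leqNgt Hms /= /armed S1 S2 V1 dvdn_add // ?andbT.
    by congr Some; rewrite /half_up; lia.
  by apply: dvdn_exp2l; rewrite /half_up; lia.
have R : ~~ is_zone (K (m.*2 + e) e.+1).
  apply: (right_end m0_ge prog_ok start2_ok A init init_end V0_lt (ltac:(lia) : 0 < e) e_start
   (ltnW L0_e) I1 I2 (M := end_1.+1) Hsn) => //.
  + by have := start_end; lia.
  + exact: no_ext_1.
  + by rewrite Eme start_end.
  + by rewrite Eme.
  + by rewrite Eme.
have Hr1 := lsin_not_zone R.
have He1 : exists e', e = e'.+1 by exists e.-1; lia.
case: He1 => e' Ee.
have Et : (m.*2 + e.-1).+1 = m.*2 + e by lia.
rewrite Et in Elc.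
have El : left_of prog start2 C (m.*2 + e) e = Some lc by move: Elc; rewrite Ee.
have Hc : ctl z = None by rewrite Hctl Ee.
have Hstep := zone_step_main prog start2 (~~ odd (m.*2 + e)) Hc Hlc Hr1.
have [die [mk' [sto' [o' Hop]]]] : exists die mk' sto' o',
   apply_op (sent m0 prog start2 true start_1 e m e.-1) (vir z) (mk z) (sto z) (K (m.*2 + e) e.+1) = (mk', sto', o', die) /\ die = false.
  rewrite /sent leqNgt Hms /= /outop S1; case: (_.2) => [|a q]; first by do 4 eexists.
  case: ifP => _; last by do 4 eexists.
  by rewrite /=; case: (sto_of _) => *; do 4 eexists.
case: Hop => Hop Ed; rewrite Hop Hf in Hstep; cbv beta iota zeta in Hstep.
have Hin : in_zone e m.
  have [_ _ H] := in_zone_ext; rewrite Em; have := pow_pos (half_up e); case: (2 ^ _) => // x _.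
  by rewrite addnS -addSn; elim: x => [|x IH]; rewrite ?addn0 // addnS; apply: in_zoneS.
have Eco : ca && dig z = false.
  have S := skeletonP A init init_end V0_lt (ltac:(lia) : 0 < e) (ltac:(lia) : m + e <= n) (in_zone_pred Hin).
  have := sk_carry S Hin; rewrite K_step Ez El Hstep /= => ->.
  by rewrite V1 gtnNdvd //; have := pow_half; have := pow_e; have := pow_pos e.-1; have := pow_pos (half_up e); lia.
rewrite Eco Ed R /= in Hstep.
by rewrite K_step Ez El Hstep; do 3 eexists.
Qed.

Lemma wedge_2 : end_1 < n -> safe_2 -> forall i, end_1 < i < end_2 -> i <= n ->
  (forall d, d <= e -> pre prog start2 C false end_1 e d (i - d)) /\
  (forall d, d <= e -> 0 < d \/ i < n -> post prog start2 C V0 false end_1 e d (i - d)).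
Proof.
move=> Hn Hs i /andP[Hi1 Hi2] Hin.
have [I1 I2] := in_end.
have G := gen_2 (ltnW Hn).
have [t2 [Ht Hpl Hsh _]] := mode2_run spec e_ge.
have not_ITest m k : at_pc prog (st2 m) = ITest _ k -> False.
  case: (ltnP (m - end_1.+1) t2) => Hlt; first by move=> E; have := Hpl _ Hlt; rewrite -/(st2 m) E.
  by have [] := Hsh _ Hlt; rewrite -/(st2 m) => ->.
apply: (wedge m0_ge prog_ok start2_ok A init init_end V0_lt (ltac:(lia) : 0 < e) e_end
  (ltnW L0_e) I1 I2 G Hn end_end) => //.
- exact: no_ext_2.
- by move=> m _; apply: bounded_2.
- move=> m _ _ E; case: (ltnP (m - end_1.+1) t2) => Hlt.
    by have := Hpl _ Hlt; rewrite -/(st2 m) E.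
  by have [] := Hsh _ Hlt; rewrite -/(st2 m) E.
- move=> d m Hd Hm Emd; split; first by move=> _ /outop_test [k /not_ITest].
  by move=> Ed V1; rewrite Ed; apply: Hs => //; rewrite -Ed.
Qed.

Lemma first_zone : 0 < n -> ~~ is_base (K n.*2 1).
Proof.
move=> Hn; have -> : n.*2 = ((n - 1).*2 + 1).+1 by lia.
have S := skeletonP A init init_end V0_lt (isT : 0 < 1) (ltac:(lia) : n - 1 + 1 <= n) (isT : in_zone 0 (n - 1)).
have : is_zone (K ((n - 1).*2 + 1).+1 1).
  rewrite (sk_post S) /in_zone /=; apply/orP; right.
  by have := pow_pos 0; lia.
by case: (K _ 1) => //= x; case: (ctl x).
Qed.

Lemma survive_start : start_1 <= n -> n = start_1 -> alive prog start2 C n.+1.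
Proof.
move=> Hn E; have H0 : 0 < n by have := e_start; lia.
apply: alive_next => //; first exact: first_zone.
have [I1 I2] := in_start.
have G := gen_1 (ltac:(rewrite /start_1 in Hn; lia) : ext + e <= n).
by rewrite {1}E (reset_arrives m0_ge prog_ok start2_ok A init init_end V0_lt (ltac:(lia) : 0 < e) e_start
  (ltnW L0_e) I1 I2 G Hn).
Qed.

Lemma survive_end : end_1 <= n -> n = end_1 -> alive prog start2 C n.+1.
Proof.
move=> Hn E; have H0 : 0 < n by have := e_end; lia.
apply: alive_next => //; first exact: first_zone.
have [I1 I2] := in_end.
have G := gen_2 Hn.
by rewrite {1}E (reset_arrives m0_ge prog_ok start2_ok A init init_end V0_lt (ltac:(lia) : 0 < e) e_end
  (ltnW L0_e) I1 I2 G Hn).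
Qed.

Lemma post_survive md m1 : m1 < n -> post prog start2 C V0 md m1 e 1 (n - 1) -> alive prog start2 C n.+1.
Proof.
move=> Hn [z Ez [_ Hc Hl _]].
have Et : ((n - 1).*2 + 1).+1 = n.*2 by lia.
rewrite Et in Ez; apply: alive_next => //; rewrite Ez /= Hc //.
by rewrite Hl //; lia.
Qed.

Lemma survive_1 : start_1 < n < end_1 -> safe_1 -> alive prog start2 C n.+1.
Proof.
move=> /andP[H1 H2] Hs; have [|_ W] := wedge_1 H1 Hs _ (leqnn n); first by rewrite H1.
by apply: post_survive H1 _; apply: W; [lia|left].
Qed.

Lemma survive_2 : end_1 < n < end_2 -> safe_2 -> alive prog start2 C n.+1.
Proof.
move=> /andP[H1 H2] Hs; have [|_ W] := wedge_2 H1 Hs _ (leqnn n); first by rewrite H1.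
by apply: post_survive H1 _; apply: W; [lia|left].
Qed.

Lemma survive : start_1 <= n < end_2 -> safe_1 -> safe_2 -> alive prog start2 C n.+1.
Proof.
move=> /andP[H1 H2] Hs1 Hs2.
case: (ltngtP n start_1) H1 => // H1 _; last by apply: survive_start; rewrite ?H1.
case: (ltngtP n end_1) => H3; [|apply: survive_2 => //; rewrite H3 //|by apply: survive_end; rewrite ?H3].
by apply: survive_1; rewrite // H1.
Qed.

Lemma safe_1_far : start_1 + run_time c e + e < n -> safe_1.
Proof.
move=> Hn d m Hd Hm Hms _ [k Hk].
have [t1 [t2 [Ht _ Hpl Hsh _]]] := mode1_run spec e_ge.
have Hr := tri_root_le e.
have Hlt : t2 <= m - start_1.+1 by move: Hd Hm Ht Hn; lia.
by have [] := Hsh _ Hlt; rewrite -/(st1 m) Hk.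
Qed.

(** In the simulation every cell before the mark of register 1 passes [Test] on, which only a cell
    with [vir] does, and [vir] goes back to the initial configuration. *)
Lemma test_passed : start_1 + run_time c e + e < n -> forall d, 0 < d < tri_root e -> is_zone (C d).
Proof.
move=> Hn d /andP[d0 Hd].
have [t1 [t2 [Ht [[k Hk] Hr] Hpl Hsh _]]] := mode1_run spec e_ge.
have Hsn : start_1 < n by lia.
set m := start_1.+1 + t1.
have Em : m - start_1.+1 = t1 by rewrite /m; lia.
have He := tri_root_le e.
have Hi : start_1 < m + d < end_1.
  by move: e_time Ht; rewrite /m /end_1 /start_1; move: (2 ^ _) (run_time c e) => x y; lia.
have Hin : m + d < n by rewrite /m; lia.
have [Wp Wq] := wedge_1 Hsn (safe_1_far Hn) Hi (ltnW Hin).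
have [z Ez [_ Hc]] := Wp d ltac:(lia).
have [z' Ez' [_ _ _ Hsg]] := Wq d ltac:(lia) (or_introl d0).
rewrite addnK in Ez Ez' Hsg.
have [|ca Es] := Hsg; first by case/andP: Hi => ->.
have Hcz : ctl z = None by rewrite Hc; case: (d) d0.
have Hv : vir z.
  move: Ez'; rewrite K_step Ez => H; apply: (sent_test Hcz H).
  rewrite Es /sent leqNgt (_ : start_1 < m); last by rewrite /m; lia.
  by rewrite /outop /run_state Em Hk Hr Hd.
by apply: (@vir_zone_init (m.*2 + d)); rewrite Ez //= Hcz.
Qed.

Definition queue_1 i := (iter i (step prog) (0, input e, [::])).2.
Definition queue_2 i := (iter i (step prog) (start2, input e, [::])).2.

Lemma nth_ohead T (q : seq T) : nth None (map Some q) 0 = ohead q.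
Proof. by case: q. Qed.

Lemma pre_show md m1 : pre prog start2 C md m1 e 0 n ->
  exists2 b, K n.*2 0 = Some b & isSome (ctl b) /\
    sto b = ohead (iter (n - m1.+1) (step prog) (if md then 0 else start2, input e, [::])).2.
Proof.
by move=> [b Eb [[_ Hs] Hc]]; exists b; rewrite -?nth_ohead ?Hc // -Eb addn0.
Qed.

Lemma show_1 : start_1 + run_time c e + e < n < end_1 ->
  (exists2 b, K n.*2 0 = Some b & isSome (ctl b) /\ sto b = ohead (queue_1 (n - start_1.+1))) /\
  alive prog start2 C n.+1.
Proof.
move=> /andP[H1 H2]; have Hs : start_1 < n by lia.
have Sf := safe_1_far H1.
split; last by apply: survive_1 => //; rewrite Hs.
have [|W _] := wedge_1 Hs Sf _ (leqnn n); first by rewrite Hs.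
by have := W 0 isT; rewrite subn0 => /pre_show.
Qed.

Lemma show_2 : end_1 < n -> n.+1 < end_2 ->
  (exists2 b, K n.*2 0 = Some b & isSome (ctl b) /\ sto b = ohead (queue_2 (n - end_1.+1))) /\
  alive prog start2 C n.+1.
Proof.
move=> H1 H2.
have Sf : safe_2.
  move=> m Em _ V1; move: H2; rewrite -Em /end_2.
  by have := extE; have := pow_e; move: V1; move: (2 ^ e) (2 ^ e.-1); lia.
have He : end_1 < n < end_2 by rewrite H1; apply: ltnW.
split; last by apply: survive_2.
have [|W _] := wedge_2 H1 Sf _ (leqnn n) => //.
by have := W 0 isT; rewrite subn0 => /pre_show.
Qed.

End Epoch.

(** * Merging and survival *)

Section Front.
Variables (Q0 : finType) (m0 P : nat) (prog : seq (instr Q0)) (start2 : nat).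
Notation cell := (cell Q0 m0 P).
Notation kind := (option cell).
Variable C : nat -> kind.
Notation K := (kinds prog start2 C).
Notation nz t p := (~~ is_zone (K t p)).

(** A cell just created carries no signal and cannot create its neighbour in the next half-step:
    zones expand at no more than half the speed of signals. *)
Lemma front_step t p : nz t p -> nz t.+1 p \/ (nz t.+1 p.+1 /\ nz t.+2 p.+1).
Proof.
move=> H; case Z : (is_zone (K t.+1 p)); last by left.
right; have E := none_before_zone H Z.
have N := after_none E; split=> //.
rewrite K_step /left_of; apply: not_zone_step => //.
move: Z; rewrite K_step E none_step.
by case: (carry_of _).
Qed.

Lemma front T a : nz T a -> forall k, exists2 j, nz (T + k) (a + j) &
  2 * j <= k \/ (2 * j <= k.+1 /\ nz (T + k).+1 (a + j)).
Proof.
move=> H; elim=> [|k [j Hj Hor]]; first by exists 0; rewrite ?addn0 //; left.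
rewrite addnS; case: Hor => [Hk|[Hk Hn]]; last by exists j => //; left.
case: (front_step Hj) => [H1|[H1 H2]]; first by exists j => //; left; apply: ltnW.
by exists j.+1; rewrite addnS //; right; split=> //; lia.
Qed.

(* A non-zone front moves right at half speed, hence the diagonal overtakes it. *)
Lemma front_diag D a : 0 < a -> nz D a -> exists2 c, 0 < c <= a.*2 & nz (D + c) c.
Proof.
move=> a0 H.
have: forall k, (exists2 c, 0 < c <= k & nz (D + c) c) \/
  exists2 j, k < a + j /\ nz (D + k) (a + j) & 2 * j <= k \/ (2 * j <= k.+1 /\ nz (D + k).+1 (a + j)).
  elim=> [|k [[c Hc Hn]|[j [Hj Hn] Hor]]].
  - by right; exists 0; rewrite ?addn0 //; left.
  - by left; exists c => //; lia.
  have step j' : j <= j' -> nz (D + k.+1) (a + j') -> 2 * j' <= k.+1 \/ (2 * j' <= k.+2 /\ nz (D + k.+1).+1 (a + j')) ->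
    (exists2 c, 0 < c <= k.+1 & nz (D + c) c) \/
    exists2 j, k.+1 < a + j /\ nz (D + k.+1) (a + j) & 2 * j <= k.+1 \/ (2 * j <= k.+2 /\ nz (D + k.+1).+1 (a + j)).
    move=> Hjj Hn' Hor'; case: (ltngtP k.+1 (a + j')) => Hlt; first by right; exists j'.
      by lia.
    by left; exists k.+1; rewrite ?leqnn // {2}Hlt.
  rewrite addnS in step *; case: Hor => [Hk|[Hk Hn']]; last by apply: (step j) => //; left.
  case: (front_step Hn) => [H1|[H1 H2]]; first by apply: (step j) => //; left; apply: ltnW.
  by apply: (step j.+1); rewrite ?addnS //; right; split=> //; lia.
move/(_ a.*2) => [|[j [Hj _] Hor]]; first by [].
by exfalso; case: Hor => [|[]]; lia.
Qed.

Lemma front_later T D a : 0 < a -> T <= D -> nz T a ->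
  exists2 c, 0 < c <= a.*2 + (D - T).+1 & nz (D + c) c.
Proof.
move=> a0 HT H; have [j Hj Hor] := front H (D - T).
have ET : T + (D - T) = D by lia.
rewrite ET in Hj; have [|c Hc Hn] := front_diag _ Hj; first by lia.
by exists c => //; case: Hor => [|[]]; lia.
Qed.

(** For an arbitrary initial configuration, the length and clock value as met by the first carry. If
    [a] is initially not a zone cell, the first carry overtakes the end of the zone within distance
    [2 * a]. *)
Definition zone_len a := find (fun d => ~~ is_zone (K d.+1 d.+1)) (iota 0 a.*2).
Definition clock a := foldr (fun d v => dig_of (K d.+1 d.+1) + v.*2) 0 (iota 0 (zone_len a)).

Lemma bit_fold (f : nat -> bool) L k : let v := foldr (fun d v => f d + v.*2) 0 (iota k L) in
  v < 2 ^ L /\ forall d, d < L -> bit v d = f (k + d).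
Proof.
elim: L k => [|L IH] k /=; first by [].
have [H1 H2] := IH k.+1; set v := foldr _ _ _ in H1 H2 *; split.
  by rewrite expnS; case: (f k); move: H1; lia.
case=> [|d] Hd; rewrite /bit.
  by rewrite expn0 divn1 oddD odd_double addbF addn0; case: (f k).
rewrite expnS divnMA; have -> : (f k + v.*2) %/ 2 = v.
  by rewrite divn2 -[nat_of_bool _]/(nat_of_bool _) half_bit_double.
by rewrite -/(bit v d) H2 // addnS addSn.
Qed.

Lemma clockP a : 0 < a -> ~~ is_zone (C a) ->
  [/\ zone_len a < a.*2,
      forall d, 0 < d <= zone_len a -> is_zone (K d d) /\ dig_of (K d d) = bit (clock a) d.-1,
      ~~ is_zone (K (zone_len a).+1 (zone_len a).+1) & clock a < 2 ^ zone_len a].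
Proof.
move=> a0 Ha; have [c Hc Hn] := @front_diag 0 a a0 Ha.
have Hh : has (fun d => ~~ is_zone (K d.+1 d.+1)) (iota 0 a.*2).
  apply/hasP; exists c.-1; first by rewrite mem_iota; lia.
  by rewrite prednK //; case/andP: Hc.
have Hlt : zone_len a < a.*2 by rewrite /zone_len -{2}(size_iota 0 a.*2) -has_find.
have [B1 B2] := bit_fold (fun d => dig_of (K d.+1 d.+1)) (zone_len a) 0.
split=> //.
- case=> // d /= Hd; split; last by rewrite B2.
  have := @before_find _ 0 (fun d => ~~ is_zone (K d.+1 d.+1)) (iota 0 a.*2) d.
  rewrite -/(zone_len a) => /(_ Hd); rewrite nth_iota; last by lia.
  by move/negbFE.
- by have := nth_find 0 Hh; rewrite -/(zone_len a) nth_iota.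
Qed.

End Front.

(** * Independence of an agent from its left side *)

Section HalfLine.
Variables (Q0 : finType) (m0 P : nat) (prog : seq (instr Q0)) (start2 : nat).
Notation cell := (cell Q0 m0 P).
Notation kind := (option cell).
Implicit Types C : nat -> kind.
Notation kinds := (kinds prog start2).

Definition shift T y (C : nat -> T) : nat -> T := fun d => C (y + d).

Lemma local_base_left act (l l' c r : kind) : is_base c ->
  local prog start2 act l c r = local prog start2 act l' c r.
Proof. by case: c => //= z; rewrite /local; case: (ctl z). Qed.

(** A living base shields its right side, since it ignores its left neighbour; after its death the
    influence from the left still needs [d] half-steps to get to distance [d]. *)
Lemma kinds_shift C y T : is_base (kinds C T y) || is_base (kinds (shift y C) T 0) ->
  forall t d, t <= T + d -> kinds (shift y C) t d = kinds C t (y + d).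
Proof.
move=> Hb; elim=> // t IH d Hd.
case: d Hd => [|d] Hd; last first.
  rewrite !K_step IH; last by lia.
  rewrite IH; last by lia.
  rewrite !addnS; congr (local _ _ _ _ _ _).
  by rewrite /left_of IH //; lia.
rewrite addn0 in Hd *; rewrite !K_step !IH; try lia.
rewrite addn0 addn1; apply: local_base_left.
case/orP: Hb => Hb; first by apply: base_back Hb; lia.
have : is_base (kinds (shift y C) t 0) by apply: base_back Hb; lia.
by rewrite IH ?addn0 //; lia.
Qed.

Lemma base_shift C y T : is_base (kinds (shift y C) T 0) = is_base (kinds C T y).
Proof.
apply/idP/idP => H.
  by have := @kinds_shift C y T; rewrite H orbT => /(_ isT T 0); rewrite !addn0 => <-.
by have := @kinds_shift C y T; rewrite H => /(_ isT T 0); rewrite !addn0 => ->.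
Qed.

Lemma kinds_local C C' t d : (forall i, i <= d + t -> C i = C' i) -> kinds C t d = kinds C' t d.
Proof.
elim: t d => [|t IH] d H; first by apply: H; rewrite addn0.
rewrite !K_step; congr (local _ _ _ _ _ _).
- case: d H => // d H; apply: IH => i Hi; apply: H; lia.
- by apply: IH => i Hi; apply: H; lia.
- by apply: IH => i Hi; apply: H; lia.
Qed.

Lemma clock_local C C' a : (forall i, i <= 4 * a -> C i = C' i) ->
  clock prog start2 C a = clock prog start2 C' a.
Proof.
move=> H; have E d : d < a.*2 -> kinds C d.+1 d.+1 = kinds C' d.+1 d.+1.
  by move=> Hd; apply: kinds_local => i Hi; apply: H; lia.
have El : zone_len prog start2 C a = zone_len prog start2 C' a.
  by apply: eq_in_find => d; rewrite mem_iota => /andP[_ Hd] /=; rewrite E.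
have Hlen : zone_len prog start2 C' a <= a.*2 by rewrite -[a.*2](size_iota 0) find_size.
rewrite /clock El; move: (zone_len _ _ C' a) Hlen => L HL.
have : forall k, k + L <= a.*2 ->
   foldr (fun d v => dig_of (kinds C d.+1 d.+1) + v.*2) 0 (iota k L) =
   foldr (fun d v => dig_of (kinds C' d.+1 d.+1) + v.*2) 0 (iota k L).
  by elim: (L) => //= l IHl k Hk; rewrite IHl ?E //; lia.
by apply.
Qed.

Lemma kind_some_chain C T z : kinds C T.+1 z != None -> is_base (kinds C T.+1 z) \/
  is_zone (kinds C T.+1 z) /\ exists2 z', z = z'.+1 & kinds C T z' != None.
Proof.
rewrite K_step; case E : (kinds C T z) => [c|].
  case Ec : (ctl c) => [pc|] H.
    left; move: H; rewrite /local Ec; case: (~~ odd T); last by rewrite /base_idle /= Ec.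
    rewrite /base_next; case: ifP => // _; case: (lsin _) => [[md|]|] //.
    case: (issue _ _ _) => [[o pc'] fl].
    by case: (apply_op _ _ _ _ _) => [[[mk' sto'] o'] die].
  right; case: z {E} H => [|z]; first by rewrite /local Ec.
  rewrite /left_of; case El: (kinds C T z) => [l|]; last by rewrite /local Ec.
  move=> _; split; last by exists z; rewrite ?El.
  by have [] // := @zone_step Q0 m0 P prog start2 (~~ odd T) (Some l) (Some c) (kinds C T z.+2); rewrite /= ?Ec.
rewrite none_step; case Hc : (carry_of _) => // _; right; split=> //.
by case: z {E} Hc => // z; rewrite /left_of => Hc; exists z => //; move: Hc; case: (kinds C T z).
Qed.

(** A nonempty cell that is not a base had a nonempty left neighbour one half-step earlier, so a
    walk back along the diagonal runs through zone cells until it finds a base. *)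
Lemma chain C D T z : D <= T -> kinds C T z != None ->
  (exists2 j, j <= D & is_base (kinds C (T - j) (z - j)) /\
      j <= z /\ forall i, i < j -> is_zone (kinds C (T - i) (z - i))) \/
  D <= z /\ forall i, i < D -> is_zone (kinds C (T - i) (z - i)).
Proof.
elim: D T z => [|D IH] T z HD Hn; first by right.
case: T HD Hn => // T HD /kind_some_chain[Hb|[Hz [z' Ez Hn]]].
  by left; exists 0 => //; rewrite !subn0.
have [[j Hj [Hb [Hjz Hi]]]|[Hz' Hi]] := IH T z' HD Hn; [left; exists j.+1 => //|right].
  rewrite Ez !subSS; split=> //; split=> // -[|i] Hij; first by rewrite !subn0 -Ez.
  by rewrite !subSS; apply: Hi.
rewrite Ez; split=> // -[|i] HiD; first by rewrite !subn0 -Ez.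
by rewrite !subSS; apply: Hi.
Qed.

End HalfLine.

Section Letters.
Variables (Q0 : finType) (m0 P : nat) (prog : seq (instr Q0)) (start2 : nat).
Notation Q := (Q0 * option (cell Q0 m0 P))%type.
Variable c : nat -> Q.
Notation G t := (iter t (@global Q0 m0 P prog start2) c).
Notation K := (kinds prog start2 (fun i => (c i).2)).

Lemma global_kind t z : (G t z).2 = K t.*2 z.
Proof. by rewrite -(@kinds_global Q0 m0 P prog start2 c t). Qed.

Lemma ray j t z b a : 0 < j -> j <= t -> j <= z ->
  (forall i, 0 < i < j -> ~~ is_base (K (t - i).*2 (z - i))) ->
  K (t - j).*2 (z - j) = Some b -> isSome (ctl b) -> sto b = Some a -> (G t z).1 = a.
Proof.
elim: j t z => // j IH [|t] [|z] // _ Hj Hz Hi Hb Hc Hs.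
rewrite iterS /global /= /next_letter global_kind.
case: (posnP j) => [j0|j0].
  move: Hb; rewrite j0 !subn1 /= => ->.
  by case: (ctl b) Hc => // pc _; rewrite Hs.
have := Hi 1; rewrite !subn1 /= => /(_ _) Hn.
have Hnb : ~~ is_base (K t.*2 z) by apply: Hn; lia.
have <- : (G t z).1 = a.
  rewrite !subSS in Hb; apply: (IH t z _ _ _ _ Hb) => // i Hij.
  by have := Hi i.+1; rewrite !subSS; apply; lia.
by case: (K t.*2 z) Hnb => // c'; rewrite /=; case: (ctl c').
Qed.

End Letters.

(** * Clock readings, displays and lengths of agents *)

Section Agents.
Variables (Q0 : finType) (m0 P : nat) (prog : seq (instr Q0)) (start2 : nat).
Hypothesis m0_ge : 2 <= m0.
Hypothesis prog_ok : all (instr_ok m0 P) prog.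
Hypothesis start2_ok : start2 <= P.
Variables (w w' : nat -> seq Q0) (c e0 : nat) (i1 i2 : nat -> nat).
Hypothesis spec : program_spec w w' prog start2 c e0 i1 i2.
Notation cell := (cell Q0 m0 P).
Notation kind := (option cell).
Implicit Types C : nat -> kind.
Notation kinds := (kinds prog start2).
Notation alive := (alive prog start2).
Notation clock := (clock prog start2).

(** The last inequality makes a zone with an initial gap before [tri_root e] shorter than [e], so
    that such an agent cannot avoid the test of epoch [e]. *)
Definition e_ok e := [/\ e0 <= e, 5 <= e, run_time c e + 2 * e + 10 < 2 ^ half_up e & 2 * tri_root e <= e].

(** Restarts dated by clock reading instead of age, [V0 + start_1] and [V0 + end_1], which frees
    them from the initial clock. *)
Definition reset_1 e := 2 ^ e.-1 + e.-1.
Definition reset_2 e := 2 ^ e.-1 + 2 ^ half_up e + e.-1.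
Definition shows (md : bool) e V :=
  if md then reset_1 e + run_time c e + e < V < reset_2 e else (reset_2 e + run_time c e < V) && (V.+1 < reset_1 e.+1).
Definition shown (md : bool) e V : option Q0 :=
  ohead (if md then queue_1 prog e (V - (reset_1 e).+1) else queue_2 prog start2 e (V - (reset_2 e).+1)).

(** If a cell before [tri_root e] were no zone cell, the clock would start short enough for epoch
    [e] to begin, and its test to be over, before age [2 ^ e]. *)
Lemma alive_zones C n e : alive C n -> e_ok e -> 2 ^ e <= n ->
  forall d, 0 < d < tri_root e -> is_zone (C d).
Proof.
move=> A [h1 h2 h3 h4] Hn d Hd; apply/negPn/negP => Hz.
have d0 : 0 < d by case/andP: Hd.
have [c1 c2 c3 c4] := clockP prog start2 d0 Hz.
have HL : zone_len prog start2 C d < e by lia.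
move/negP: (Hz); apply; apply: (test_passed m0_ge prog_ok start2_ok spec A c2 c3 c4 h1 h2 HL h3) => //.
have := extE c4 HL; have := pow_e h2; have := pow_half h2; rewrite /start_1; move: Hn h3.
by move: (ext _ _) (run_time _ _) (2 ^ _) (2 ^ _) (2 ^ _); lia.
Qed.

Lemma alive_shows C n a e md : alive C n -> 0 < a -> ~~ is_zone (C a) -> e_ok e -> a.*2 <= e ->
  shows md e (clock C a + n) ->
  (exists2 b, kinds C n.*2 0 = Some b & isSome (ctl b) /\ sto b = shown md e (clock C a + n)) /\
  alive C n.+1.
Proof.
move=> A a0 Ha [h1 h2 h3 h4] Hae Hs.
have [c1 c2 c3 c4] := clockP prog start2 a0 Ha.
have HL : zone_len prog start2 C a < e by lia.
have Ex := extE c4 HL; have Pe := pow_e h2.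
set V0 := clock C a in c4 Hs Ex *.
have E1 : V0 + start_1 V0 e = reset_1 e by rewrite /start_1 /reset_1; lia.
have E2 : V0 + end_1 V0 e = reset_2 e by rewrite /end_1 /reset_2; lia.
have E3 : V0 + end_2 V0 e = reset_1 e.+1 by rewrite /end_2 /reset_1 /=; lia.
case: md Hs; rewrite /shows /shown /= => Hs.
  have -> : V0 + n - (reset_1 e).+1 = n - (start_1 V0 e).+1 by lia.
  have Hr : start_1 V0 e + run_time c e + e < n < end_1 V0 e.
    by lia.
  exact: (show_1 m0_ge prog_ok start2_ok spec A c2 c3 c4 h1 h2 HL h3 Hr).
have -> : V0 + n - (reset_2 e).+1 = n - (end_1 V0 e).+1 by lia.
have Hr1 : end_1 V0 e < n by lia.
have Hr2 : n.+1 < end_2 V0 e by lia.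
exact: (show_2 m0_ge prog_ok start2_ok spec A c2 c3 c4 h1 h2 HL h3 Hr1 Hr2).
Qed.

(** A clock below [2 ^ S.-1] means a zone shorter than [S] on an earlier carry path; its end moves
    at half speed and is caught by the diagonal starting at [T] before [4 * S + 4]. *)
Lemma chain_short C T a S : is_base (kinds C T 0) -> 0 < a -> ~~ is_zone (C a) -> a.*2 < S ->
  clock C a + T < 2 ^ S.-1 -> S.*2 <= T ->
  exists2 d, 0 < d <= 4 * S + 4 & ~~ is_zone (kinds C (T + d) d).
Proof.
move=> Hb a0 Ha HaS HV HT.
have [c1 c2 c3 c4] := clockP prog start2 a0 Ha.
set L0 := zone_len _ _ _ _ in c1 c2 c3 c4; set V0 := clock C a in HV c2 c4.
have A : alive C T./2 by apply: base_back Hb; lia.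
pose out d := ~~ in_zone L0 V0 d (T./2 - S).
have outS : out S.
  rewrite /out /in_zone negb_or -ltnNge -ltnNge; apply/andP; split; first by lia.
  by apply: leq_ltn_trans HV; lia.
have [d Hd Hleast] := ex_minnP (ex_intro out S outS).
have HdS : d <= S by apply: Hleast.
have d0 : 0 < d by case: (d) Hd => //; rewrite /out /in_zone leq0n.
have Hin : in_zone L0 V0 d.-1 (T./2 - S).
  by apply/negPn/negP => /Hleast; lia.
have Hm : T./2 - S + d <= T./2 by lia.
have Sk := skeletonP A c2 c3 c4 d0 Hm Hin.
have Hz : ~~ is_zone (kinds C ((T./2 - S).*2 + d) d) by rewrite (sk_pre Sk).
have HT2 : (T./2 - S).*2 + d <= T by lia.
have [x Hx Hx2] := front_later d0 HT2 Hz.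
by exists x => //; lia.
Qed.

End Agents.

Lemma tri_root_mono e e' : e <= e' -> tri_root e <= tri_root e'.
Proof.
move=> H; case: (posnP e) => [->|e_gt0]; first by [].
have /andP[H1 _] := tri_rootP e_gt0.
have /andP[_ H2] := tri_rootP (leq_trans e_gt0 H).
rewrite leqNgt; apply/negP => Hlt.
have : tri_root e' * (tri_root e').+1 <= tri_root e * (tri_root e).-1.
  by rewrite mulnC; apply: leq_mul; lia.
lia.
Qed.

Lemma bit_ones L i : i < L -> bit (2 ^ L).-1 i.
Proof.
move=> H; rewrite /bit.
have E : (2 ^ L).-1 = (2 ^ (L - i)).-1 * 2 ^ i + (2 ^ i).-1.
  have : 2 ^ L = 2 ^ (L - i) * 2 ^ i by rewrite -expnD; congr (_ ^ _); lia.
  have := pow_pos i; have := pow_pos (L - i); case: (2 ^ (L - i)) => // a _.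
  by rewrite mulSn /= => H1 ->; lia.
rewrite E divnMDl ?pow_pos // divn_small ?addn0; last by have := pow_pos i; lia.
have -> : 2 ^ (L - i) = (2 ^ (L - i).-1).*2 by rewrite -mul2n -expnS; congr (_ ^ _); lia.
by have := pow_pos (L - i).-1; case: (2 ^ _) => // a _; rewrite doubleS /= odd_double.
Qed.

(** * An initial pattern that keeps its base alive *)

Section Survivor.
Variables (Q0 : finType) (m0 P : nat) (prog : seq (instr Q0)) (start2 : nat).
Hypothesis m0_ge : 2 <= m0.
Hypothesis prog_ok : all (instr_ok m0 P) prog.
Hypothesis start2_ok : start2 <= P.
Hypothesis size_ok : size prog <= P.
Variables (w w' : nat -> seq Q0) (c e0 : nat) (i1 i2 : nat -> nat).
Hypothesis spec : program_spec w w' prog start2 c e0 i1 i2.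
Notation cell := (cell Q0 m0 P).
Notation kind := (option cell).

(** The address lies outside the program, where an empty queue means idling. The digits of
    [fresh_zone] are all 1, so the very first carry overflows and starts the first epoch,
    [L + 1]. *)
Definition fresh_base : cell := Cell (Some (inord (size prog))) true false (no_mark m0) None None None.
Definition fresh_zone : cell := Cell None true true (no_mark m0) None None None.

Definition quiet (s : option (bool * option bool * op Q0 m0)) :=
  match s with None => true | Some (_, None, Nop) => true | _ => false end.

Lemma quietP s : quiet s -> s = None \/ exists ca, s = Some (ca, None, Nop).
Proof. by case: s => [[[ca [b|]] [|j|j|j|j|a|a|]]|] //= _; [right; exists ca|left]. Qed.

Variable C : nat -> kind.
Notation K := (kinds prog start2 C).
Variables (L S : nat).
Hypotheses (C0 : C 0 = Some fresh_base) (CL : forall d, 0 < d <= L -> C d = Some fresh_zone)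
  (CN : C L.+1 = None).
Hypothesis L_gt0 : 0 < L.

Lemma fresh_phase t d : t + d <= L.*2.+2 -> d <= L.+1 ->
  if d is 0 then exists2 b, K t 0 = Some b &
     [/\ ctl b = Some (inord (size prog)), sto b = None, quiet (sg b) & t = 0 -> sg b = None]
  else if d <= L then exists2 z, K t d = Some z &
     [/\ ctl z = None, ls z = None, quiet (sg z) & t <= d -> sg z = None /\ dig z]
  else t <= L.+1 -> K t d = None.
Proof.
elim: t d => [|t IH] d Htd Hd.
  rewrite /kinds; case: d Htd Hd => [|d] Htd Hd; first by exists fresh_base.
  by case: ifP => HdL; [exists fresh_zone; rewrite ?CL|move=> _; have -> : d.+1 = L.+1 by lia].
case: d Htd Hd => [|d] Htd Hd.
  have [b Eb [Hc Hs Hq _]] := IH 0 ltac:(lia) isT.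
  have := IH 1 ltac:(lia) isT; rewrite L_gt0 => -[z Ez [Hzc Hzl _ _]].
  rewrite K_step Eb Ez /local Hc; case: (~~ odd t).
    rewrite /base_next /= Hzc Hzl /issue inordK ?ltnS // nth_default // Hs /=.
    by eexists; first by [].
  by rewrite /base_idle; eexists; first by [].
have Hl : exists2 l, left_of prog start2 C t d.+1 = Some l & quiet (sg l) /\ (t <= d -> sg l = None).
  case: d Htd Hd => [|d] Htd Hd.
    have [b Eb [_ _ Hq H0]] := IH 0 ltac:(lia) isT; exists b => //; split=> // Ht; apply: H0; lia.
  have := IH d.+1 ltac:(lia) ltac:(lia); rewrite ifT; last by lia.
  by move=> [z Ez [_ _ Hq Hi]]; exists z => //; split=> // Htd'; have [] := Hi Htd'.
have [l El [Hql Hil]] := Hl.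
case: ifP => HdL; last first.
  move=> HtL; have := IH d.+1 ltac:(lia) Hd; rewrite HdL => /(_ ltac:(lia)) En.
  by rewrite K_step En none_step El /carry_of Hil //; lia.
have := IH d.+1 ltac:(lia) Hd; rewrite HdL => -[z Ez [Hc Hls Hq Hi]].
have [Hr Hb] : lsin (K t d.+2) = None /\ is_base (K t d.+2) = false.
  have := IH d.+2 ltac:(lia) ltac:(lia); case: ifP => HdL2.
    by move=> [z' -> [Hc' Hl' _ _]]; rewrite /= Hc' Hl'.
  by move=> -> //; lia.
case: (quietP Hql) => [E|[ca E]].
  have H1 : isSome (left_of prog start2 C t d.+1) by rewrite El.
  have H2 : ~~ has_sg (left_of prog start2 C t d.+1) by rewrite El /= E.
  rewrite K_step Ez zone_step_keep //.
  eexists; first by []; split=> //= Ht; split=> //.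
  by have [] := Hi (leqW Ht).
have := zone_step_main prog start2 (~~ odd t) Hc E Hr.
rewrite /= !andbF /= Hb andbF /= K_step Ez El => ->.
eexists; first by []; split=> //= Ht.
by move: E; rewrite Hil.
Qed.

Hypothesis ok_e : forall e, L <= e -> e_ok c e0 e.
Hypothesis L_S : L < S.
Hypothesis tri_S : tri_root S <= L.+1.
(** The zone tries to enter place [y] at the end of epoch [y - 1], at an age of at least
    [2 ^ (y - 2)]. By then a base at [y] must have passed the test of epoch [y - 2], which the
    missing zone cell forbids. *)
Hypothesis no_bad : forall y, L.+2 <= y <= S.+1 -> is_base (C y) ->
  exists2 d, 0 < d < tri_root y.-2 & ~~ is_zone (C (y + d)).

Notation V0 := (2 ^ L).-1.

Lemma fresh_init : [/\ alive prog start2 C L.+1,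
  forall d, 0 < d <= L -> is_zone (K d d) /\ dig_of (K d d) = bit V0 d.-1,
  ~~ is_zone (K L.+1 L.+1) & V0 < 2 ^ L].
Proof.
split; last by have := pow_pos L; lia.
- have [] := fresh_phase (t := L.+1.*2) (d := 0) ltac:(lia) isT.
  by move=> b Eb [Hc _ _ _]; rewrite /alive Eb /= Hc.
- case=> // d /= Hd; have := fresh_phase (t := d.+1) (d := d.+1) ltac:(lia) ltac:(lia).
  rewrite Hd => -[z -> [Hc _ _ /(_ (leqnn _)) [_ Hdig]]].
  by rewrite /= Hc Hdig bit_ones.
have := fresh_phase (t := L.+1) (d := L.+1) ltac:(lia) (leqnn _).
by rewrite ltnn => -> .
Qed.

Lemma vir_stays n t d : alive prog start2 C n -> t <= n.*2 -> 0 < d <= L ->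
  is_zone (K t d) /\ vir_of (K t d).
Proof.
move=> A; elim: t d => [|t IH] d Ht Hd; first by rewrite /kinds CL.
have [Hz Hv] := IH d (ltnW Ht) Hd; rewrite K_step.
have Hl : isSome (left_of prog start2 C t d).
  case: d Hd {Hz Hv} => // -[|d] Hd /=.
    by have := alive_at A (ltnW Ht); case: (K t 0).
  by have [] := IH d.+1 (ltnW Ht) ltac:(lia); case: (K t d.+1).
by have [-> _ _ _ ->] := zone_step prog start2 (~~ odd t) (K t d.+1) Hz Hl.
Qed.

Lemma epoch_of n : L < n -> exists2 e, L < e & start_1 V0 e <= n < end_2 V0 e.
Proof.
have E e : L < e -> end_2 V0 e = start_1 V0 e.+1.
  move=> He; have := pow_pos L => p0.
  have H : V0 < 2 ^ L by lia.
  have := extE H He; have := extE H (leqW He); rewrite /end_2 /start_1 /=.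
  have : 2 ^ e = 2 * 2 ^ e.-1 by rewrite -expnS; congr (_ ^ _); lia.
  lia.
elim: n => // n IH Hn; case: (ltngtP L n) => HLn; [|lia|]; last first.
  exists L.+1 => //; rewrite E // /start_1 /ext HLn prednK ?pow_pos //= subnn; lia.
have [e He /andP[H1 H2]] := IH HLn.
case: (ltnP n.+1 (end_2 V0 e)) => H3; first by exists e => //; rewrite H3 (leqW H1).
exists e.+1; first exact: ltnW.
rewrite -E // H3 /= [end_2 V0 e.+1]E; last exact: ltnW.
apply: leq_ltn_trans H2 _; rewrite E // /start_1 /ext.
have : 2 ^ e < 2 ^ e.+1 by rewrite ltn_exp2l.
have : 2 ^ L <= 2 ^ e by rewrite leq_exp2l //; lia.
rewrite /=; have := pow_pos L; lia.
Qed.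

Lemma survivor n : n <= 2 ^ S.-1 -> alive prog start2 C n.
Proof.
have [A0 I1 I2 I3] := fresh_init.
elim: n => [|n IH] Hn; first by apply: (alive_at A0).
have A := IH (ltnW Hn).
case: (ltnP L n) => HLn; last by apply: (alive_at A0); lia.
have [e He Hne] := epoch_of HLn.
have [h1 h2 h3 h4] := ok_e (ltnW He).
have HeS : e <= S.
  rewrite leqNgt; apply/negP => HSe.
  have Ex := extE I3 He; have : 2 ^ S <= 2 ^ e.-1 by rewrite leq_exp2l //; lia.
  have : 2 ^ S = 2 * 2 ^ S.-1 by rewrite -expnS; congr (_ ^ _); lia.
  have : 2 ^ L <= 2 ^ S.-1 by rewrite leq_exp2l //; lia.
  by move: Hne Ex; rewrite /start_1; have := pow_pos L; lia.
apply: (survive m0_ge prog_ok start2_ok spec A I1 I2 I3 h1 h2 He h3 Hne).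
  (* The test concerns [d < tri_root e <= L + 1], hence only initial cells, all of them with
     [vir]. *)
  move=> d m Hd Em _ _ _; have Hdt := tri_root_mono HeS.
  by have [] := vir_stays (t := m.*2 + d) A ltac:(lia) (ltac:(lia) : 0 < d <= L).
move=> m Em _ V1; apply/negP => Hb.
have p0 := pow_pos L; have Hm : 2 ^ e.-1 <= m.
  have : 2 ^ e = 2 * 2 ^ e.-1 by rewrite -expnS; congr (_ ^ _); lia.
  have : 2 ^ L <= 2 ^ e.-1 by rewrite leq_exp2l //; lia.
  by lia.
have Hb0 : is_base (C e.+1) by apply: (base_back (t := 0) _ Hb).
have [|d Hd Hz] := no_bad (y := e.+1) _ Hb0; first by lia.
have Hbm : is_base (K m.*2 e.+1) by apply: base_back Hb; lia.
have Am : alive prog start2 (shift e.+1 C) m by rewrite /alive base_shift.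
have oke : e_ok c e0 e.-1 by apply: ok_e; lia.
have := alive_zones m0_ge prog_ok start2_ok spec Am oke Hm Hd.
by rewrite /shift (negbTE Hz).
Qed.

End Survivor.

(** * Contents of a window at a given time *)

Section Window.
Variables (Q0 : finType) (m0 P : nat) (prog : seq (instr Q0)) (start2 : nat).
Hypothesis m0_ge : 2 <= m0.
Hypothesis prog_ok : all (instr_ok m0 P) prog.
Hypothesis start2_ok : start2 <= P.
Variables (w w' : nat -> seq Q0) (c e0 : nat) (i1 i2 : nat -> nat).
Hypothesis spec : program_spec w w' prog start2 c e0 i1 i2.
Notation cell := (cell Q0 m0 P).
Notation kind := (option cell).
Notation kinds := (kinds prog start2).

(** The initial cells without which no base is alive at half-step [2 ^ s]: those inspected by the
    test of epoch [s - 1]. *)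
Definition heavy s (C : nat -> kind) :=
  is_base (C 0) && all (fun d => is_zone (C d)) (iota 1 (tri_root s.-1).-1).
Definition has_gap A (C : nat -> kind) := has (fun d => ~~ is_zone (C d.+1)) (iota 0 A).
Definition first_gap A (C : nat -> kind) := (find (fun d => ~~ is_zone (C d.+1)) (iota 0 A)).+1.
Definition clk A (C : nat -> kind) := clock prog start2 C (first_gap A C).

Definition near B r V := (r <= V + B) && (V <= r + B).
Definition margin s N := run_time c (s + 3) + s + 4 + N.
(** The clock readings to be considered lie between [2 ^ s.-1] and [2 ^ (s + 2)], so only the resets
    of the epochs [s] to [s + 3] can be near. *)
Definition bad s N V :=
  has (fun e => near (margin s N) (reset_1 e) V || near (margin s N) (reset_2 e) V) (iota s 4).

Lemma run_time_mono e e' : e <= e' -> run_time c e <= run_time c e'.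
Proof. by move=> H; rewrite /run_time leq_mul2l leq_mul ?orbT. Qed.

Lemma not_bad_shows s N V : 5 <= s -> 2 ^ s.-1 <= V -> V < 2 ^ (s + 2) -> ~~ bad s N V ->
  exists md e, s <= e <= s + 2 /\ forall x, V <= x + N -> x <= V + N -> shows c md e x.
Proof.
move=> s5 H1 H2 /hasPn Hb.
have near_e e : s <= e <= s + 3 -> ~~ near (margin s N) (reset_1 e) V /\ ~~ near (margin s N) (reset_2 e) V.
  by move=> He; have := Hb e; rewrite mem_iota => /(_ ltac:(lia)); rewrite negb_or => /andP.
have side r : ~~ near (margin s N) r V -> V + margin s N < r \/ r + margin s N < V.
  by rewrite /near negb_and -!ltnNge => /orP[]; [left|right].
have mar e : s <= e <= s + 2 -> run_time c e + e + N < margin s N.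
  move=> He; have := @run_time_mono e (s + 3) ltac:(lia); rewrite /margin; lia.
have L1 : reset_1 s + margin s N < V.
  have [/side[Hs|//] _] := near_e s ltac:(lia).
  by move: Hs; rewrite /reset_1 /margin; lia.
have L2 : V + margin s N < reset_1 (s + 3).
  have [/side[//|Hs] _] := near_e (s + 3) ltac:(lia); move: Hs.
  have -> : reset_1 (s + 3) = 2 ^ (s + 2) + (s + 2) by rewrite /reset_1 !addnS.
  lia.
have inside e : s <= e <= s + 2 -> reset_1 e + margin s N < V -> V + margin s N < reset_1 e.+1 ->
  exists md e, s <= e <= s + 2 /\ forall x, V <= x + N -> x <= V + N -> shows c md e x.
  move=> He Ha Hb'; have := mar e He; have [_ /side[Hs|Hs]] := near_e e ltac:(lia) => Hm.
    by exists true, e; split=> // x Hx1 Hx2; rewrite /shows; lia.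
  by exists false, e; split=> // x Hx1 Hx2; rewrite /shows; lia.
have [/side[Hs|Hs] _] := near_e s.+1 ltac:(lia); first by apply: (inside s) => //; lia.
have [/side[Ht|Ht] _] := near_e s.+2 ltac:(lia); first by apply: (inside s.+1) => //; lia.
have E3 : s.+3 = s + 3 by lia.
by apply: (inside s.+2); rewrite ?E3 //; lia.
Qed.

Lemma gap_clock A C : has_gap A C -> [/\ 0 < first_gap A C <= A, ~~ is_zone (C (first_gap A C)) &
  clk A C < 2 ^ A.*2].
Proof.
move=> H; have Hf : 0 < first_gap A C <= A.
  by rewrite /first_gap /=; move: H; rewrite /has_gap has_find size_iota.
have Hz : ~~ is_zone (C (first_gap A C)).
  have Hlt : find (fun d => ~~ is_zone (C d.+1)) (iota 0 A) < A.
    by move: H; rewrite /has_gap has_find size_iota.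
  by have := nth_find 0 H; rewrite nth_iota.
split=> //; have [|c1 _ _ c4] := clockP prog start2 _ Hz; first by case/andP: Hf.
by apply: leq_trans c4 _; rewrite leq_exp2l //; lia.
Qed.

Variable x : nat -> Q0 * kind.
Let C i := (x i).2.
Notation G t := (iter t (@global Q0 m0 P prog start2) x).
Notation K := (kinds C).

Variables (s t o M N A : nat).
Hypotheses (s_ge : 6 <= s) (t_ge : 2 ^ s <= t) (t_lt : t < 2 ^ s.+1) (MN : M + N + 8 * s + 32 <= 2 ^ s.-1)
  (A_s : A.*2 <= s) (o_ge : M + N < o).
Hypothesis ok_e : forall e, s.-1 <= e -> e_ok c e0 e.

Hypothesis H1 : exists2 j, 0 < j <= M & forall n, n <= 2 ^ s.+1 -> is_base (K n.*2 (o - j)).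
Hypothesis H2 : forall p, o <= p + (4 * s + 20) -> p < o + N -> ~~ heavy s (shift p C).
Hypothesis H3 : forall p, o <= p + (M + N) -> p < o + N -> has_gap A (shift p C).
Hypothesis H4 : forall j, 0 < j <= M -> heavy s (shift (o - j) C) ->
  ~~ bad s N (clk A (shift (o - j) C) + (t - j)).

Let pow_s : 2 ^ s = 2 * 2 ^ s.-1.
Proof. by rewrite -expnS; congr (_ ^ _); lia. Qed.

Lemma late_heavy T p : 2 ^ s <= T -> is_base (K T p) -> heavy s (shift p C).
Proof.
move=> HT Hb; have Hb2 : is_base (K (2 ^ s.-1).*2 p) by apply: base_back Hb; lia.
have Am : alive prog start2 (shift p C) (2 ^ s.-1) by rewrite /alive base_shift.
apply/andP; split; first by rewrite /shift addn0; apply: (base_back (t := 0) _ Hb).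
apply/allP => d; rewrite mem_iota => Hd.
apply: (alive_zones m0_ge prog_ok start2_ok spec Am (ok_e (leqnn _)) (leqnn _)).
lia.
Qed.

Lemma clk_small p : o <= p + (M + N) -> p < o + N -> clk A (shift p C) < 2 ^ s.
Proof.
move=> Hp Hp'; have [_ _ H] := gap_clock (H3 Hp Hp').
by apply: leq_trans H _; rewrite leq_exp2l.
Qed.

Lemma window_empty z : o <= z < o + N -> K t.*2 z = None.
Proof.
move=> Hz; apply/eqP; case: (boolP (K t.*2 z == None)) => // Hn; exfalso.
have [j0 Hj0 Hs0] := H1.
have HDt : M + N <= t.*2 by lia.
have Hbase : exists2 j, j <= M + N & is_base (K (t.*2 - j) (z - j)) /\
      j <= z /\ forall i, i < j -> is_zone (K (t.*2 - i) (z - i)).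
  (* The walk back cannot cross the survivor, whose place is a base and never a zone cell. *)
  case: (chain HDt Hn) => // -[_ Hi].
  have : is_zone (K (t.*2 - (z - (o - j0))) (z - (z - (o - j0)))) by apply: Hi; lia.
  have -> : z - (z - (o - j0)) = o - j0 by lia.
  have Hb : is_base (K (t.*2 - (z - (o - j0))) (o - j0)).
    apply: (base_back (t' := t.*2)); first by lia.
    by apply: Hs0; apply: ltnW.
  by rewrite (is_base_zone Hb).
have [j Hj [Hb [Hjz Hi]]] := Hbase.
have Hh : heavy s (shift (z - j) C) by apply: late_heavy Hb; lia.
(* A base this close would be a forbidden heavy one. A farther one is out of range: [4 * s + 20] is
   the bound of [chain_short] for [S = s + 4]. *)
case: (leqP j (4 * s + 20)) => Hjs.
  by move/negP: (H2 (p := z - j) ltac:(lia) ltac:(lia)); apply.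
have [G1 G2 _] := gap_clock (H3 (p := z - j) ltac:(lia) ltac:(lia)).
have G3 := clk_small (p := z - j) ltac:(lia) ltac:(lia).
have Hb' : is_base (kinds (shift (z - j) C) (t.*2 - j) 0) by rewrite base_shift.
have E4 : 2 ^ (s + 4).-1 = 8 * 2 ^ s by rewrite addnS /= expnD mulnC.
have E1 : 2 ^ s.+1 = 2 * 2 ^ s by rewrite expnS.
have [||||d Hd Hnz] := chain_short m0_ge prog_ok start2_ok (S := s + 4) Hb' _ G2.
- by case/andP: G1.
- by lia.
- by rewrite -/(clk A (shift (z - j) C)); move: E4 E1 G3 t_lt; lia.
- by lia.
have Ek := @kinds_shift _ _ _ prog start2 C (z - j) (t.*2 - j) _ (t.*2 - j + d) d (leqnn _).
move: Hnz; rewrite Ek ?Hb //.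
have := Hi (j - d) ltac:(lia).
have -> : t.*2 - (j - d) = t.*2 - j + d by lia.
have -> : z - (j - d) = z - j + d by lia.
by move=> ->.
Qed.

Lemma window_letters : exists md e j, let V := clk A (shift (o - j) C) + (t - j) in
  [/\ s <= e <= s + 2, 0 < j <= M, clk A (shift (o - j) C) < 2 ^ A.*2,
      forall y, V <= y + N -> y <= V + N -> shows c md e y &
      forall i a, i < N -> shown prog start2 md e (V - i) = Some a -> (G t (o + i)).1 = a].
Proof.
have [j0 Hj0 Hs0] := H1.
(* Life is required only up to [t - j - N], before the earliest of the [N] emissions, so that any
   nearer base standing in the way of a letter contradicts the minimality of [j]. That the chosen
   base lives on follows from its clock, in [stay]. *)
pose at_ j := (0 < j <= M) && is_base (K (t - j - N).*2 (o - j)).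
have Hat0 : at_ j0 by rewrite /at_ Hj0; apply: Hs0; lia.
have [j /andP[Hj Hb] Hmin] := ex_minnP (ex_intro at_ j0 Hat0).
have Hheavy : heavy s (shift (o - j) C) by apply: late_heavy Hb; lia.
have Hnb := H4 Hj Hheavy.
have Hgap := H3 (p := o - j) ltac:(lia) ltac:(lia).
have [G1 G2 G3] := gap_clock Hgap.
have G4 := clk_small (p := o - j) ltac:(lia) ltac:(lia).
have E2 : 2 ^ (s + 2) = 4 * 2 ^ s by rewrite expnD mulnC.
have E1 : 2 ^ s.+1 = 2 * 2 ^ s by rewrite expnS.
set V := clk A _ + (t - j) in Hnb; set V0 := clk A _ in G3 G4 V Hnb.
have [|||md [e [He Hshow]]] := not_bad_shows (s := s) (N := N) _ _ _ Hnb; [by lia|by lia|by move: t_lt; lia|].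
exists md, e, j; split=> //.
have oke : e_ok c e0 e by apply: ok_e; lia.
have step n : t - j - N <= n -> n <= t - j + N -> alive prog start2 (shift (o - j) C) n ->
    (exists2 b, kinds (shift (o - j) C) n.*2 0 = Some b &
       isSome (ctl b) /\ sto b = shown prog start2 md e (V0 + n)) /\ alive prog start2 (shift (o - j) C) n.+1.
  move=> Hn1 Hn2 An; apply: (alive_shows m0_ge prog_ok start2_ok spec An _ G2 oke).
  - by case/andP: G1.
  - by lia.
  - by apply: (Hshow (V0 + n)); rewrite /V; lia.
have stay k : k <= N.*2 -> alive prog start2 (shift (o - j) C) (t - j - N + k).
  elim: k => [|k IH] Hk; first by rewrite addn0 /alive base_shift.
  by rewrite addnS; have [//| |_ ] := step (t - j - N + k) _ _ (IH (ltnW Hk)); try lia.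
move=> i a Hi Ha.
have An := stay (N - i) ltac:(lia).
have En : t - j - N + (N - i) = t - (j + i) by lia.
rewrite En in An.
have [[b Eb [Hc Hsto]] _] := step (t - (j + i)) ltac:(lia) ltac:(lia) An.
have Eb' : K (t - (j + i)).*2 (o + i - (j + i)) = Some b.
  have -> : o + i - (j + i) = o - j by lia.
  have Ek := @kinds_shift _ _ _ prog start2 C (o - j) (t - (j + i)).*2 _ (t - (j + i)).*2 0 (leq_addr _ _).
  have An' : is_base (kinds (shift (o - j) C) (t - (j + i)).*2 0) := An.
  by rewrite -Eb Ek ?addn0 // An' orbT.
have [r1 r2 r3] : [/\ 0 < j + i, j + i <= t & j + i <= o + i].
  by move: Hj Hi MN t_ge o_ge pow_s; clear => *; split; lia.
apply: (ray r1 r2 r3 _ Eb' Hc).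
  move=> k Hk; apply/negP => Hbk.
  have [k1 k2] : 2 ^ s <= (t - k).*2 /\ (k <= i -> o <= o + i - k + (4 * s + 20) /\ o + i - k < o + N).
    by move: Hk Hj Hi MN t_ge o_ge pow_s; clear; lia.
  have Hk2 : heavy s (shift (o + i - k) C) by apply: late_heavy k1 Hbk.
  case: (leqP k i) => Hki; first by have [k3 k4] := k2 Hki; move/negP: (H2 k3 k4); apply.
  have [k5 k6 k7 k8] : [/\ 0 < k - i <= M, o - (k - i) = o + i - k, (t - (k - i) - N).*2 <= (t - k).*2 & k - i < j].
    by move: Hki Hk Hj Hi MN t_ge o_ge pow_s; clear => *; split; lia.
  have : at_ (k - i) by rewrite /at_ k5 k6; apply: base_back k7 Hbk.
  by move/Hmin; rewrite leqNgt k8.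
rewrite Hsto -Ha; congr (shown _ _ _ _ _); rewrite /V.
by move: Hj Hi MN t_ge o_ge pow_s; clear; lia.
Qed.

End Window.

(** * Occurrences in periodic words *)

Lemma nth_iter_rot T (a0 : T) q k j : j < size q ->
  nth a0 (iter k (rot 1) q) j = nth a0 q ((j + k) %% size q).
Proof.
elim: k j => [|k IH] j Hj; first by rewrite addn0 modn_small.
have Hs : size (iter k (rot 1) q) = size q by elim: (k) => //= k' IHk; rewrite size_rot.
rewrite iterS; have E : nth a0 (rot 1 (iter k (rot 1) q)) j = nth a0 (iter k (rot 1) q) (j.+1 %% size q).
  move: Hs; case: (iter k _ _) => [|b r] /= Hs; first by rewrite -Hs in Hj.
  rewrite rot1_cons nth_rcons -Hs; case: (ltngtP j (size r)) => Hjr.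
  - by rewrite modn_small.
  - by move: Hj; rewrite -Hs; lia.
  - by rewrite Hjr modnn.
rewrite E IH ?ltn_pmod //; last by lia.
by rewrite modnDml addSn addnS.
Qed.

Lemma ohead_iter_rot_rev T (a0 : T) W k i : i <= k -> 0 < size W ->
  ohead (iter (k - i) (rot 1) (rev W)) =
  Some (nth a0 W (((size W).-1 - k %% size W + i) %% size W)).
Proof.
move=> Hi Hw; have Hl : 0 < size (rev W) by rewrite size_rev.
have Hs : size (iter (k - i) (rot 1) (rev W)) = size W.
  by elim: (k - i) => [|k' IHk] /=; rewrite ?size_rev // size_rot.
have := nth_iter_rot a0 (k - i) Hl; rewrite add0n size_rev.
case: (iter _ _ _) Hs => [|b r] Hs /=; first by move: Hw; rewrite -Hs.
move=> ->; congr Some; rewrite nth_rev ?ltn_pmod //; congr nth.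
set l := size W in Hw *; set a := (k - i) %% l.
have -> : l - a.+1 = (l - a.+1) %% l by rewrite modn_small //; lia.
apply/eqP; rewrite -(eqn_modDr (k %% l + a)).
have -> : l - a.+1 + (k %% l + a) = l.-1 + k %% l by lia.
have -> : l.-1 - k %% l + i + (k %% l + a) = l.-1 + (a + i) by lia.
by rewrite eqn_modDl modn_mod modnDml subnK.
Qed.

Lemma count_iota_shift (f : nat -> bool) b n :
  count (fun i => f (b + i)) (iota 0 n) = count f (iota b n).
Proof. by rewrite -{2}(addn0 b) iotaDl count_map; apply: eq_count. Qed.

Section Periodic.
Variables (T : eqType) (a0 : T) (W u : seq T).
Let l := size W.
Hypothesis l_gt0 : 0 < l.

(** Occurrence of [u] at [r] in the periodic repetition of [W]. *)
Definition cyc r := all (fun k => nth a0 W ((r + k) %% l) == nth a0 u k) (iota 0 (size u)).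

Lemma cyc_mod r : cyc (r %% l) = cyc r.
Proof. by apply: eq_all => k; rewrite modnDml. Qed.

Lemma count_shift (f : nat -> bool) a n :
  (forall r, f (r %% l) = f r) -> count (fun i => f (a + i)) (iota 0 (n * l)) = n * count f (iota 0 l).
Proof.
move=> Hf; have one b : count (fun i => f (b + i)) (iota 0 l) = count f (iota 0 l).
  elim: b => [|b <-]; first by apply: eq_count.
  rewrite !count_iota_shift.
  have : count f (iota b l.+1) = count f (iota b l) + f (b + l).
    by rewrite -addn1 iotaD count_cat /= addn0.
  have -> : f (b + l) = f b by rewrite -Hf -[RHS]Hf modnDr.
  by rewrite /= addnC => /addIn.
elim: n a => [|n IH] a; first by rewrite !mul0n.
rewrite mulSn iotaD count_cat one mulSn; congr (_ + _).
rewrite -(IH (a + l)) add0n -(count_iota_shift (fun i => f (a + i))).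
by apply: eq_count => i /=; rewrite addnA.
Qed.

Definition cocc := count cyc (iota 0 l).

Lemma occ_cyc r : r + size u <= l -> (take (size u) (drop r W) == u) = cyc r.
Proof.
move=> Hr; apply/eqP/allP => [E k|H].
  rewrite mem_iota add0n => /andP[_ Hk]; rewrite -{1}E nth_take // nth_drop modn_small //.
  by apply: leq_trans Hr; rewrite ltn_add2l.
apply: (@eq_from_nth _ a0); first by rewrite size_takel // size_drop leq_subRL; lia.
move=> k; rewrite size_takel; last by rewrite size_drop; lia.
move=> Hk; rewrite nth_take // nth_drop.
have := H k; rewrite mem_iota add0n Hk => /(_ isT) /eqP <-.
by rewrite modn_small //; apply: leq_trans Hr; rewrite ltn_add2l.
Qed.

(** Only occurrences across the seam of two periods are missed by [occ]. The successor is for the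
    empty [u], which [occ] counts once more than there are letters. *)
Lemma cocc_occ : size u < l -> occ W u <= cocc.+1 /\ cocc <= occ W u + size u.
Proof.
move=> Hu; have E : occ W u = count cyc (iota 0 (l - size u).+1).
  by apply: eq_in_count => r; rewrite mem_iota => Hr; apply: occ_cyc; rewrite /l in Hu *; lia.
rewrite E /cocc; have Hl : l = (l - size u) + size u by lia.
have H1 : count cyc (iota 0 (l - size u).+1) = count cyc (iota 0 (l - size u)) + cyc (l - size u).
  by rewrite -(addn1 (l - size u)) iotaD count_cat /= addn0.
have H2 : count cyc (iota 0 l) = count cyc (iota 0 (l - size u)) + count cyc (iota (l - size u) (size u)).
  by rewrite {1}Hl iotaD count_cat.
have := count_size cyc (iota (l - size u) (size u)); rewrite size_iota H1 H2.
by case: (cyc _); lia.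
Qed.

Definition hits N x := count (fun i => cyc (x + i)) (iota 0 N).

Lemma hits_bounds N x : N %/ l * cocc <= hits N x <= (N %/ l).+1 * cocc.
Proof.
have H := fun n => @count_shift cyc x n cyc_mod.
rewrite /hits /cocc -!H; apply/andP; split.
  have {2}-> : N = N %/ l * l + N %% l by exact: divn_eq.
  by rewrite iotaD count_cat leq_addr.
have E : (N %/ l).+1 * l = N + ((N %/ l).+1 * l - N).
  by rewrite subnKC //; apply: ltnW; apply: ltn_ceil.
by rewrite E iotaD count_cat leq_addr.
Qed.

End Periodic.

(** * Occurrences in the displayed words *)

Section Counting.
Variables (Q0 : finType) (m0 P : nat) (prog : seq (instr Q0)) (start2 : nat).
Variables (w w' : nat -> seq Q0) (c e0 : nat) (i1 i2 : nat -> nat).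
Hypothesis spec : program_spec w w' prog start2 c e0 i1 i2.

Definition word_of (md : bool) e := if md then w (i1 e) else w' (i2 e).

(** The word is the content of the queue, which is bounded by [e]. *)
Lemma word_size md e : e0 <= e -> size (word_of md e) <= e.
Proof.
move=> He; case: md; rewrite /word_of.
  have [t1 [t2 [_ _ _ H B]]] := mode1_run spec He.
  have [_ _ E] := H _ (leqnn t2); have [_] := B t2.
  by rewrite E subnn /= size_rev.
have [t2 [_ _ H B]] := mode2_run spec He.
have [_ E] := H _ (leqnn t2); have [_] := B t2.
by rewrite E subnn /= size_rev.
Qed.

Lemma shown_word (a0 : Q0) md e N V : e0 <= e -> 0 < size (word_of md e) ->
  (forall i, i < N -> shows c md e (V - i)) ->
  exists x, forall i, i < N -> i <= V ->
    shown prog start2 md e (V - i) = Some (nth a0 (word_of md e) ((x + i) %% size (word_of md e))).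
Proof.
move=> He Hw Hs; case: N Hs => [|N] Hs; first by exists 0.
case: md Hw Hs => Hw Hs; rewrite /word_of /shown.
  have [t1 [t2 [Ht _ _ H _]]] := mode1_run spec He.
  exists ((size (w (i1 e))).-1 - (V - (reset_1 e).+1 - t2) %% size (w (i1 e))) => i Hi HV.
  have := Hs i Hi; rewrite /shows => Hsi.
  have Hk : t2 <= V - i - (reset_1 e).+1 by lia.
  have [_ _ E] := H _ Hk; rewrite /queue_1 E.
  have -> : V - i - (reset_1 e).+1 - t2 = V - (reset_1 e).+1 - t2 - i by lia.
  by apply: ohead_iter_rot_rev => //; lia.
have [t2 [Ht _ H _]] := mode2_run spec He.
exists ((size (w' (i2 e))).-1 - (V - (reset_2 e).+1 - t2) %% size (w' (i2 e))) => i Hi HV.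
have := Hs i Hi; rewrite /shows => Hsi.
have Hk : t2 <= V - i - (reset_2 e).+1 by lia.
have [_ E] := H _ Hk; rewrite /queue_2 E.
have -> : V - i - (reset_2 e).+1 - t2 = V - (reset_2 e).+1 - t2 - i by lia.
by apply: ohead_iter_rot_rev => //; lia.
Qed.

Notation Q := (Q0 * option (cell Q0 m0 P))%type.
Variable d : Q.

Definition wcount (y : nat -> Q) (u : seq Q) N :=
  count (fun i => all (fun k => y (i + k) == nth d u k) (iota 0 (size u))) (iota 0 N).

Lemma wcount_not_emb (y : nat -> Q) u N : (forall i, i < N + size u -> (y i).2 = None) ->
  has (fun q : Q => q.2 != None) u -> wcount y u N = 0.
Proof.
move=> Hy /(has_nthP d)[k Hk Hq]; apply/eqP; rewrite -leqn0 leqNgt -has_count; apply/negP.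
move=> /hasP[i]; rewrite mem_iota => /andP[_ Hi] /allP /(_ k).
rewrite mem_iota add0n Hk => /(_ isT) /eqP E.
by move: Hq; rewrite -E Hy //; lia.
Qed.

Lemma wcount_emb (y : nat -> Q) (v : seq Q0) N W a0 x : 0 < size W ->
  (forall i, i < N + size v -> y i = (nth a0 W ((x + i) %% size W), None)) ->
  wcount y [seq (q, None) | q <- v] N = hits a0 W v N x.
Proof.
move=> Hw Hy; apply: eq_in_count => i; rewrite mem_iota => /andP[_ Hi].
rewrite size_map; apply: eq_in_all => k; rewrite mem_iota => /andP[_ Hk].
rewrite Hy; last by lia.
rewrite (nth_map a0) ?addnA //.
by apply/eqP/eqP => [[->]|->].
Qed.

End Counting.

(** * Finite Bernoulli expectations *)

Import Order.TTheory GRing.Theory Num.Theory.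
Local Open Scope ring_scope.

Lemma ler_sum_mem (R : realFieldType) (I : eqType) (r : seq I) (F G : I -> R) :
  (forall i, i \in r -> F i <= G i) -> \sum_(i <- r) F i <= \sum_(i <- r) G i.
Proof. by move=> H; rewrite [leLHS]big_seq [leRHS]big_seq; apply: ler_sum => i /H. Qed.

Section Expectation.
Variables (R : realFieldType) (Q : finType) (p : Q -> R).

Fixpoint Ex n (f : seq Q -> R) : R :=
  if n is n'.+1 then \sum_q p q * Ex n' (fun s => f (q :: s)) else f [::].

Lemma eq_Ex n f g : (forall s, size s = n -> f s = g s) -> Ex n f = Ex n g.
Proof.
elim: n f g => [|n IH] f g H; first exact: H.
by apply: eq_bigr => q _; congr (_ * _); apply: IH => s Hs; apply: H; rewrite /= Hs.
Qed.

Lemma ExD n f g : Ex n (fun s => f s + g s) = Ex n f + Ex n g.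
Proof.
elim: n f g => [|n IH] f g //=; rewrite -big_split; apply: eq_bigr => q _.
by rewrite IH mulrDr.
Qed.

Lemma ExZ n a f : Ex n (fun s => a * f s) = a * Ex n f.
Proof.
elim: n f => [|n IH] f //=; rewrite mulr_sumr; apply: eq_bigr => q _.
by rewrite IH mulrCA.
Qed.

Lemma Ex0 n : Ex n (fun=> 0) = 0.
Proof. by elim: n => [|n IH] //=; rewrite big1 // => q _; rewrite IH mulr0. Qed.

Lemma ExB n f g : Ex n (fun s => f s - g s) = Ex n f - Ex n g.
Proof.
rewrite ExD; congr (_ + _); rewrite -mulN1r -ExZ.
by apply: eq_Ex => s _; rewrite mulN1r.
Qed.

Lemma Ex_sum n I (r : seq I) (F : I -> seq Q -> R) :
  Ex n (fun s => \sum_(i <- r) F i s) = \sum_(i <- r) Ex n (F i).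
Proof.
elim: r => [|i r IH]; first by rewrite big_nil -[RHS](Ex0 n); apply: eq_Ex => s _; rewrite big_nil.
by rewrite big_cons -IH -ExD; apply: eq_Ex => s _; rewrite big_cons.
Qed.

Lemma Ex_cat a b f : Ex (a + b) f = Ex a (fun s => Ex b (fun s' => f (s ++ s'))).
Proof. by elim: a f => [|a IH] f //=; apply: eq_bigr => q _; rewrite IH. Qed.

Lemma Ex_tuple n (f : seq Q -> R) : \sum_(v : n.-tuple Q) (\prod_(q <- v) p q) * f v = Ex n f.
Proof.
elim: n f => [|n IH] f /=.
  rewrite (big_pred1 [tuple]); first by rewrite big_nil mul1r.
  by move=> v /=; apply/esym/eqP; rewrite [v]tuple0.
rewrite (reindex (fun x : Q * n.-tuple Q => cons_tuple x.1 x.2)) /=; last first.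
  exists (fun v : n.+1.-tuple Q => (thead v, behead_tuple v)) => [[q v] _|v _] /=.
    by congr (_, _); apply/val_inj.
  by rewrite [in RHS](tuple_eta v).
rewrite -(pair_bigA _ (fun q (v : n.-tuple Q) => (\prod_(q' <- q :: v) p q') * f (q :: v))) /=.
apply: eq_bigr => q _; rewrite -IH mulr_sumr; apply: eq_bigr => v _.
by rewrite big_cons mulrA.
Qed.

Hypothesis p_ge0 : forall q, 0 <= p q.
Hypothesis p_sum : \sum_q p q = 1.

Lemma Ex_le n f g : (forall s, size s = n -> f s <= g s) -> Ex n f <= Ex n g.
Proof.
elim: n f g => [|n IH] f g H; first exact: H.
apply: ler_sum => q _; apply: ler_wpM2l => //; apply: IH => s Hs.
by apply: H; rewrite /= Hs.
Qed.

Lemma Ex_const n a : Ex n (fun=> a) = a.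
Proof. by elim: n => //= n IH; rewrite -mulr_suml p_sum mul1r IH. Qed.

Lemma Ex_ge0 n f : (forall s, size s = n -> 0 <= f s) -> 0 <= Ex n f.
Proof. by move=> H; rewrite -[leLHS](Ex_const n); apply: Ex_le. Qed.

Lemma Ex_indep a b f g :
  Ex (a + b) (fun s => f (take a s) * g (drop a s)) = Ex a f * Ex b g.
Proof.
rewrite Ex_cat mulrC -ExZ; apply: eq_Ex => s Hs; rewrite mulrC -ExZ.
by apply: eq_Ex => s' _; rewrite -Hs take_size_cat // drop_size_cat.
Qed.

Lemma Ex_drop a b f : Ex (a + b) (fun s => f (drop a s)) = Ex b f.
Proof.
rewrite -[RHS]mul1r -(Ex_const a 1) -Ex_indep.
by apply: eq_Ex => s _; rewrite mul1r.
Qed.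

Lemma Ex_take a b f : Ex (a + b) (fun s => f (take a s)) = Ex a f.
Proof.
rewrite -[RHS]mulr1 -(Ex_const b 1) -Ex_indep.
by apply: eq_Ex => s _; rewrite mulr1.
Qed.

Definition prob n (E : seq Q -> bool) := Ex n (fun s => (E s)%:R).

Lemma prob_le n (E F : seq Q -> bool) : (forall s, size s = n -> E s -> F s) -> prob n E <= prob n F.
Proof.
move=> H; apply: Ex_le => s Hs; case Es : (E s) => //; by rewrite (H s).
Qed.

Lemma prob_le1 n (E : seq Q -> bool) : prob n E <= 1.
Proof. by rewrite -(Ex_const n 1); apply: Ex_le => s _; rewrite lern1; case: (E s). Qed.

Lemma prob_ge0 n E : 0 <= prob n E.
Proof. by apply: Ex_ge0 => s _; rewrite ler0n. Qed.

Lemma prob_union n I (r : seq I) (E : I -> seq Q -> bool) (F : seq Q -> bool) :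
  (forall s, size s = n -> F s -> has (fun i => E i s) r) ->
  prob n F <= \sum_(i <- r) prob n (E i).
Proof.
move=> H; rewrite -Ex_sum; apply: Ex_le => s Hs; case Fs : (F s); last by apply: sumr_ge0.
have : has (fun i => E i s) r by apply: H.
elim: (r) => [//|i r' IH] /=; rewrite big_cons => /orP[->|/IH H'].
  by rewrite lerDl; apply: sumr_ge0.
by apply: (le_trans H'); rewrite lerDr.
Qed.

Lemma prob_not n E : prob n (fun s => ~~ E s) = 1 - prob n E.
Proof.
rewrite -{1}(Ex_const n 1) -ExB; apply: eq_Ex => s _.
by case: (E s); rewrite ?subrr ?subr0.
Qed.

(** [~~ F d] rules out runs that leave the word, so no condition on [n] is necessary. *)
Lemma prob_run (d : Q) (F : Q -> bool) n a k : ~~ F d ->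
  prob n (fun s => all (fun i => F (nth d s (a + i))) (iota 0 k)) <= (\sum_(q | F q) p q) ^+ k.
Proof.
move=> Fd; set th := \sum_(q | F q) p q.
have th_ge0 : 0 <= th by apply: sumr_ge0.
elim: n a k => [|n IH] a [|k]; rewrite ?expr0; try exact: prob_le1.
  rewrite /prob /= nth_nil (negbTE Fd) /=; exact: exprn_ge0.
case: a => [|a].
  have le1 : prob n.+1 (fun s => all (fun i => F (nth d s (0 + i))) (iota 0 k.+1)) <=
      \sum_q p q * ((F q)%:R * th ^+ k).
    apply: ler_sum => q _; apply: ler_wpM2l => //.
    apply: le_trans (_ : Ex n (fun s => (F q)%:R * (all (fun i => F (nth d s (0 + i))) (iota 0 k))%:R) <= _).
      apply: Ex_le => s _ /=; case: (F q); rewrite ?mul1r ?mul0r //.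
      by rewrite -[1%N]addn0 iotaDl all_map.
    by rewrite ExZ; apply: ler_wpM2l; [exact: ler0n|exact: IH].
  apply: le_trans le1 _; rewrite exprS /th mulr_suml [leRHS]big_mkcond.
  by apply: ler_sum => q _; case: (F q); rewrite ?mul1r // mul0r mulr0.
apply: le_trans (_ : \sum_q p q * th ^+ k.+1 <= _).
  by apply: ler_sum => q _; apply: ler_wpM2l => //; exact: IH.
by rewrite -mulr_suml p_sum mul1r.
Qed.

Lemma prob_exact (E : nat -> Q -> bool) (d : Q) k b :
  prob (k + b) (fun s => all (fun i => E i (nth d s i)) (iota 0 k)) = \prod_(i < k) \sum_(q | E i q) p q.
Proof.
elim: k E => [|k IH] E; first by rewrite big_ord0 /prob Ex_const.
rewrite big_ord_recl mulr_suml [RHS]big_mkcond; apply: eq_bigr => q _ /=.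
under [X in p q * X]eq_Ex => s _ do rewrite -[1%N]addn0 iotaDl all_map.
case: (E 0%N q) => /=; last by rewrite Ex0 mulr0.
by congr (_ * _); rewrite -(IH (fun i => E i.+1)).
Qed.

Fixpoint fails (E : seq Q -> bool) l r (s : seq Q) :=
  if r is r'.+1 then ~~ E (take l s) && fails E l r' (drop l s) else true.

Lemma prob_fails (E : seq Q -> bool) l r b : prob (r * l + b) (fails E l r) = (1 - prob l E) ^+ r.
Proof.
elim: r b => [|r IH] b; first by rewrite expr0 /prob Ex_const.
rewrite mulSn -addnA exprS -(IH b) -prob_not -Ex_indep.
by apply: eq_Ex => s _ /=; rewrite -natrM mulnb.
Qed.

End Expectation.

Local Open Scope ring_scope.

(** * The pushed measure as an expected count *)

Section Push.
Variables (R : realType) (Q0 : finType) (m0 P : nat) (prog : seq (instr Q0)) (start2 : nat).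
Notation Q := (Q0 * option (cell Q0 m0 P))%type.
Notation G := (@global Q0 m0 P prog start2).
Variable p : Q -> R.
Hypothesis p_ge0 : forall q, 0 <= p q.
Hypothesis p_sum : \sum_q p q = 1.

Local Open Scope nat_scope.

Lemma global_window (x x' : nat -> Q) z z' t : 2 * t <= z -> 2 * t <= z' ->
  (forall k, k <= 4 * t -> x (z - 2 * t + k) = x' (z' - 2 * t + k)) ->
  iter t G x z = iter t G x' z'.
Proof.
elim: t z z' => [|t IH] z z' Hz Hz' H.
  by have := H 0 isT; rewrite !subn0 !addn0.
have H' i : i <= 4 -> iter t G x (z - 2 + i) = iter t G x' (z' - 2 + i).
  move=> Hi; apply: IH; [lia|lia|move=> k Hk].
  have := H (i + k) ltac:(lia).
  have -> : z - 2 * t.+1 + (i + k) = z - 2 + i - 2 * t + k by lia.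
  by have -> : z' - 2 * t.+1 + (i + k) = z' - 2 + i - 2 * t + k by lia.
have [y Ez] : exists y, z = y.+2 by exists (z - 2); lia.
have [y' Ez'] : exists y, z' = y.+2 by exists (z' - 2); lia.
move: (H' 0 isT) (H' 1 isT) (H' 2 isT) (H' 3 isT) (H' 4 isT).
have -> : z - 2 = y by lia.
have -> : z' - 2 = y' by lia.
by rewrite Ez Ez' !iterS /global /half_step !addnS !addn0 => -> -> -> -> ->.
Qed.

Variable d : Q.

Definition config (s : seq Q) t := iter t G (nth d s).
Definition spells (y : nat -> Q) (u : seq Q) := all (fun k => y k == nth d u k) (iota 0 (size u)).

Lemma spells_img t (u s : seq Q) : size s = size u + 4 * t ->
  (iter t (ca_img (automaton m0 P prog start2)) s == u) = spells (fun k => config s t (2 * t + k)) u.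
Proof.
move=> Hs; have [Hsz Hn] := iter_ca_img prog start2 d s t.
have E k : k < size u -> nth d (iter t (ca_img (automaton m0 P prog start2)) s) k = config s t (2 * t + k).
  by move=> Hk; rewrite Hn ?[2 * t + k]addnC //; lia.
apply/eqP/allP => [Eu k|H].
  rewrite mem_iota add0n => /andP[_ Hk]; rewrite -E //.
  by rewrite Eu.
apply: (@eq_from_nth _ d); first by rewrite Hsz; lia.
move=> k; rewrite Hsz => Hk; have Hk' : k < size u by lia.
by rewrite E //; apply/eqP/H; rewrite mem_iota.
Qed.

Local Open Scope ring_scope.

Lemma ca_push_Ex t (u : seq Q) : ca_push (automaton m0 P prog start2) p t u =
  prob p (size u + 4 * t) (fun s => spells (fun k => config s t (2 * t + k)%N) u).
Proof.
rewrite /ca_push /= /prob -[RHS](Ex_tuple p) big_mkcond; apply: eq_bigr => v _.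
rewrite spells_img ?size_tuple //.
by case: (spells _ _); rewrite ?mulr1 ?mulr0.
Qed.

Lemma ca_push_window t (u : seq Q) N i : (i <= N)%N ->
  ca_push (automaton m0 P prog start2) p t u =
  prob p (N + size u + 4 * t) (fun s => spells (fun k => config s t (2 * t + (i + k))%N) u).
Proof.
move=> Hi; rewrite ca_push_Ex.
have -> : (N + size u + 4 * t = i + ((size u + 4 * t) + (N - i)))%N by lia.
rewrite /prob -(Ex_take p_sum (size u + 4 * t) (N - i)) -(Ex_drop p_sum i).
apply: eq_Ex => s Hs; congr (nat_of_bool _)%:R.
apply: eq_in_all => k; rewrite mem_iota => /andP[_ Hk]; congr (_ == _).
apply: global_window => [||j Hj]; try lia.
rewrite nth_take ?nth_drop; last by lia.
congr nth; lia.
Qed.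

(** By translation invariance all positions of the window are equally likely to bear [u]; a single
    event describing the whole window then estimates the measure. *)
Lemma ca_push_wcount t (u : seq Q) N :
  N%:R * ca_push (automaton m0 P prog start2) p t u =
  Ex p (N + size u + 4 * t) (fun s => (wcount d (fun i => config s t (2 * t + i)%N) u N)%:R).
Proof.
have E s : (wcount d (fun i => config s t (2 * t + i)%N) u N)%:R =
   \sum_(i <- iota 0 N) (spells (fun k => config s t (2 * t + (i + k))%N) u)%:R :> R.
  by rewrite /wcount -sum1_count natr_sum [LHS]big_mkcond; apply: eq_bigr => i _; rewrite /spells; case: ifP.
under eq_Ex => s _ do rewrite E.
rewrite Ex_sum (eq_big_seq (fun=> ca_push (automaton m0 P prog start2) p t u)).
  by rewrite big_const_seq count_predT size_iota iter_addr_0 mulr_natl.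
by move=> i; rewrite mem_iota => Hi; rewrite (@ca_push_window t u N i) //; lia.
Qed.

End Push.

(** * The error bound *)

Local Open Scope nat_scope.

Section BadEvents.
Variables (Q0 : finType) (m0 P : nat) (prog : seq (instr Q0)) (start2 : nat).
Hypothesis m0_ge : 2 <= m0.
Hypothesis prog_ok : all (instr_ok m0 P) prog.
Hypothesis start2_ok : start2 <= P.
Hypothesis size_ok : size prog <= P.
Variables (w w' : nat -> seq Q0) (c e0 : nat) (i1 i2 : nat -> nat).
Hypothesis spec : program_spec w w' prog start2 c e0 i1 i2.
Notation kind := (option (cell Q0 m0 P)).
Notation Q := (Q0 * kind)%type.
Variable a0 : Q0.
Let d : Q := (a0, None).

Definition kd (s : seq Q) i := (nth d s i).2.

Lemma shift_kd (s : seq Q) q : shift q (kd s) = kd (drop q s).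
Proof. by apply: functional_extensionality => i; rewrite /shift /kd nth_drop. Qed.

Definition head_kind L i : kind :=
  if i == 0 then Some (fresh_base m0 P prog) else if i <= L then Some (fresh_zone Q0 m0 P) else None.
Definition head_ok L (s : seq Q) := all (fun i => (nth d s i).2 == head_kind L i) (iota 0 L.+2).
Definition zone_run (s : seq Q) a k := all (fun i => is_zone (nth d s (a + i)).2) (iota 0 k).
(** Only the run of zone cells after a possible rival at [y] is forbidden, whatever stands at [y].
    The condition concerns letters after the head and is therefore independent of it. *)
Definition tail_ok L S (s : seq Q) :=
  all (fun y => ~~ zone_run s (y - L.+2).+1 (tri_root y.-2).-1) (iota L.+2 (S - L)).
Definition pattern L S (s : seq Q) := head_ok L (take L.+2 s) && tail_ok L S (drop L.+2 s).

Lemma pattern_survivor L S (s : seq Q) : 0 < L -> L < S -> tri_root S <= L.+1 ->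
  (forall e, L <= e -> e_ok c e0 e) ->
  pattern L S (take (3 * S) s) -> forall n, n <= 2 ^ S.-1 -> alive prog start2 (kd s) n.
Proof.
move=> L0 LS HS ok_e /andP[/allP Hh /allP Ht] n Hn.
have hd i : i < L.+2 -> kd s i = head_kind L i.
  move=> Hi; have := Hh i; rewrite mem_iota => /(_ ltac:(lia)) /eqP <-.
  by rewrite nth_take // nth_take //; lia.
apply: (survivor m0_ge prog_ok start2_ok size_ok spec (L := L) (S := S)) => //.
- exact: hd.
- move=> i Hi; rewrite hd; last by lia.
  by rewrite /head_kind; case: i Hi => // i; rewrite ltn0Sn => /= ->.
- by rewrite hd // /head_kind /= ltnn.
- move=> y Hy _; have := Ht y; rewrite mem_iota => /(_ ltac:(lia)).
  rewrite /zone_run -has_predC => /hasP[i]; rewrite mem_iota => Hi /= Hz.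
  exists i.+1; first by lia.
  have Hy2 : tri_root y.-2 <= S by apply: leq_trans (tri_root_le _) _; lia.
  move: Hz; rewrite nth_drop nth_take; last by lia.
  by rewrite /kd; have -> : L.+2 + ((y - L.+2).+1 + i) = y + i.+1 by lia.
Qed.

Variables (s t N A Rn : nat).
Let L := tri_root (s + 2).
Let l1 := 3 * (s + 2).
Let M := Rn * l1.
Let o := 2 * t.

(** With [S = s + 2] a pattern ensures life up to [2 ^ s.+1], beyond [t]; [3 * S] letters decide it.
    Disjoint blocks make the failures independent. *)
Definition bad_trap (x : seq Q) := fails (pattern L (s + 2)) l1 Rn (drop (o - M) x).
Definition bad_near (x : seq Q) := has (fun q => heavy s (kd (drop q x))) (iota (o - (4 * s + 20)) (4 * s + 20 + N)).
Definition bad_gap (x : seq Q) := has (fun q => ~~ has_gap A (kd (drop q x))) (iota (o - (M + N)) (M + N + N)).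
Definition bad_clock (x : seq Q) := has (fun j => heavy s (kd (drop (o - j) x)) &&
  bad c s N (clk prog start2 A (kd (drop (o - j) x)) + (t - j))) (iota 1 M).
Definition bad_event x := [|| bad_trap x, bad_near x, bad_gap x | bad_clock x].

Hypotheses (s_ge : 6 <= s) (t_ge : 2 ^ s <= t) (t_lt : t < 2 ^ s.+1) (MN : M + N + 8 * s + 32 <= 2 ^ s.-1)
  (A_s : A.*2 <= s).
Hypothesis ok_e : forall e, L <= e -> e_ok c e0 e.
Hypotheses (L_gt0 : 0 < L) (L_s : L < s).

Let pow_s : 2 ^ s = 2 * 2 ^ s.-1.
Proof. by rewrite -expnS; congr (_ ^ _); lia. Qed.

Lemma failsP (E : seq Q -> bool) l r (x : seq Q) : ~~ fails E l r x ->
  exists2 k, k < r & E (take l (drop (k * l) x)).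
Proof.
elim: r x => [|r IH] x //=; rewrite negb_and negbK => /orP[H|/IH[k Hk H]].
  by exists 0; rewrite // mul0n drop0.
by exists k.+1; rewrite // mulSn addnC -drop_drop.
Qed.

Lemma not_bad_event x : ~~ bad_event x ->
  let C i := (nth d x i).2 in
  [/\ exists2 j, 0 < j <= M & forall n, n <= 2 ^ s.+1 -> is_base (kinds prog start2 C n.*2 (o - j)),
      forall q, o <= q + (4 * s + 20) -> q < o + N -> ~~ heavy s (shift q C),
      forall q, o <= q + (M + N) -> q < o + N -> has_gap A (shift q C) &
      forall j, 0 < j <= M -> heavy s (shift (o - j) C) ->
        ~~ bad c s N (clk prog start2 A (shift (o - j) C) + (t - j))].
Proof.
move=> H C; have E q : shift q C = kd (drop q x) by rewrite -shift_kd.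
move: H; rewrite /bad_event !negb_or => /and4P[/failsP[k Hk B1] /hasPn B2 /hasPn B3 /hasPn B4].
have Hkl : k.+1 * l1 <= M by rewrite /M leq_mul2r Hk orbT.
split.
- exists (M - k * l1); first by rewrite mulSn in Hkl; lia.
  move=> n Hn; rewrite -base_shift E.
  have -> : o - (M - k * l1) = k * l1 + (o - M) by rewrite mulSn in Hkl; lia.
  rewrite -drop_drop; apply: (pattern_survivor L_gt0 _ _ ok_e B1); [by lia|exact: leqW|by rewrite addn2].
- by move=> q Hq1 Hq2; rewrite E; apply: B2; rewrite mem_iota; lia.
- by move=> q Hq1 Hq2; rewrite E; have := B3 q; rewrite mem_iota negbK; apply; lia.
- move=> j Hj; rewrite E => Hh; have := B4 j; rewrite mem_iota Hh /=; apply; lia.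
Qed.

Lemma good_window x : ~~ bad_event x -> (forall e, s <= e -> forall md, 0 < size (word_of w w' i1 i2 md e)) ->
  exists md e j y, let V := clk prog start2 A (kd (drop (o - j) x)) + (t - j) in
  [/\ s <= e <= s + 2, 0 < j <= M, clk prog start2 A (kd (drop (o - j) x)) < 2 ^ A.*2,
      forall z, V <= z + N -> z <= V + N -> shows c md e z &
      forall i, i < N -> config prog start2 d x t (o + i) =
        (nth a0 (word_of w w' i1 i2 md e) ((y + i) %% size (word_of w w' i1 i2 md e)), None)].
Proof.
move=> /not_bad_event[h1 h2 h3 h4] Hw.
have Mo : M + N < o by move: MN t_ge pow_s s_ge; rewrite /o; clear; lia.
have ok' e : s.-1 <= e -> e_ok c e0 e by move=> He; apply: ok_e; lia.
have emp := window_empty m0_ge prog_ok start2_ok spec s_ge t_ge t_lt MN A_s Mo ok' h1 h2 h3.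
have [md [e [j [H1 H2 H3 H4 H5]]]] :=
  window_letters m0_ge prog_ok start2_ok spec s_ge t_ge t_lt MN A_s Mo ok' h1 h2 h3 h4.
have Es : shift (o - j) (fun i => (nth d x i).2) = kd (drop (o - j) x) by rewrite -shift_kd.
rewrite Es in H3 H4 H5; set V := _ + (t - j) in H4 H5.
have He : e0 <= e by have [] := ok_e (e := e) ltac:(lia).
have Hes : s <= e by case/andP: H1.
have Hsh i : i < N -> shows c md e (V - i) by move=> Hi; apply: H4; lia.
have [y Hy] := shown_word spec a0 He (Hw e Hes md) Hsh.
exists md, e, j, y; split=> // i Hi.
have HiV : i <= V by lia.
have Hl := H5 i _ Hi (Hy i Hi HiV).
have Hn : kinds prog start2 (fun i => (nth d x i).2) t.*2 (o + i) = None by apply: emp; lia.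
rewrite /config [iter _ _ _ _]surjective_pairing Hl; congr (_, _).
by rewrite global_kind.
Qed.

End BadEvents.

Local Open Scope ring_scope.

Lemma count_near B r v t M :
  (M <= t)%N -> (count (fun j => near B r (v + (t - j))) (iota 1 M) <= B.*2.+1)%N.
Proof.
move=> Mt; rewrite -size_filter -(size_iota (v + t - (r + B)) B.*2.+1); apply: uniq_leq_size.
  by apply: filter_uniq; apply: iota_uniq.
by move=> j; rewrite mem_filter !mem_iota /near; lia.
Qed.

(** Eight intervals: two resets in each of four epochs. *)
Lemma count_bad c s N v t M :
  (M <= t)%N -> (count (fun j => bad c s N (v + (t - j))) (iota 1 M) <= 8 * (margin c s N).*2.+1)%N.
Proof.
move=> Mt; set B := margin c s N.
have le_add (f g : nat -> bool) r : (count (fun j => f j || g j) r <= count f r + count g r)%N.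
  by rewrite -count_predUI leq_addr.
rewrite /bad.
have -> : iota s 4 = [:: s; s.+1; s.+2; s.+3] by [].
rewrite /= -/B.
have two e : (count (fun j => near B (reset_1 e) (v + (t - j)) || near B (reset_2 e) (v + (t - j))) (iota 1 M)
     <= 2 * B.*2.+1)%N.
  by apply: leq_trans (le_add _ _ _) _; rewrite mul2n -addnn; apply: leq_add; apply: count_near.
apply: leq_trans (le_add _ _ _) _.
have H1 := two s; have H2 := two s.+1; have H3 := two s.+2; have H4 := two s.+3.
have L3 : (count (fun j => (near B (reset_1 s.+1) (v + (t - j)) || near B (reset_2 s.+1) (v + (t - j))) ||
   ((near B (reset_1 s.+2) (v + (t - j)) || near B (reset_2 s.+2) (v + (t - j))) ||
   ((near B (reset_1 s.+3) (v + (t - j)) || near B (reset_2 s.+3) (v + (t - j))) || false))) (iota 1 M)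
   <= 6 * B.*2.+1)%N.
  apply: leq_trans (le_add _ _ _) _.
  have : (count (fun j => 
   ((near B (reset_1 s.+2) (v + (t - j)) || near B (reset_2 s.+2) (v + (t - j))) ||
   ((near B (reset_1 s.+3) (v + (t - j)) || near B (reset_2 s.+3) (v + (t - j))) || false))) (iota 1 M)
   <= 4 * B.*2.+1)%N.
    apply: leq_trans (le_add _ _ _) _.
    have : (count (fun j => (near B (reset_1 s.+3) (v + (t - j)) || near B (reset_2 s.+3) (v + (t - j))) || false) (iota 1 M)
       <= 2 * B.*2.+1)%N.
      by under eq_count => j do rewrite orbF.
    lia.
  lia.
lia.
Qed.

(** * Probabilities of the bad events *)

Section Bounds.
Variables (R : realType) (Q0 : finType) (m0 P : nat) (prog : seq (instr Q0)) (start2 : nat).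
Variables (c : nat).
Notation kind := (option (cell Q0 m0 P)).
Notation Q := (Q0 * kind)%type.
Variable p : Q -> R.
Hypothesis p_ge0 : forall q, 0 <= p q.
Hypothesis p_sum : \sum_q p q = 1.
Variable a0 : Q0.
Let d : Q := (a0, None).
Notation kd := (kd (m0 := m0) (P := P) a0).

Definition theta := \sum_(q | is_zone q.2) p q.

Lemma zone_run_le n a k : prob p n (fun x => zone_run (m0 := m0) (P := P) a0 x a k) <= theta ^+ k.
Proof. exact: (prob_run p_ge0 p_sum n a k (F := fun q => is_zone q.2) (d := d)). Qed.

Lemma heavy_le n s : prob p n (fun x => heavy s (kd x)) <= theta ^+ (tri_root s.-1).-1.
Proof.
apply: le_trans (zone_run_le n 1 _); apply: prob_le => // x _ /andP[_ /allP H].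
apply/allP => i; rewrite mem_iota => Hi; apply: H; rewrite mem_iota; lia.
Qed.

Lemma gap_le n A : prob p n (fun x => ~~ has_gap A (kd x)) <= theta ^+ A.
Proof.
apply: le_trans (zone_run_le n 1 _); apply: prob_le => // x _ /hasPn H.
by apply/allP => i Hi; have := H i Hi; rewrite negbK.
Qed.

Lemma prob_dropped (E : seq Q -> bool) n q : (q <= n)%N -> prob p n (fun x => E (drop q x)) = prob p (n - q) E.
Proof. by move=> H; rewrite -{1}(subnKC H); apply: (Ex_drop p_sum). Qed.

Lemma heavy_local s (C C' : nat -> kind) : (forall i, (i <= s)%N -> C i = C' i) -> heavy s C = heavy s C'.
Proof.
move=> H; rewrite /heavy H //; congr (_ && _); apply: eq_in_all => i; rewrite mem_iota => Hi.
by rewrite H //; have := tri_root_le s.-1; lia.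
Qed.

Lemma clk_local A (C C' : nat -> kind) : (forall i, (i <= 4 * A.+1)%N -> C i = C' i) ->
  clk prog start2 A C = clk prog start2 A C'.
Proof.
move=> H; have Ef : first_gap A C = first_gap A C'.
  by congr _.+1; apply: eq_in_find => i; rewrite mem_iota => Hi; rewrite H //; lia.
rewrite /clk Ef; apply: clock_local => i Hi; apply: H.
have : (find (fun i => ~~ is_zone (C' i.+1)) (iota 0 A) <= A)%N by rewrite -{2}(size_iota 0 A) find_size.
by move: Hi; rewrite /first_gap; lia.
Qed.

Section Pattern.
Variable s : nat.
Let L := tri_root (s + 2).
Let l1 := (3 * (s + 2))%N.

(** The head costs a factor [delta] for each of its [L + 2] letters. The tail costs only 1/2: each
    forbidden run has at least [(tri_root L).-1] cells, so a union bound over the rivals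
    suffices. *)
Lemma pattern_prob delta : (2 <= L)%N -> (L < s + 2)%N ->
  0 <= delta -> (forall i, (i <= L.+1)%N -> delta <= \sum_(q | q.2 == head_kind m0 P prog L i) p q) ->
  (s + 2)%:R * theta ^+ (tri_root L).-1 <= 1 / 2 -> theta <= 1 ->
  delta ^+ L.+2 / 2 <= prob p l1 (pattern prog a0 L (s + 2)).
Proof.
move=> L2 Ls d0 Hd Ht th1.
have th0 : 0 <= theta by apply: sumr_ge0.
have -> : l1 = (L.+2 + (l1 - L.+2))%N by rewrite /l1; lia.
have -> : prob p (L.+2 + (l1 - L.+2)) (pattern prog a0 L (s + 2)) =
    prob p L.+2 (head_ok prog a0 L) * prob p (l1 - L.+2) (tail_ok a0 L (s + 2)).
  rewrite -(Ex_indep p); apply: eq_Ex => x _.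
  by rewrite /pattern -natrM mulnb.
apply: ler_pM; rewrite ?exprn_ge0 ?invr_ge0 ?ler0n //.
  have := prob_exact p_sum (fun i q => q.2 == head_kind m0 P prog L i) d L.+2 0.
  rewrite addn0 => ->; rewrite -[L.+2 in leLHS]card_ord -prodr_const.
  by apply: ler_prod => i _; rewrite d0 Hd // -ltnS.
have : prob p (l1 - L.+2) (fun x => ~~ tail_ok a0 L (s + 2) x) <= 1 / 2.
  apply: le_trans Ht; apply: le_trans (prob_union p_ge0 (r := iota L.+2 (s + 2 - L))
    (E := fun y x => zone_run (m0 := m0) (P := P) a0 x (y - L.+2).+1 (tri_root y.-2).-1) _) _.
    by move=> x _; rewrite -has_predC; apply: sub_has => y /=; rewrite negbK.
  apply: le_trans (_ : \sum_(y <- iota L.+2 (s + 2 - L)) theta ^+ (tri_root L).-1 <= _).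
    apply: ler_sum_mem => y; rewrite mem_iota => Hy; apply: le_trans (zone_run_le _ _ _) _.
    by apply: ler_wiXn2l => //; have := @tri_root_mono L y.-2; lia.
  rewrite big_const_seq count_predT size_iota iter_addr_0 -[leLHS]mulr_natl.
  by apply: ler_wpM2r; rewrite ?exprn_ge0 // ler_nat leq_subr.
rewrite (prob_not p_sum); lra.
Qed.

End Pattern.

Variables (s t N A Rn : nat).
Let L := tri_root (s + 2).
Let l1 := (3 * (s + 2))%N.
Let M := (Rn * l1)%N.
Let o := (2 * t)%N.
Hypotheses (MN : (M + N + 4 * A + 5 * s + 32 <= t)%N).
Let n := (N + 4 * t)%N.
Let kappa := (tri_root s.-1).-1.

Lemma bad_trap_prob : prob p n (bad_trap prog a0 s t Rn) =
  (1 - prob p l1 (pattern prog a0 L (s + 2))) ^+ Rn.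
Proof.
rewrite (prob_dropped (fails _ l1 Rn)); last by rewrite /n; lia.
have -> : (n - (2 * t - Rn * (3 * (s + 2))) = Rn * l1 + (N + 2 * t))%N by rewrite /n /l1; move: MN; rewrite /M /l1; lia.
exact: prob_fails.
Qed.

Lemma bad_near_prob : prob p n (bad_near a0 s t N) <= (4 * s + 20 + N)%:R * theta ^+ kappa.
Proof.
apply: le_trans (prob_union p_ge0 (r := iota (o - (4 * s + 20)) (4 * s + 20 + N))
  (E := fun q x => heavy s (kd (drop q x))) _) _ => //.
rewrite mulr_natl -[X in _ *+ X](size_iota (o - (4 * s + 20))) -iter_addr_0 -count_predT -big_const_seq.
apply: ler_sum_mem => q; rewrite mem_iota => Hq.
rewrite (prob_dropped (fun x => heavy s (kd x))); last by move: MN Hq; rewrite /n /o; lia.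
exact: heavy_le.
Qed.

Lemma bad_gap_prob : prob p n (bad_gap a0 s t N A Rn) <= (M + N + N)%:R * theta ^+ A.
Proof.
apply: le_trans (prob_union p_ge0 (r := iota (o - (M + N)) (M + N + N))
  (E := fun q x => ~~ has_gap A (kd (drop q x))) _) _ => //.
rewrite mulr_natl -[X in _ *+ X](size_iota (o - (M + N))) -iter_addr_0 -count_predT -big_const_seq.
apply: ler_sum_mem => q; rewrite mem_iota => Hq.
rewrite (prob_dropped (fun x => ~~ has_gap A (kd x))); last by move: MN Hq; rewrite /n /o; lia.
exact: gap_le.
Qed.

(* Translation invariance: the clock of a fixed heavy base is bad for few translates only. *)
Lemma bad_clock_prob : prob p n (bad_clock prog start2 c a0 s t N A Rn) <=
  (8 * (margin c s N).*2.+1)%:R * theta ^+ kappa.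
Proof.
apply: le_trans (prob_union p_ge0 (r := iota 1 M)
  (E := fun j x => heavy s (kd (drop (o - j) x)) &&
     bad c s N (clk prog start2 A (kd (drop (o - j) x)) + (t - j))) _) _ => //.
(* [l] letters decide both heaviness and clock, so that the events of all [j] can be evaluated on
   one and the same word and summed there. *)
pose l := (4 * A + s + 10)%N.
pose f j x := heavy s (kd x) && bad c s N (clk prog start2 A (kd x) + (t - j)).
have Ef j x : f j (take l x) = f j x.
  have E i : (i < l)%N -> kd (take l x) i = kd x i by move=> Hi; rewrite /kd nth_take.
  rewrite /f (@heavy_local s _ (kd x)); last by move=> i Hi; apply: E; rewrite /l; lia.
  by rewrite (@clk_local A _ (kd x)) // => i Hi; apply: E; rewrite /l; lia.
rewrite (eq_big_seq (fun j => prob p l (f j))); last first.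
  move=> j; rewrite mem_iota => Hj.
  rewrite (prob_dropped (f j)); last by move: MN; rewrite /n /o; lia.
  have -> : (n - (o - j) = l + (n - (o - j) - l))%N by move: MN; rewrite /n /o /l; lia.
  rewrite /prob -(Ex_take p_sum l (n - (o - j) - l)); apply: eq_Ex => x _.
  by rewrite Ef.
rewrite -Ex_sum; apply: le_trans (_ : Ex p l (fun x => (8 * (margin c s N).*2.+1)%:R * (heavy s (kd x))%:R) <= _).
  apply: Ex_le => // x _; rewrite /f; case: (heavy s _) => /=; last by rewrite big1 // mulr0.
  rewrite mulr1 -natr_sum ler_nat -big_mkcond sum1_count.
  by apply: count_bad; move: MN; lia.
by rewrite ExZ; apply: ler_wpM2l; [exact: ler0n|exact: heavy_le].
Qed.

Definition error := (1 - prob p l1 (pattern prog a0 L (s + 2))) ^+ Rn +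
  (4 * s + 20 + N + 8 * (margin c s N).*2.+1)%:R * theta ^+ kappa + (M + N + N)%:R * theta ^+ A.

Lemma bad_event_prob : prob p n (bad_event prog start2 c a0 s t N A Rn) <= error.
Proof.
have H := prob_union p_ge0 (r := iota 0 4) (E := fun i => nth (fun=> false)
  [:: bad_trap prog a0 s t Rn; bad_near a0 s t N; bad_gap a0 s t N A Rn; bad_clock prog start2 c a0 s t N A Rn] i)
  (n := n) (F := bad_event prog start2 c a0 s t N A Rn).
apply: le_trans (H _) _; first by move=> x _ /=; rewrite /bad_event orbF.
rewrite /= !big_cons big_nil /= bad_trap_prob.
have := bad_near_prob; have := bad_gap_prob; have := bad_clock_prob.
rewrite /error natrD mulrDl; lra.
Qed.

End Bounds.

Local Open Scope nat_scope.

(** * Inequalities that hold eventually *)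

Definition ev (P : nat -> Prop) := exists n0, forall n, n0 <= n -> P n.

Lemma ev_and P Q : ev P -> ev Q -> ev (fun n => P n /\ Q n).
Proof.
move=> [a Ha] [b Hb]; exists (maxn a b) => n; rewrite geq_max => /andP[H1 H2].
by split; [apply: Ha|apply: Hb].
Qed.

Lemma ev_imp (P Q : nat -> Prop) : ev P -> (forall n, P n -> Q n) -> ev Q.
Proof. by move=> [a Ha] H; exists a => n /Ha /H. Qed.

Lemma ev_ge a : ev (fun n => a <= n). Proof. by exists a. Qed.

Lemma ev_comp (P : nat -> Prop) (f : nat -> nat) : ev P -> (forall a, ev (fun n => a <= f n)) ->
  ev (fun n => P (f n)).
Proof. by move=> [a Ha] Hf; apply: (ev_imp (Hf a)) => n /Ha. Qed.

(** With [j] about [n / (k * (m + 2))] one has [n <= K * 2 ^ j]; the power costs [m * j] binary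
    digits and the constant [a * K ^ m] at most [j] more. *)
Lemma poly_exp a m k : 0 < k -> ev (fun n => a * n ^ m <= 2 ^ (n %/ k)).
Proof.
move=> k0; set K := k * m.+2; exists (k * (m.+2 * (a * K ^ m).+1)) => n Hn.
set q := n %/ k; set j := q %/ m.+2.
have Hq : n < k * q.+1 by rewrite mulnC; apply: ltn_ceil.
have Hj : q < m.+2 * j.+1 by rewrite mulnC; apply: ltn_ceil.
have Hjq : j * m.+2 <= q by apply: leq_trunc_div.
have Haj : a * K ^ m <= j.
  rewrite /j /q leq_divRL // leq_divRL //; apply: leq_trans Hn.
  move: (a * _) => y; rewrite mulnC leq_mul2l [y * _]mulnC leq_mul2l leqnSn !orbT //.
have H2j : j < 2 ^ j by apply: ltn_expl.
have HnK : n <= K * 2 ^ j.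
  apply: leq_trans (ltnW Hq) _; rewrite /K -mulnA leq_mul2l; apply/orP; right.
  by apply: leq_trans Hj _; rewrite leq_mul2l; apply/orP; right.
apply: leq_trans (_ : 2 ^ (j * m.+2) <= _); last by rewrite leq_exp2l.
apply: leq_trans (_ : a * (K * 2 ^ j) ^ m <= _).
  by apply: leq_mul => //; case: (m) => // m'; rewrite leq_exp2r.
rewrite expnMn mulnA expnM !expnS.
apply: leq_trans (_ : 2 ^ j * (2 ^ j) ^ m <= _).
  by rewrite leq_mul2r; apply/orP; right; apply: leq_trans Haj (ltnW H2j).
by rewrite leq_mul2l leq_pmull ?expn_gt0 ?orbT.
Qed.

Lemma tri_root_large a e : a ^ 2 <= e -> a <= tri_root e.
Proof.
move=> H; case: (posnP a) => [->//|a0].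
have e0 : 0 < e by apply: leq_trans H; rewrite expn_gt0 a0.
have /andP[_ Hk] := tri_rootP e0; rewrite leqNgt; apply/negP => Hlt.
have : tri_root e * (tri_root e).+1 <= a.-1 * a by apply: leq_mul; lia.
have : a.-1 * a <= a * a by rewrite leq_mul2r leq_pred orbT.
have : 0 < a * a by rewrite muln_gt0 a0.
by move: H; rewrite expnS expn1; lia.
Qed.

Lemma ev_tri_root a : ev (fun n => a <= tri_root n).
Proof. by exists (a ^ 2) => n; apply: tri_root_large. Qed.

Lemma tri_root_small a : ev (fun s => a * tri_root (s + 2) <= s).
Proof.
exists (a * (2 * a + 10)) => s Hs; set L := tri_root _.
case: (leqP L (2 * a + 10)) => HL; first by apply: leq_trans Hs; rewrite leq_mul2l HL orbT.
have /andP[H _] := @tri_rootP (s + 2) ltac:(lia); rewrite -/L in H.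
have : L * (2 * a + 9) <= L * L.-1 by apply: leq_mul; lia.
nia.
Qed.

Lemma tri_root_sqr e : e <= tri_root e ^ 2.
Proof.
case: (posnP e) => [->//|e0]; have /andP[_ H] := tri_rootP e0.
move: H; rewrite expnS expn1; case: (tri_root e) => [|k]; first by lia.
nia.
Qed.

Local Open Scope ring_scope.

Section Powers.
Variable R : realType.

Lemma bernoulli (x : R) n : 0 <= x <= 1 -> (1 - x) ^+ n * (1 + n%:R * x) <= 1.
Proof.
move=> /andP[x0 x1]; elim: n => [|n IH]; first by rewrite expr0 mul0r addr0 mulr1.
apply: le_trans IH; rewrite exprS -mulrA mulrCA; apply: ler_wpM2l; first by rewrite exprn_ge0 // subr_ge0.
rewrite -natr1 -subr_ge0.
have -> : 1 + n%:R * x - (1 - x) * (1 + (n%:R + 1) * x) = (n%:R + 1) * x ^+ 2 by ring.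
by rewrite mulr_ge0 ?sqr_ge0 // addr_ge0.
Qed.

Lemma half_power (th : R) : 0 <= th < 1 -> exists2 k, (0 < k)%N & th ^+ k <= 1 / 2.
Proof.
move=> /andP[t0 t1]; set x := 1 - th; have x0 : 0 < x by rewrite subr_gt0.
pose k := (Num.bound x^-1).+1; exists k => //.
have Hk : 1 <= k%:R * x.
  rewrite -ler_pdivrMr // div1r; apply: ltW; apply: lt_le_trans (archi_boundP _) _.
    by rewrite invr_ge0 ltW.
  by rewrite ler_nat.
have := @bernoulli x k; have -> : 1 - x = th by rewrite /x; ring.
have pk : 0 <= th ^+ k by rewrite exprn_ge0.
move=> /(_ _) H; have := H ltac:(by rewrite ltW //= /x gerBl).
move: pk Hk; set y := th ^+ k; set z := k%:R * x => pk Hk Hb.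
have : y * 2 <= y * (1 + z) by apply: ler_wpM2l => //; lra.
lra.
Qed.

Lemma pow_bound (th : R) k n a b : 0 <= th -> th <= 1 -> th ^+ k <= 1 / 2 -> (0 < a)%N ->
  (a * b <= 2 ^ (n %/ k))%N -> b%:R * th ^+ n <= 1 / a%:R.
Proof.
move=> t0 t1 Hk a0 Hab; rewrite ler_pdivlMr ?ltr0n //.
have tk0 : 0 <= th ^+ k by rewrite exprn_ge0.
have H : th ^+ n <= (1 / 2) ^+ (n %/ k).
  rewrite {1}(divn_eq n k) exprD mulnC exprM -[leRHS]mulr1.
  apply: ler_pM; rewrite ?exprn_ge0 ?exprn_ile1 //.
  by apply: lerXn2r; rewrite ?nnegrE // divr_ge0.
rewrite mulrAC -natrM mulnC.
apply: le_trans (_ : (2 ^ (n %/ k))%:R * (1 / 2) ^+ (n %/ k) <= _).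
  by apply: ler_pM; rewrite ?ler0n ?exprn_ge0 // ler_nat.
by rewrite natrX -exprMn mulrCA mul1r divff ?expr1n // pnatr_eq0.
Qed.

End Powers.

Local Open Scope nat_scope.

Lemma quarter k s : 0 < k -> 2 * (s %/ (4 * k)) <= s %/ k.
Proof.
move=> k0; rewrite leq_divRL //; apply: leq_trans (leq_trunc_div s (4 * k)).
move: (s %/ _) => x; rewrite -mulnA mulnCA; move: (x * k); lia.
Qed.

(** The exponent of [D] is of order sqrt(s), negligible against [s / k]: the search range is smaller
    than any exponential in [s]. *)
Lemma ev_growth a D k : 0 < k -> 0 < D ->
  ev (fun s => a * s ^ 3 * D ^ (tri_root (s + 2)).+2 <= 2 ^ (s %/ k)).
Proof.
move=> k0 D0; have k4 : 0 < 4 * k by rewrite muln_gt0.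
have H := ev_and (poly_exp a 3 k4) (ev_and (tri_root_small (3 * (4 * k) * D)) (ev_ge 1)).
apply: (ev_imp H) => s [H1 [H2 H3]].
apply: leq_trans (_ : 2 ^ (2 * (s %/ (4 * k))) <= _); last by rewrite leq_exp2l // quarter.
rewrite mul2n -addnn expnD; apply: leq_mul => //.
apply: leq_trans (_ : 2 ^ (D * (tri_root (s + 2)).+2) <= _).
  by rewrite expnM leq_exp2r // ltnW // ltn_expl.
rewrite leq_exp2l // leq_divRL //; apply: leq_trans H2.
have L1 : 1 <= tri_root (s + 2) by apply: tri_root_large; lia.
have HL : (tri_root (s + 2)).+2 <= 3 * tri_root (s + 2) by lia.
apply: leq_trans (leq_mul (leq_mul (leqnn D) HL) (leqnn (4 * k))) _.
by move: (tri_root _) => x; lia.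
Qed.

(** When [D * delta >= 1], a block succeeds with probability at least [delta ^ (L + 2) / 2], so that
    at least [s] successes are expected. *)
Definition blocks D s := 2 * s * D ^ (tri_root (s + 2)).+2.

Lemma blocks_le D s : 0 < s -> blocks D s * (3 * (s + 2)) <= 18 * (s * s) * D ^ (tri_root (s + 2)).+2.
Proof.
move=> s0; rewrite /blocks mulnAC leq_mul2r; apply/orP; right.
have : s * (s + 2) <= s * (3 * s) by rewrite leq_mul2l; lia.
have -> : 2 * s * (3 * (s + 2)) = 6 * (s * (s + 2)) by lia.
have -> : s * (3 * s) = 3 * (s * s) by lia.
by move: (s * (s + 2)) (s * s); lia.
Qed.

Lemma margin_le c U s : 0 < s -> margin c s (s * s + U) <= (25 * c + 6 + U) * (s * s).
Proof.
move=> s0; rewrite /margin /run_time.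
have H1 : (s + 3).+1 * (s + 3).+1 <= 25 * (s * s).
  apply: leq_trans (_ : (5 * s) * (5 * s) <= _); first by apply: leq_mul; lia.
  lia.
have H2 : c * ((s + 3).+1 * (s + 3).+1) <= c * (25 * (s * s)) by rewrite leq_mul2l H1 orbT.
have H3 : s <= s * s by rewrite leq_pmull.
have H4 : U <= U * (s * s) by rewrite leq_pmulr // muln_gt0 s0.
have -> : (25 * c + 6 + U) * (s * s) = c * (25 * (s * s)) + 6 * (s * s) + U * (s * s) by lia.
by move: H2 H3 H4; move: (c * (25 * _)) (c * _) (U * _); lia.
Qed.

(** * Admissible parameters *)

Section ErrorBound.
Variables (c e0 U : nat).

Lemma ev_e_ok : ev (e_ok c e0).
Proof.
have H1 := poly_exp (4 * c + 20) 2 (isT : 0 < 2).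
have H2 := tri_root_small 2.
apply: (ev_imp (ev_and H1 (ev_and H2 (ev_and (ev_ge e0) (ev_ge 5))))) => e [h1 [h2 [h3 h4]]].
split=> //.
  apply: leq_trans (_ : 2 ^ (e %/ 2) <= _).
    apply: leq_trans h1; rewrite /run_time.
    have : e.+1 * e.+1 <= (2 * e) * (2 * e) by apply: leq_mul; lia.
    rewrite !expnS expn0 muln1; have : e * 5 <= e * e by rewrite leq_mul2l h4 orbT.
    have -> : (2 * e) * (2 * e) = 4 * (e * e) by lia.
    move: (e.+1 * e.+1) (e * e) => x y Hy Hx.
    have : c * x <= c * (4 * y) by rewrite leq_mul2l Hx orbT.
    have -> : (4 * c + 20) * y = c * (4 * y) + 20 * y by lia.
    by move: (c * x) (c * (4 * y)); lia.
  by rewrite leq_exp2l // /half_up; lia.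
apply: leq_trans h2; rewrite leq_mul2l; apply/orP; right.
by apply: tri_root_mono; lia.
Qed.

(** The last inequality keeps the clock reading of the displaying agent, which differs from [t] by
    at most the search range and the initial clock, within [2 ^ (s %/ 4)] of [t]. *)
Definition side D s := let L := tri_root (s + 2) in let N := s * s + U in
  [/\ 6 <= s, forall e, L <= e -> e_ok c e0 e, 2 <= L < s &
      16 * (blocks D s * (3 * (s + 2)) + N + 2 ^ (s %/ 32).*2 + margin c s N + 8 * s + 32) <= 2 ^ (s %/ 4)].

Lemma ev_side D : 0 < D -> ev (side D).
Proof.
move=> D0; have [E1 HE1] := ev_e_ok.
have big := ev_growth (2 * (16 * (18 + (1 + U) + (25 * c + 6 + U) + 8 + 32))) (isT : 0 < 4) D0.
have big2 := poly_exp 32 1 (isT : 0 < 8).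
have HLs := tri_root_small 2.
apply: (ev_imp (ev_and big (ev_and big2 (ev_and (ev_tri_root (maxn 2 E1)) (ev_and HLs (ev_ge 40)))))).
move=> s [b1 [b2 [b3 [b4 b5]]]].
have b3' : maxn 2 E1 <= tri_root (s + 2) by apply: leq_trans b3 _; apply: tri_root_mono; lia.
rewrite geq_max in b3'; case/andP: b3' => L2 LE.
have s0 : 0 < s by lia.
split; [lia|by move=> e He; apply: HE1; apply: leq_trans LE He|by rewrite L2; lia|].
have := blocks_le D s0; have := margin_le c U s0.
have : 16 * 2 ^ (s %/ 32).*2 * 2 <= 2 ^ (s %/ 4).
  apply: leq_trans (_ : 2 ^ (5 + (s %/ 32).*2) <= _); first by rewrite expnD; lia.
  by rewrite leq_exp2l //; lia.
set D' := D ^ _ in b1 *; have D'0 : 0 < D' by rewrite expn_gt0 D0.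
have s3 : s ^ 3 = s * (s * s) by rewrite !expnS expn0 muln1.
rewrite s3 in b1.
have HD : s * s <= s * s * D' by rewrite leq_pmulr.
have Hs3 : s * s * D' <= s * (s * s) * D' by rewrite leq_mul2r leq_pmull ?orbT.
have H1 : s <= s * s by rewrite leq_pmull.
have H4 : U <= U * (s * s) by rewrite leq_pmulr // muln_gt0 s0.
set y := s * s in b1 HD Hs3 H1 H4 *; set z := s * y * D' in Hs3.
have b1' : 2 * (16 * (18 + (1 + U) + (25 * c + 6 + U) + 8 + 32)) * z <= 2 ^ (s %/ 4) by rewrite /z [_ * (s * y * D')]mulnA.
have Hyz : y <= z by lia.
have K1 : (25 * c + 6 + U) * y <= (25 * c + 6 + U) * z by rewrite leq_mul2l Hyz orbT.
have K2 : U * y <= U * z by rewrite leq_mul2l Hyz orbT.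
have K3 : 18 * y * D' <= 18 * z by rewrite -mulnA leq_mul2l Hs3 orbT.
move: b1' K1; set X := 25 * c + 6 + U => b1' K1.
have E : 2 * (16 * (18 + (1 + U) + X + 8 + 32)) * z = 32 * (59 * z + U * z + X * z) by clear; lia.
rewrite E in b1'; move: b1' K1 K2 K3 H1 H4 Hyz s0; clear.
move: (2 ^ (s %/ 4)) (2 ^ (s %/ 32).*2) (blocks _ _ * _) (margin _ _ _) (18 * y * D') => p1 p2 p3 p4 p5.
move: (X * y) (X * z) (U * y) (U * z) => q1 q2 q3 q4.
lia.
Qed.

End ErrorBound.

Local Open Scope ring_scope.

Section Growth.
Variables (c U : nat).
Local Open Scope nat_scope.

(** For the tail of the pattern: an iterated root is still of the order of the fourth root of [s],
    enough for a power of [theta] to beat the number of rivals. *)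
Lemma ev_double_root k : 0 < k ->
  ev (fun s => 2 * (s + 2) <= 2 ^ ((tri_root (tri_root (s + 2))).-1 %/ k)).
Proof.
move=> k0; pose f s := (tri_root (tri_root (s + 2))).-1.
have Hf a : ev (fun s => a <= f s).
  exists ((a.+1 ^ 2) ^ 2) => s Hs; have : a.+1 <= tri_root (tri_root (s + 2)).
    apply: tri_root_large; apply: tri_root_large; lia.
  by rewrite /f; lia.
have H := ev_and (ev_comp (poly_exp 32 4 k0) Hf) (Hf 1).
apply: (ev_imp H) => s [H1 H2]; apply: leq_trans H1.
have Hl : tri_root (tri_root (s + 2)) <= 2 * f s by rewrite /f in H2 *; lia.
have A1 := tri_root_sqr (s + 2); have A2 := tri_root_sqr (tri_root (s + 2)).
have A3 : tri_root (s + 2) ^ 2 <= ((2 * f s) ^ 2) ^ 2.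
  by rewrite leq_exp2r //; apply: leq_trans A2 _; rewrite leq_exp2r.
have E : ((2 * f s) ^ 2) ^ 2 = 16 * f s ^ 4 by rewrite -expnM expnMn.
by move: A1 A3; rewrite E; move: (f s ^ 4) (tri_root (s + 2) ^ 2); lia.
Qed.

Lemma ev_root a k : 0 < k -> ev (fun s => a * s ^ 3 <= 2 ^ ((tri_root s.-1).-1 %/ k)).
Proof.
move=> k0; pose f s := (tri_root s.-1).-1.
have Hf b : ev (fun s => b <= f s).
  exists (b.+1 ^ 2).+1 => s Hs; have : b.+1 <= tri_root s.-1 by apply: tri_root_large; lia.
  by rewrite /f; lia.
have H := ev_and (ev_comp (poly_exp (a * 512) 6 k0) Hf) (ev_and (Hf 1) (ev_ge 2)).
apply: (ev_imp H) => s [H1 [H2 H3]]; apply: leq_trans H1.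
have Hl : tri_root s.-1 <= 2 * f s by rewrite /f in H2 *; lia.
have A1 : s.-1 <= (2 * f s) ^ 2 by apply: leq_trans (tri_root_sqr _) _; rewrite leq_exp2r.
have A2 : s <= 8 * f s ^ 2 by move: A1; rewrite expnMn; lia.
rewrite -mulnA leq_mul2l; apply/orP; right.
have -> : 512 * f s ^ 6 = (8 * f s ^ 2) ^ 3 by rewrite expnMn -expnM.
by rewrite leq_exp2r.
Qed.

Lemma near_count s : 0 < s ->
  s * (4 * s + 20 + (s * s + U) + 8 * (margin c s (s * s + U)).*2.+1) <=
  (4 + 20 + 1 + U + 16 * (25 * c + 6 + U) + 8) * s ^ 3.
Proof.
move=> s0; have Hm := margin_le c U s0; set X := 25 * c + 6 + U in Hm *.
rewrite expnS mulnCA leq_mul2l !expnS expn0 muln1; apply/orP; right.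
have H1 : s <= s * s by rewrite leq_pmull.
have H4 : U <= U * (s * s) by rewrite leq_pmulr // muln_gt0 s0.
have -> : (4 + 20 + 1 + U + 16 * X + 8) * (s * s) = 33 * (s * s) + U * (s * s) + 16 * (X * (s * s)) by clear; lia.
move: Hm H1 H4 s0; clear.
move: (margin _ _ _) => b; move: (X * (s * s)) => b1; move: (U * (s * s)) => b2; move: (s * s) => b3; lia.
Qed.

Lemma gap_count D s : 0 < s -> 0 < D ->
  s * (blocks D s * (3 * (s + 2)) + (s * s + U) + (s * s + U)) <=
  (20 + 2 * U) * s ^ 3 * D ^ (tri_root (s + 2)).+2.
Proof.
move=> s0 D0; have Hb := blocks_le D s0; set D' := D ^ _ in Hb *.
have D'0 : 0 < D' by rewrite expn_gt0 D0.
have -> : (20 + 2 * U) * s ^ 3 * D' = s * ((20 + 2 * U) * (s * s) * D') by rewrite !expnS expn0; lia.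
rewrite leq_mul2l; apply/orP; right.
have H1 : s * s <= s * s * D' by rewrite leq_pmulr.
have sD : 0 < s * s * D' by rewrite muln_gt0 D'0 muln_gt0 s0.
have H4 : U <= U * (s * s * D') by rewrite leq_pmulr.
have -> : (20 + 2 * U) * (s * s) * D' = 18 * (s * s) * D' + 2 * (s * s * D') + 2 * (U * (s * s * D')) by clear; lia.
move: Hb H1 H4; clear.
move: (blocks _ _ * _) => b; move: (18 * (s * s) * D') => b1; move: (U * (s * s * D')) => b2; move: (s * s * D') => b3; move: (s * s) => b4; lia.
Qed.

End Growth.

Section ErrorSmall.
Variables (R : realType) (Q0 : finType) (m0 P : nat) (prog : seq (instr Q0)) (start2 : nat).
Variables (c e0 : nat).
Notation Q := (Q0 * option (cell Q0 m0 P))%type.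
Variable p : Q -> R.
Hypothesis p_full : full_bernoulli p.
Variables (a0 : Q0) (U : nat).

Let p_gt0 q : 0 < p q. Proof. by have [H _] := p_full. Qed.
Let p_ge0 q : 0 <= p q. Proof. exact: ltW. Qed.
Let p_sum : \sum_q p q = 1. Proof. by have [_ ->] := p_full. Qed.

Lemma p_le1 q : p q <= 1.
Proof. by rewrite -p_sum (bigD1 q) //= lerDl; apply: sumr_ge0. Qed.

Lemma theta_bounds : 0 <= theta p < 1.
Proof.
rewrite sumr_ge0 //= -p_sum [ltRHS](bigID (fun q => is_zone q.2)) /= /theta ltrDl.
rewrite (bigD1 (a0, None)) //=; apply: ltr_wpDr; last exact: p_gt0.
exact: sumr_ge0.
Qed.

(** The window [s * s] is much longer than the words, of at most [s + 2] letters. The gap [s %/ 32]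
    is long enough for [theta ^+ (s %/ 32)] to beat the search range, yet short enough for the
    initial clocks, below [2 ^ (s %/ 32).*2], to be small against the duration of the first mode. *)
Lemma error_small : exists2 D, (0 < D)%N &
  ev (fun s => error prog c p a0 s (s * s + U) (s %/ 32) (blocks D s) <= 3 / s%:R).
Proof.
set q1 := (a0, Some (fresh_base m0 P prog)) : Q; set q2 := (a0, Some (fresh_zone Q0 m0 P)) : Q.
set q3 := (a0, None) : Q.
pose delta := p q1 * p q2 * p q3.
have d_gt0 : 0 < delta by rewrite !mulr_gt0.
have d_le q : q \in [:: q1; q2; q3] -> delta <= p q.
  rewrite !inE /delta => /or3P[] /eqP ->.
  - by rewrite -mulrA ler_piMr // mulr_ile1 // p_le1.
  - by rewrite mulrAC ler_piMl // mulr_ile1 // p_le1.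
  - by rewrite ler_piMl // mulr_ile1 // p_le1.
have d_head L i : delta <= \sum_(q : Q | q.2 == head_kind m0 P prog L i) p q.
  have [q Hq Hk] : exists2 q, q \in [:: q1; q2; q3] & q.2 == head_kind m0 P prog L i.
    rewrite /head_kind; case: ifP => _; first by exists q1; rewrite ?inE ?eqxx.
    case: ifP => _; first by exists q2; rewrite ?inE ?eqxx ?orbT.
    by exists q3; rewrite ?inE ?eqxx ?orbT.
  apply: le_trans (d_le q Hq) _; rewrite (bigD1 q) //= lerDl.
  exact: sumr_ge0.
pose D := (Num.bound delta^-1).+1.
have HD : 1 <= D%:R * delta.
  rewrite -ler_pdivrMr // div1r; apply: ltW; apply: lt_le_trans (archi_boundP _) _.
    by rewrite invr_ge0 ltW.
  by rewrite ler_nat.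
exists D => //.
have [k k0 Hk] := half_power theta_bounds.
have /andP[th0 th1] := theta_bounds.
have k32 : (0 < 32 * k)%N by rewrite muln_gt0.
have EV := ev_and (ev_double_root k0) (ev_and (ev_root (4 + 20 + 1 + U + 16 * (25 * c + 6 + U) + 8) k0)
  (ev_and (ev_growth (20 + 2 * U) k32 (ltn0Sn _ : (0 < D)%N)) (ev_and (ev_side c e0 U (ltn0Sn _ : (0 < D)%N)) (ev_ge 1)))).
apply: (ev_imp EV) => s [h1 [h2 [h3 [[s6 _ /andP[L2 Ls] _] s0]]]].
have -> : 3 / s%:R = 1 / s%:R + 1 / s%:R + 1 / s%:R :> R by field; rewrite pnatr_eq0 -lt0n.
rewrite /error; apply: lerD; first apply: lerD.
- set L := tri_root (s + 2) in L2 Ls *.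
  have Hpat : delta ^+ L.+2 / 2 <= prob p (3 * (s + 2)) (pattern prog a0 L (s + 2)).
    apply: pattern_prob => //; [by lia|exact: ltW| |exact: ltW].
    by apply: (pow_bound th0 (ltW th1) Hk).
  set rho := prob _ _ _ in Hpat *.
  have rho01 : 0 <= rho <= 1 by rewrite prob_ge0 ?prob_le1.
  have Hn : s%:R <= (blocks D s)%:R * rho.
    apply: le_trans (_ : (blocks D s)%:R * (delta ^+ L.+2 / 2) <= _); last by apply: ler_wpM2l.
    rewrite /blocks -/L natrM natrX natrM.
    have -> : 2%:R * s%:R * D%:R ^+ L.+2 * (delta ^+ L.+2 / 2) = s%:R * (D%:R * delta) ^+ L.+2 :> R.
      by rewrite [in RHS]exprMn; move: (D%:R ^+ _) (delta ^+ _) => x y; field.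
    by rewrite ler_peMr // exprn_ege1.
  have := bernoulli (blocks D s) rho01; have s0' : 0 < s%:R :> R by rewrite ltr0n.
  have : 0 <= (1 - rho) ^+ blocks D s by rewrite exprn_ge0 // subr_ge0; case/andP: rho01.
  set y := (1 - rho) ^+ _ => y0 Hy; rewrite ler_pdivlMr //.
  apply: le_trans Hy; apply: ler_wpM2l => //; lra.
- apply: (pow_bound th0 (ltW th1) Hk) => //.
  by apply: leq_trans h2; apply: near_count.
- apply: (pow_bound th0 (ltW th1) Hk) => //.
  by rewrite -divnMA; apply: leq_trans h3; apply: gap_count.
Qed.

End ErrorSmall.

Local Open Scope nat_scope.

(** Only the vanishing of frequencies matters, so a factor 2 for the incomplete period is
    affordable. *)
Lemma hits_upper (T : eqType) (a0 : T) W u N x : size u < size W -> size W <= N ->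
  hits a0 W u N x * size W <= N * (2 * (occ W u + size u)).
Proof.
move=> Hu HN; have W0 : 0 < size W by lia.
have /andP[_ H] := hits_bounds a0 u W0 N x; have [_ Hc] := cocc_occ a0 W0 Hu.
apply: leq_trans (leq_mul H (leqnn _)) _; rewrite mulnAC.
apply: leq_trans (_ : 2 * N * (occ W u + size u) <= _); last by rewrite [2 * N]mulnC -mulnA.
apply: leq_mul Hc; rewrite mulSn mul2n -addnn; apply: leq_add => //.
exact: leq_trunc_div.
Qed.

Lemma hits_lower (T : eqType) (a0 : T) W u N x : size u < size W -> size W <= N ->
  N * (occ W u - 1) <= 2 * size W * hits a0 W u N x.
Proof.
move=> Hu HN; have W0 : 0 < size W by lia.
have /andP[H _] := hits_bounds a0 u W0 N x; have [Hc _] := cocc_occ a0 W0 Hu.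
apply: leq_trans (leq_mul (leqnn _) H); rewrite mulnA; apply: leq_mul; last by lia.
have q0 : 0 < N %/ size W by rewrite divn_gt0.
have Hlt := ltn_ceil N W0; rewrite mulSn in Hlt.
have Hq : size W <= N %/ size W * size W by rewrite leq_pmull.
by move: Hlt Hq; rewrite -mulnA [size W * _]mulnC; move: (_ * size W); lia.
Qed.

Lemma reset_order e : 5 <= e -> reset_1 e < reset_2 e < reset_1 e.+1.
Proof.
move=> He; have H1 := pow_half He; have H2 := pow_e He; have H3 := pow_pos (half_up e).
rewrite /reset_1 /reset_2 /=; move: H1 H2 H3; move: (2 ^ e) (2 ^ e.-1) (2 ^ half_up e); lia.
Qed.

Lemma reset_mono e e' : 5 <= e -> e < e' -> reset_1 e.+1 <= reset_1 e'.
Proof.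
move=> He H; rewrite /reset_1 /=; have : 2 ^ e <= 2 ^ e'.-1 by rewrite leq_exp2l //; lia.
lia.
Qed.

Lemma shows_range c md e V : 5 <= e -> shows c md e V ->
  reset_1 e <= V < reset_1 e.+1 /\ md = (V < reset_2 e).
Proof.
move=> He; have := reset_order He; case: md; rewrite /shows => H Hs.
  by split; lia.
by split; [lia|apply/esym/negbTE; rewrite -leqNgt; lia].
Qed.

Lemma shows_unique c md e V e' : 5 <= e -> 5 <= e' -> shows c md e V ->
  reset_1 e' <= V < reset_1 e'.+1 -> e = e' /\ md = (V < reset_2 e').
Proof.
move=> He He' /(shows_range He)[H1 H2] H3.
have E : e = e'.
  case: (ltngtP e e') => // H.
    by have := reset_mono He H; lia.
  by have := reset_mono He' H; lia.
by rewrite -E.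
Qed.

(** * Bounds on the measure of a word at time t *)

Section PushBounds.
Variables (R : realType) (Q0 : finType) (m0 P : nat) (prog : seq (instr Q0)) (start2 : nat).
Hypothesis m0_ge : 2 <= m0.
Hypothesis prog_ok : all (instr_ok m0 P) prog.
Hypothesis start2_ok : start2 <= P.
Hypothesis size_ok : size prog <= P.
Variables (w w' : nat -> seq Q0) (c e0 : nat) (i1 i2 : nat -> nat).
Hypothesis spec : program_spec w w' prog start2 c e0 i1 i2.
Hypotheses (w_growing : growing w) (w'_growing : growing w').
Notation kind := (option (cell Q0 m0 P)).
Notation Q := (Q0 * kind)%type.
Variable p : Q -> R.
Hypothesis p_full : full_bernoulli p.
Variable a0 : Q0.
Let d : Q := (a0, None).
Notation word_of := (word_of w w' i1 i2).
Notation push := (ca_push (automaton m0 P prog start2) p).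

Let p_ge0 q : (0 <= p q)%R. Proof. by have [H _] := p_full; apply: ltW. Qed.
Let p_sum : (\sum_q p q = 1)%R. Proof. by have [_ ->] := p_full. Qed.

Lemma ev_word U : ev (fun s => forall md e, s <= e -> U < size (word_of md e)).
Proof.
have one (x : nat -> seq Q0) (i : nat -> nat) : growing x -> slow i -> ev (fun s => forall e, s <= e -> U < size (x (i e))).
  move=> Hx [_ Hi]; have [M HM] := Hx U.+1; have [E HE] := Hi M.
  by exists E => s Hs e He; apply: HM; apply: HE; apply: leq_trans Hs He.
apply: (ev_imp (ev_and (one _ _ w_growing (spec_slow1 spec)) (one _ _ w'_growing (spec_slow2 spec)))).
by move=> s [H1 H2] [] e He; [apply: H1|apply: H2].
Qed.

Local Open Scope ring_scope.

(** The expected count is split by [bad], which costs at most the proportion [3 / s]; otherwise the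
    window shows one periodic word, whose mode and epoch are known only through the approximate
    clock reading [V]. *)
Lemma push_bounds U : exists D, ev (fun s => [/\ side c e0 U D s, (3%:R : R) <= s%:R,
  forall md e, (s <= e)%N -> (U < size (word_of md e))%N &
  forall u : seq Q, size u = U -> forall t, (2 ^ s <= t < 2 ^ s.+1)%N ->
   (has (fun q : Q => q.2 != None) u -> push t u <= 3 / s%:R) /\
   forall v, u = [seq (q, None) | q <- v] ->
    let near_t md e := exists V, [/\ (s <= e <= s + 2)%N, (t <= V + 2 ^ (s %/ 4))%N, (V < t + 2 ^ (s %/ 4))%N & shows c md e V] in
    (forall b, 0 <= b -> (forall md e, near_t md e ->
       2 * ((occ (word_of md e) v + U)%:R / (size (word_of md e))%:R) <= b) -> push t u <= 3 / s%:R + b) /\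
    (forall b, 0 <= b -> (forall md e, near_t md e ->
       b <= (occ (word_of md e) v - 1)%:R / (2 * size (word_of md e))%:R) -> (1 - 3 / s%:R) * b <= push t u)]).
Proof.
have [D D0 HD] := error_small prog c e0 p_full a0 U; exists D.
have EV := ev_and HD (ev_and (ev_side c e0 U D0) (ev_and (ev_word U) (ev_ge 3))).
apply: (ev_imp EV) => s [Herr [Hside [Hw s3]]]; split=> // [|u Hu]; first by rewrite ler_nat.
move=> t /andP[Ht1 Ht2].
have [s6 ok_e /andP[L2 Ls] Hsum] := Hside.
set M := (blocks D s * (3 * (s + 2)))%N in Hsum.
have P4 : (2 ^ (s %/ 4) <= 2 ^ s.-1)%N by rewrite leq_exp2l //; lia.
have P5 : (2 ^ s.-1 <= 2 ^ s)%N by rewrite leq_exp2l //; lia.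
have MN : (M + (s * s + U) + 8 * s + 32 <= 2 ^ s.-1)%N by move: Hsum P4; lia.
have MN2 : (M + (s * s + U) + 4 * (s %/ 32) + 5 * s + 32 <= t)%N by move: MN P5 Ht1; lia.
have As : ((s %/ 32).*2 <= s)%N by lia.
have L0 : (0 < tri_root (s + 2))%N by lia.
pose bad (x : seq Q) := bad_event prog start2 c a0 s t (s * s + U) (s %/ 32) (blocks D s) x.
have Hbad : prob p (s * s + U + 4 * t) bad <= 3 / s%:R.
  by apply: le_trans Herr; apply: bad_event_prob.
set err := 3 / s%:R in Hbad *.
have N0 : 0 < (s * s)%:R :> R by rewrite ltr0n muln_gt0; lia.
pose cnt (x : seq Q) := wcount d (fun i => config prog start2 d x t (2 * t + i)%N) u (s * s).
have Hpush : (s * s)%:R * push t u = Ex p (s * s + U + 4 * t) (fun x => (cnt x)%:R).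
  by rewrite -Hu; apply: ca_push_wcount.
have cnt_le x : (cnt x <= s * s)%N.
  by rewrite -[leqRHS](size_iota 0 (s * s)); apply: count_size.
have upper b : 0 <= b -> (forall x, ~~ bad x -> (cnt x)%:R <= (s * s)%:R * b) -> push t u <= err + b.
  move=> b0 Hb; rewrite -(ler_pM2l N0) Hpush.
  apply: le_trans (_ : Ex p (s * s + U + 4 * t) (fun x => (s * s)%:R * (bad x)%:R + (s * s)%:R * b) <= _).
    apply: Ex_le => // x _; case Hx : (bad x).
      by rewrite mulr1 -[leLHS]addr0 lerD // ?ler_nat // mulr_ge0.
    by rewrite mulr0 add0r Hb // Hx.
  rewrite ExD ExZ Ex_const // mulrDr lerD2r.
  by apply: ler_wpM2l => //; apply: ltW.
have lower b : 0 <= b -> (forall x, ~~ bad x -> (s * s)%:R * b <= (cnt x)%:R) -> (1 - err) * b <= push t u.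
  move=> b0 Hb; rewrite -(ler_pM2l N0) Hpush.
  apply: le_trans (_ : Ex p (s * s + U + 4 * t) (fun x => (s * s)%:R * b * (~~ bad x)%:R) <= _); last first.
    apply: Ex_le => // x _; case Hx : (bad x); first by rewrite mulr0.
    by rewrite mulr1 Hb // Hx.
  rewrite ExZ -/(prob p _ (fun x => ~~ bad x)) prob_not // -mulrA [(1 - err) * b]mulrC.
  apply: ler_wpM2l; first exact: ltW.
  by apply: ler_wpM2l => //; lra.
have words : forall e, (s <= e)%N -> forall md, (0 < size (word_of md e))%N.
  by move=> e He md; apply: leq_ltn_trans (Hw md e He).
have good x : ~~ bad x -> exists md e j y,
    let V := (clk prog start2 (s %/ 32) (kd a0 (drop (2 * t - j) x)) + (t - j))%N in
   [/\ (s <= e <= s + 2)%N, (0 < j <= M)%N, (clk prog start2 (s %/ 32) (kd a0 (drop (2 * t - j) x)) < 2 ^ (s %/ 32).*2)%N,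
       (forall z, V <= z + (s * s + U) -> z <= V + (s * s + U) -> shows c md e z)%N &
       forall i, (i < s * s + U)%N -> config prog start2 d x t (2 * t + i) =
        (nth a0 (word_of md e) ((y + i) %% size (word_of md e)), None)].
  move=> Hx; exact: (good_window m0_ge prog_ok start2_ok size_ok spec s6 Ht1 Ht2 MN As ok_e L0 Ls Hx words).
split.
  move=> Hu2; rewrite -[err]addr0; apply: upper => // x /good[md [e [j [y [_ _ _ _ Hc]]]]].
  rewrite /cnt (wcount_not_emb) ?mulr0 // Hu => i Hi.
  by rewrite Hc.
move=> v Ev near_t.
have Uv : size v = U by rewrite -Hu Ev size_map.
have gcount x : ~~ bad x -> exists md e y, near_t md e /\ cnt x = hits a0 (word_of md e) v (s * s) y.
  move=> /good[md [e [j [y [G1 G2 G3 G4 G5]]]]]; exists md, e, y; split.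
    exists (clk prog start2 (s %/ 32) (kd a0 (drop (2 * t - j) x)) + (t - j))%N; split=> //.
    - by move: Hsum MN2 G2; clear; lia.
    - by move: Hsum MN2 G2 G3; clear; lia.
    - by apply: G4; apply: leq_addr.
  have He : (s <= e)%N by case/andP: G1.
  by rewrite /cnt Ev; apply: wcount_emb; [exact: words|rewrite Uv].
have wsize md e : near_t md e -> (U < size (word_of md e) <= s * s)%N /\ 0 < (size (word_of md e))%:R :> R.
  move=> [V [He _ _ _]].
  have H1 : (U < size (word_of md e))%N by apply: Hw; case/andP: He.
  split; last by rewrite ltr0n; apply: leq_ltn_trans H1.
  rewrite H1 /=; have oke : (e0 <= e)%N by have [] := ok_e e; first by lia.
  apply: leq_trans (word_size spec md oke) _.
  have : (6 * s <= s * s)%N by rewrite leq_mul2r s6 orbT.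
  by lia.
split=> b b0 Hb.
  apply: upper => // x /gcount[md [e [y [Hn ->]]]].
  have [/andP[H1 H2] H3] := wsize md e Hn.
  apply: le_trans (_ : (s * s)%:R * (2 * ((occ (word_of md e) v + U)%:R / (size (word_of md e))%:R)) <= _); last first.
    by apply: ler_wpM2l; [exact: ltW|exact: Hb].
  rewrite !mulrA ler_pdivlMr // -!natrM ler_nat -mulnA -Uv.
  by apply: hits_upper; rewrite ?Uv.
apply: lower => // x /gcount[md [e [y [Hn ->]]]].
have [/andP[H1 H2] H3] := wsize md e Hn.
apply: le_trans (_ : (s * s)%:R * ((occ (word_of md e) v - 1)%:R / (2 * size (word_of md e))%:R) <= _).
  by apply: ler_wpM2l; [exact: ltW|exact: Hb].
rewrite mulrA ler_pdivrMr; last by rewrite natrM mulr_gt0.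
by rewrite -!natrM ler_nat [leqRHS]mulnC; apply: hits_lower; rewrite ?Uv.
Qed.

End PushBounds.

(** * Limits *)

Import numFieldNormedType.Exports.
Local Open Scope ring_scope.
Local Open Scope classical_set_scope.

Section Null.
Variable R : realType.
Implicit Types f : nat -> R.

Definition null f := forall e : R, 0 < e -> ev (fun n => f n < e).

Lemma nullP f : (forall n, 0 <= f n) -> (f @ \oo --> (0 : R)) <-> null f.
Proof.
move=> f0; split=> [/cvgrPdist_lt H e e0|H].
  have [N _ HN] := H e e0; exists N => n Hn.
  by have := HN n Hn; rewrite /= sub0r normrN ger0_norm.
apply/cvgrPdist_lt => e e0; have [N HN] := H e e0; exists N => // n /= Hn.
by rewrite sub0r normrN ger0_norm // HN.
Qed.

Lemma not_null f : ~ null f -> exists2 e : R, 0 < e & forall n0, exists2 n, (n0 <= n)%N & e <= f n.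
Proof.
move=> H; apply: contrapT => Hn; apply: H => e e0; apply: contrapT => He; apply: Hn.
exists e => // n0; apply: contrapT => Hx; apply: He; exists n0 => n Hn.
by rewrite ltNge; apply/negP => Hle; apply: Hx; exists n.
Qed.

Lemma ev_inv (e : R) a : 0 < e -> ev (fun n => a / n%:R < e).
Proof.
move=> e0; exists (Num.bound (`|a| / e)).+1 => n Hn.
have n0 : 0 < n%:R :> R by rewrite ltr0n; apply: leq_trans Hn.
rewrite ltr_pdivrMr //; apply: le_lt_trans (ler_norm a) _.
rewrite mulrC -ltr_pdivrMr //; apply: lt_le_trans (archi_boundP _) _; first by rewrite divr_ge0 // ltW.
by rewrite ler_nat; apply: ltnW.
Qed.

Lemma slow_surj i E k : slow i -> (i E <= k)%N -> exists2 e, (E <= e)%N & i e = k.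
Proof.
move=> [Hs Hu] HE; have [E' HE'] := Hu k.
have Hex : exists e, (E <= e)%N && (k <= i e)%N by exists (maxn E E'); rewrite leq_maxl HE' // leq_maxr.
have [e /andP[H1 H2] Hmin] := ex_minnP Hex; exists e => //.
case: (eqVneq e E) => [Ee|Hne]; first by apply/eqP; rewrite eqn_leq H2 Ee HE.
have He : e = e.-1.+1 by lia.
have : ~~ ((E <= e.-1)%N && (k <= i e.-1)%N) by apply/negP => /Hmin; lia.
by have := Hs e.-1; rewrite -He; lia.
Qed.

(** * Cesaro means over dyadic blocks *)

Section Cesaro.
Variable f : nat -> R.
Hypotheses (f_ge0 : forall n, 0 <= f n) (f_le1 : forall n, f n <= 1).

Definition mean n := (\sum_(1 <= k < n.+1) f k) / n%:R.
(** Near a power of two the first mode lasts about [2 ^ half_up s.+1]; [gap s] covers it with the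
    uncertainty [2 ^ (s %/ 4)] of the clock, and is still negligible against [2 ^ s]. *)
Definition gap s := (2 ^ (s %/ 2 + 3))%N.

Lemma mean_ge0 n : 0 <= mean n.
Proof. by rewrite divr_ge0 // sumr_ge0. Qed.

Lemma gap_mono s s' : (s <= s')%N -> (gap s <= gap s')%N.
Proof. by move=> H; rewrite leq_exp2l // leq_add2r leq_div2r. Qed.

Lemma exceptional_count s n : (count (fun k => has (fun j => near (gap s) (2 ^ j) k) (iota 0 s.+2)) (iota 1 n)
   <= s.+2 * (gap s).*2.+1)%N.
Proof.
rewrite -[s.+2 in leqRHS](size_iota 0); elim: (iota 0 s.+2) => [|j r IH] /=; first by rewrite count_pred0.
rewrite mulSn; apply: leq_trans (_ : count (fun k => near (gap s) (2 ^ j) k) (iota 1 n) +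
   count (fun k => has (fun j => near (gap s) (2 ^ j) k) r) (iota 1 n) <= _)%N.
  by rewrite -count_predUI leq_addr.
apply: leq_add IH; rewrite -size_filter -(size_iota (2 ^ j - gap s) (gap s).*2.+1); apply: uniq_leq_size.
  by apply: filter_uniq; apply: iota_uniq.
by move=> k; rewrite mem_filter !mem_iota /near; lia.
Qed.

(** For [n] between [2 ^ q] and [2 ^ q.+1], the exceptional times are a bounded number plus those
    close to powers of two, about [q * 2 ^ (q / 2)] in all, a vanishing proportion of [n]. *)
Lemma cesaro_upper (eta : R) s1 : 0 < eta ->
  (forall s t, (s1 <= s)%N -> (2 ^ s + gap s <= t)%N -> (t + gap s <= 2 ^ s.+1)%N -> f t <= eta) ->
  ev (fun n => mean n <= 2 * eta).
Proof.
move=> eta0 Hf; pose k0 := (Num.bound eta^-1).+1.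
have Hk0 : 1 <= k0%:R * eta.
  rewrite -ler_pdivrMr // div1r; apply: ltW; apply: lt_le_trans (archi_boundP _) _.
    by rewrite invr_ge0 ltW.
  by rewrite ler_nat.
have Hlog a : ev (fun n => (a <= trunc_log 2 n)%N).
  by exists (2 ^ a)%N => n Hn; apply: trunc_log_max.
have EV := ev_and (ev_comp (poly_exp (3 * (k0 * (2 ^ s1 + 17))) 1 (isT : (0 < 2)%N)) Hlog) (ev_and (Hlog 1%N) (ev_ge 1)).
apply: (ev_imp EV) => n [h1 [h2 h3]].
have n0 : 0 < n%:R :> R by rewrite ltr0n.
set q := trunc_log 2 n in h1 h2.
have /andP[Hq1 Hq2] := trunc_log_bounds (isT : (1 < 2)%N) h3; rewrite -/q in Hq1 Hq2.
pose ex k := has (fun j => near (gap q) (2 ^ j) k) (iota 0 q.+2).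
have point k : (1 <= k <= n)%N -> f k <= eta + (k < 2 ^ s1)%:R + (ex k)%:R.
  move=> /andP[k1 kn]; case: (ltnP k (2 ^ s1)) => Hk.
    rewrite [eta + _]addrC -addrA; apply: le_trans (f_le1 k) _; rewrite lerDl.
    by rewrite addr_ge0 // ltW.
  rewrite addr0; set s := trunc_log 2 k.
  have /andP[Hs1 Hs2] := trunc_log_bounds (isT : (1 < 2)%N) k1; rewrite -/s in Hs1 Hs2.
  have s1s : (s1 <= s)%N by apply: trunc_log_max.
  have sq : (s <= q)%N by apply: trunc_log_max => //; apply: leq_trans kn.
  have G := gap_mono sq.
  case: (leqP (2 ^ s + gap s)%N k) => H1; last first.
    have -> : ex k by apply/hasP; exists s; [rewrite mem_iota; lia|rewrite /near; lia].
    by apply: le_trans (f_le1 k) _; rewrite lerDr ltW.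
  case: (leqP (k + gap s)%N (2 ^ s.+1)%N) => H2; last first.
    have -> : ex k by apply/hasP; exists s.+1; [rewrite mem_iota; lia|rewrite /near; lia].
    by apply: le_trans (f_le1 k) _; rewrite lerDr ltW.
  by apply: le_trans (Hf _ _ s1s H1 H2) _; rewrite lerDl.
rewrite /mean ler_pdivrMr //.
have -> : \sum_(1 <= k < n.+1) f k = \sum_(k <- iota 1 n) f k by rewrite /index_iota subSS subn0.
have Hsum : \sum_(k <- iota 1 n) f k <= \sum_(k <- iota 1 n) (eta + (k < 2 ^ s1)%:R + (ex k)%:R).
  apply: ler_sum_mem => k; rewrite mem_iota => Hk; apply: point; lia.
apply: le_trans Hsum _; rewrite !big_split /= big_const_seq count_predT size_iota iter_addr_0 -!natr_sum.
have Hc1 : (\sum_(k <- iota 1 n) (k < 2 ^ s1) <= 2 ^ s1)%N.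
  rewrite -big_mkcond sum1_count -size_filter -[leqRHS](size_iota 0); apply: uniq_leq_size.
    by apply: filter_uniq; apply: iota_uniq.
  by move=> k; rewrite mem_filter !mem_iota; lia.
have Hc2 : (\sum_(k <- iota 1 n) ex k <= q.+2 * (gap q).*2.+1)%N.
  by rewrite -big_mkcond sum1_count exceptional_count.
have Hnat : (k0 * (2 ^ s1 + q.+2 * (gap q).*2.+1) <= n)%N.
  apply: leq_trans Hq1.
  set x := (2 ^ (q %/ 2))%N in h1.
  have x0 : (0 < x)%N by rewrite expn_gt0.
  have Hg : gap q = (8 * x)%N by rewrite /gap expnD mulnC.
  apply: leq_trans (_ : x * x <= _)%N; last by rewrite -expnD leq_exp2l //; lia.
  apply: leq_trans (leq_mul h1 (leqnn x)); rewrite expn1 Hg.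
  have H1 : ((8 * x).*2.+1 <= 17 * x)%N by lia.
  have H2 : (q.+2 * (8 * x).*2.+1 <= (3 * q) * (17 * x))%N by apply: leq_mul => //; lia.
  have H3 : (2 ^ s1 <= 2 ^ s1 * (3 * q * x))%N by rewrite leq_pmulr // !muln_gt0 /= h2 x0.
  have -> : (3 * (k0 * (2 ^ s1 + 17)) * q * x = k0 * (2 ^ s1 * (3 * q * x) + (3 * q) * (17 * x)))%N by clear; lia.
  by rewrite leq_mul2l leq_add ?orbT.
have Hreal : (2 ^ s1 + q.+2 * (gap q).*2.+1)%:R <= n%:R * eta.
  have : (k0 * (2 ^ s1 + q.+2 * (gap q).*2.+1))%:R <= n%:R :> R by rewrite ler_nat.
  rewrite natrM; set y := (2 ^ s1 + _)%:R => Hy.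
  have y0 : 0 <= y by rewrite ler0n.
  have : k0%:R * y * eta <= n%:R * eta by apply: ler_wpM2r => //; apply: ltW.
  have : y * 1 <= y * (k0%:R * eta) by apply: ler_wpM2l.
  by rewrite mulr1 mulrCA mulrA; lra.
have : (\sum_(k <- iota 1 n) (k < 2 ^ s1) + \sum_(k <- iota 1 n) ex k)%:R <= n%:R * eta.
  by apply: le_trans Hreal; rewrite ler_nat; apply: leq_add.
rewrite natrD -[eta *+ n]mulr_natl; lra.
Qed.

(** One dyadic block without its margins fills at least a quarter of the times up to [2 ^ s.+1], so
    it alone keeps the mean at [eta / 4]. *)
Lemma cesaro_lower (eta : R) : 0 < eta ->
  (forall s0, exists2 s, (s0 <= s)%N & forall t, (2 ^ s + gap s <= t)%N -> (t + gap s <= 2 ^ s.+1)%N -> eta <= f t) ->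
  ~ null mean.
Proof.
move=> eta0 Hs Hn; have [n0 H] := Hn (eta / 4) ltac:(by rewrite divr_gt0).
have [s1 Hs1] := poly_exp 64 1 (isT : (0 < 2)%N).
have [s Hs0 Ht] := Hs (maxn n0 (maxn s1 8)).
have [h1 h2 h3] : [/\ n0 <= s, s1 <= s & 8 <= s]%N by split; lia.
have H64 := Hs1 s h2; rewrite expn1 in H64.
have Hn0 : (n0 <= 2 ^ s.+1)%N by apply: leq_trans (ltnW (ltn_expl s.+1 (isT : (1 < 2)%N))); lia.
have := H _ Hn0; apply/negP; rewrite -leNgt /mean.
have G : (8 * gap s <= 2 * 2 ^ s)%N.
  have -> : gap s = (8 * 2 ^ (s %/ 2))%N by rewrite /gap expnD mulnC.
  have : (2 ^ (s %/ 2) * 2 ^ (s %/ 2) <= 2 ^ s)%N by rewrite -expnD leq_exp2l //; lia.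
  have : (64 * 8 * 2 ^ (s %/ 2) <= 2 ^ (s %/ 2) * 2 ^ (s %/ 2))%N.
    by rewrite leq_mul2r; apply/orP; right; lia.
  lia.
have E2 : (2 ^ s.+1 = 2 * 2 ^ s)%N by rewrite expnS.
rewrite ler_pdivlMr ?ltr0n ?expn_gt0 //.
have -> : \sum_(1 <= k < (2 ^ s.+1).+1) f k =
   \sum_(1 <= k < 2 ^ s + gap s) f k + (\sum_(2 ^ s + gap s <= k < (2 ^ s.+1 - gap s).+1) f k +
   \sum_((2 ^ s.+1 - gap s).+1 <= k < (2 ^ s.+1).+1) f k).
  have g0 : (0 < gap s)%N by rewrite expn_gt0.
  have p0 : (0 < 2 ^ s)%N by rewrite expn_gt0.
  rewrite -big_cat_nat ?ltnS ?leq_subr //; last by lia.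
  by rewrite -big_cat_nat //; lia.
have A1 : 0 <= \sum_(1 <= k < 2 ^ s + gap s) f k by rewrite sumr_ge0.
have A2 : 0 <= \sum_((2 ^ s.+1 - gap s).+1 <= k < (2 ^ s.+1).+1) f k by rewrite sumr_ge0.
have A3 : ((2 ^ s.+1 - gap s).+1 - (2 ^ s + gap s))%:R * eta <= \sum_(2 ^ s + gap s <= k < (2 ^ s.+1 - gap s).+1) f k.
  rewrite mulr_natl -sumr_const_nat; apply: ler_sum_nat => k Hk.
  by apply: Ht; lia.
have A4 : (2 ^ s.+1)%:R <= 4 * ((2 ^ s.+1 - gap s).+1 - (2 ^ s + gap s))%:R :> R.
  by rewrite -natrM ler_nat; lia.
have : (2 ^ s.+1)%:R * eta <= 4 * ((2 ^ s.+1 - gap s).+1 - (2 ^ s + gap s))%:R * eta.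
  by apply: ler_wpM2r => //; apply: ltW.
move: A3; rewrite -[4 * _ * eta]mulrA; move: (_%:R * eta) => y A3 A5.
lra.
Qed.

End Cesaro.
End Null.

Lemma instr_ok_mono (T : finType) m P m' P' (i : instr T) : (m <= m')%N -> (P <= P')%N -> instr_ok m P i -> instr_ok m' P' i.
Proof.
move=> Hm HP; case: i => [r n|r n|r z nz|a n|n|b] //=.
- by move=> /andP[H1 H2]; rewrite (leq_trans H1) // (leq_trans H2).
- by move=> /andP[H1 H2]; rewrite (leq_trans H1) // (leq_trans H2).
- by move=> /and3P[H1 H2 H3]; rewrite (leq_trans H1) // (leq_trans H2) // (leq_trans H3).
- by move=> H; apply: leq_trans H HP.
- by move=> H; apply: leq_trans H HP.
Qed.

Lemma instr_ok_exists (T : finType) (prog : seq (instr T)) : exists m P, all (instr_ok m P) prog.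
Proof.
elim: prog => [|i prog [m [P H]]]; first by exists 0%N, 0%N.
have [m' [P' H']] : exists m' P', instr_ok m' P' i.
  case: i => [r n|r n|r z nz|a n|n|b].
  - by exists r, n; rewrite /= !leqnn.
  - by exists r, n; rewrite /= !leqnn.
  - by exists r, (maxn z nz); rewrite /= leqnn leq_maxl leq_maxr.
  - by exists 0%N, n => /=.
  - by exists 0%N, n => /=.
  - by exists 0%N, 0%N.
exists (maxn m m'), (maxn P P'); rewrite /= (instr_ok_mono _ _ H') ?leq_maxr //=.
by apply: sub_all H => j; apply: instr_ok_mono; apply: leq_maxl.
Qed.

Section Density.
Variables (R : realType) (Q0 : finType) (w : nat -> seq Q0) (v : seq Q0).
Hypothesis w_growing : growing w.

Lemma dens_ge0 i : 0 <= dens R (w i) v.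
Proof. by rewrite divr_ge0. Qed.

Lemma LwP : Lw R w v <-> ~ null (fun i => dens R (w i) v).
Proof. by rewrite /Lw nullP //; exact: dens_ge0. Qed.

Lemma ev_size a : ev (fun i => (a <= size (w i))%N).
Proof. by have [M HM] := w_growing a; exists M. Qed.

Lemma ratio_null : null (fun i => dens R (w i) v) ->
  null (fun i => 2 * ((occ (w i) v + size v)%:R / (size (w i))%:R) : R).
Proof.
move=> H e e0; have e4 : 0 < e / 4 by rewrite divr_gt0.
have [b Hb] := ev_inv (size v)%:R e4.
apply: (ev_imp (ev_and (H _ e4) (ev_size (maxn b (size v).+1)))) => i [h1 h2].
rewrite geq_max in h2; case/andP: h2 => h2 h3.
have l0 : 0 < (size (w i))%:R :> R by rewrite ltr0n; apply: leq_trans h3.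
have d0 : 0 < (size (w i) - size v)%:R :> R by rewrite ltr0n subn_gt0.
have H1 : (occ (w i) v)%:R / (size (w i))%:R <= dens R (w i) v.
  by rewrite /dens ler_wpM2l // lef_pV2 ?posrE // ler_nat leq_subr.
have H2 := Hb _ h2; rewrite natrD mulrDl; lra.
Qed.

(** The 8 is a factor 2 for the length against the length minus [size v], one for the subtracted
    occurrence, and one from the denominator. *)
Lemma ratio_low (e : R) : 0 < e -> ev (fun i => e <= dens R (w i) v ->
  e / 8 <= (occ (w i) v - 1)%:R / (2 * size (w i))%:R).
Proof.
move=> e0; have e4 : 0 < e / 4 by rewrite divr_gt0.
have [b Hb] := ev_inv 1 e4.
apply: (ev_imp (ev_size (maxn b (2 * size v).+1))) => i h2 Hd.
rewrite geq_max in h2; case/andP: h2 => h2 h3.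
have l0 : 0 < (size (w i))%:R :> R by rewrite ltr0n; apply: leq_trans h3.
have d0 : 0 < (size (w i) - size v)%:R :> R by rewrite ltr0n subn_gt0; lia.
have H2 := Hb _ h2; rewrite ltr_pdivrMr // in H2.
rewrite ler_pdivlMr // in Hd.
have H3 : (size (w i))%:R <= 2 * (size (w i) - size v)%:R :> R by rewrite -natrM ler_nat; lia.
have H4 : e * (size (w i))%:R <= e * (2 * (size (w i) - size v)%:R) by apply: ler_wpM2l => //; apply: ltW.
have H5 : (occ (w i) v)%:R <= (occ (w i) v - 1)%:R + 1 :> R by rewrite natr1 ler_nat; lia.
rewrite ler_pdivlMr ?natrM ?mulr_gt0 //.
by move: H2 Hd H4 H5; move: (occ _ _ - 1)%:R (occ _ _)%:R => x y; lra.
Qed.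

End Density.

(** * Persistent and Cesaro-persistent words *)

Section Main.
Variables (R : realType) (Q0 : finType) (m0 P : nat) (prog : seq (instr Q0)) (start2 : nat).
Hypothesis m0_ge : (2 <= m0)%N.
Hypothesis prog_ok : all (instr_ok m0 P) prog.
Hypothesis start2_ok : (start2 <= P)%N.
Hypothesis size_ok : (size prog <= P)%N.
Variables (w w' : nat -> seq Q0) (c e0 : nat) (i1 i2 : nat -> nat).
Hypothesis spec : program_spec w w' prog start2 c e0 i1 i2.
Hypotheses (w_growing : growing w) (w'_growing : growing w').
Notation kind := (option (cell Q0 m0 P)).
Notation Q := (Q0 * kind)%type.
Variable p : Q -> R.
Hypothesis p_full : full_bernoulli p.
Notation A := (automaton m0 P prog start2).
Notation emb := (fun q : Q0 => ((q, None) : Q)).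

Let p_ge0 q : 0 <= p q. Proof. by have [H _] := p_full; apply: ltW. Qed.
Let p_sum : \sum_q p q = 1. Proof. by have [_ ->] := p_full. Qed.

(** A default letter exists because weights over an empty alphabet cannot sum to 1. *)
Lemma letter_exists : exists a0 : Q0, True.
Proof.
case: (pickP (fun _ : Q => true)) => [[a0 k] _|H]; first by exists a0.
have : (0 : R) = 1 by rewrite -p_sum big_pred0.
by move/eqP; rewrite eq_sym oner_eq0.
Qed.

Lemma push_ge0 t u : 0 <= ca_push A p t u.
Proof. by apply: sumr_ge0 => x _; apply: prodr_ge0 => q _. Qed.

Lemma push_le1 t u : ca_push A p t u <= 1.
Proof. by have [a0 _] := letter_exists; rewrite (ca_push_Ex prog start2 p (a0, None)) prob_le1. Qed.

Lemma persistentP u : persistent A p u <-> ~ null (fun t => ca_push A p t u).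
Proof. by rewrite /persistent nullP // => t; apply: push_ge0. Qed.

Lemma cesaroP u : cesaro_persistent A p u <-> ~ null (mean (fun t => ca_push A p t u)).
Proof. by rewrite /cesaro_persistent -nullP // => n; apply: mean_ge0 => t; apply: push_ge0. Qed.

Lemma null_upper (f : nat -> R) : (forall e, 0 < e -> ev (fun n => f n <= e)) -> null f.
Proof.
move=> H e e_gt0; have [|n0 Hn] := H (e / 2); first by rewrite divr_gt0.
by exists n0 => n /Hn Hf; apply: le_lt_trans Hf _; lra.
Qed.

Lemma dyadic (Pr : nat -> nat -> Prop) : ev (fun s => forall t, (2 ^ s <= t < 2 ^ s.+1)%N -> Pr s t) ->
  ev (fun t => exists s, Pr s t).
Proof.
move=> [s0 H]; exists (2 ^ s0)%N => t Ht; exists (trunc_log 2 t); apply: H.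
  exact: trunc_log_max.
by apply: trunc_log_bounds => //; apply: leq_trans Ht; rewrite expn_gt0.
Qed.

(** [V] is the clock reading of the agent whose letters are seen; it depends on the configuration
    and is known only up to [2 ^ (s %/ 4)]. *)
Definition near_t s t md e := exists V,
  [/\ (s <= e <= s + 2)%N, (t <= V + 2 ^ (s %/ 4))%N, (V < t + 2 ^ (s %/ 4))%N & shows c md e V].

Lemma not_emb_small u (e : R) : has (fun q : Q => q.2 != None) u -> 0 < e ->
  ev (fun s => forall t, (2 ^ s <= t < 2 ^ s.+1)%N -> ca_push A p t u <= e).
Proof.
move=> Hu e_gt0; have [a0 _] := letter_exists.
have [D HD] := push_bounds m0_ge prog_ok start2_ok size_ok spec w_growing w'_growing p_full a0 (size u).
apply: (ev_imp (ev_and HD (ev_inv 3 e_gt0))) => s [[_ _ _ H] Hs] t Ht.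
by have [H1 _] := H u erefl t Ht; apply: le_trans (H1 Hu) (ltW Hs).
Qed.

Variable v : seq Q0.
Notation u := (map emb v).
Notation word_of := (word_of w w' i1 i2).

Lemma emb_bounds : ev (fun s => [/\ (40 <= s)%N, 3 / s%:R <= 1 / 2 :> R & forall t, (2 ^ s <= t < 2 ^ s.+1)%N ->
    (forall b, 0 <= b -> (forall md e, near_t s t md e ->
       2 * ((occ (word_of md e) v + size v)%:R / (size (word_of md e))%:R) <= b) -> ca_push A p t u <= 3 / s%:R + b) /\
    (forall b, 0 <= b -> (forall md e, near_t s t md e ->
       b <= (occ (word_of md e) v - 1)%:R / (2 * size (word_of md e))%:R) -> b / 2 <= ca_push A p t u)]).
Proof.
have [a0 _] := letter_exists.
have [D HD] := push_bounds m0_ge prog_ok start2_ok size_ok spec w_growing w'_growing p_full a0 (size v).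
have half : 0 < 1 / 2 :> R by rewrite divr_gt0.
apply: (ev_imp (ev_and HD (ev_and (ev_inv 3 half) (ev_ge 40)))) => s [[_ _ _ H] [Hs s40]].
split=> //; first exact: ltW.
move=> t Ht; have [_ /(_ v erefl) [H1 H2]] := H u (size_map _ _) t Ht.
split=> // b b0 Hb; apply: le_trans (H2 b b0 Hb).
by rewrite mulrC; apply: ler_wpM2r => //; lra.
Qed.

Lemma ev_index (i : nat -> nat) (Pr : nat -> Prop) : slow i -> ev Pr -> ev (fun s => forall e, (s <= e)%N -> Pr (i e)).
Proof.
move=> [_ Hi] [n0 Hn]; have [E HE] := Hi n0.
by exists E => s Hs e He; apply: Hn; apply: HE; apply: leq_trans He.
Qed.

Lemma push_null : null (fun i => dens R (w i) v) -> null (fun i => dens R (w' i) v) ->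
  null (fun t => ca_push A p t u).
Proof.
move=> H1 H2; apply: null_upper => e e_gt0; have e2 : 0 < e / 2 by rewrite divr_gt0.
have K1 := ev_index (spec_slow1 spec) (ratio_null w_growing H1 e2).
have K2 := ev_index (spec_slow2 spec) (ratio_null w'_growing H2 e2).
have H := ev_and emb_bounds (ev_and (ev_inv 3 e2) (ev_and K1 K2)).
have [|n0 Hn0] := @dyadic (fun s t => ca_push A p t u <= e); last by exists n0 => t /Hn0[].
apply: (ev_imp H) => s [[_ _ Hb] [Hs [k1 k2]]] t Ht.
have [Hu _] := Hb t Ht; apply: le_trans (Hu (e / 2) (ltW e2) _) _; last by lra.
by move=> md e1 [V [/andP[He _] _ _ _]]; apply: ltW; case: md; [apply: k1|apply: k2].
Qed.

Lemma quarter_half s : (2 ^ (s %/ 4) <= 2 ^ (s %/ 2))%N.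
Proof. by rewrite leq_exp2l //; lia. Qed.

(** The delay [2 ^ (s %/ 4)] puts every admissible clock reading after the first restart, and twice
    this delay is within the duration [2 ^ half_up s.+1] of the first mode. *)
Lemma near_mode1 s md e : (40 <= s)%N -> near_t s (reset_1 s.+1 + 2 ^ (s %/ 4)) md e -> e = s.+1 /\ md = true.
Proof.
move=> s40 [V [He H1 H2 Hs]].
have Hh : (2 * 2 ^ (s %/ 4) <= 2 ^ half_up s.+1)%N by rewrite -expnS leq_exp2l // /half_up; lia.
have HV : (reset_1 s.+1 <= V < reset_2 s.+1)%N.
  by move: H1 H2 Hh; rewrite /reset_1 /reset_2; move: (2 ^ (s %/ 4))%N (2 ^ half_up _)%N (2 ^ _)%N; lia.
have s5 : (5 <= s.+1)%N by lia.
have e5 : (5 <= e)%N by lia.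
have := reset_order s5; move=> Ho.
have [|-> ->] := shows_unique e5 s5 Hs; first by lia.
by split=> //; lia.
Qed.

Lemma near_mode2 s t md e : (40 <= s)%N -> (2 ^ s + gap s <= t)%N -> (t + gap s <= 2 ^ s.+1)%N ->
  near_t s t md e -> e = s.+1 /\ md = false.
Proof.
move=> s40 Ht1 Ht2 [V [He H1 H2 Hs]].
have Q4 := quarter_half s.
have Hg : gap s = (8 * 2 ^ (s %/ 2))%N by rewrite /gap expnD mulnC.
have Hh : (2 ^ half_up s.+1 <= 2 * 2 ^ (s %/ 2))%N by rewrite -expnS leq_exp2l // /half_up; lia.
have Hl : (s <= 2 * 2 ^ (s %/ 2))%N.
  by have := ltn_expl (s %/ 2) (isT : (1 < 2)%N); lia.
have HV : (reset_2 s.+1 <= V < reset_1 s.+2)%N.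
  move: Ht1 Ht2 H1 H2 Hh Hl Q4; rewrite Hg /reset_1 /reset_2 /=.
  move: (2 ^ (s %/ 4))%N => x1; move: (2 ^ half_up s.+1)%N => x2; move: (2 ^ (s %/ 2))%N => x3; move: (2 ^ s.+1)%N => x4; move: (2 ^ s)%N => x5; lia.
have s5 : (5 <= s.+1)%N by lia.
have e5 : (5 <= e)%N by lia.
have := reset_order s5; move=> Ho.
have [|-> ->] := shows_unique e5 s5 Hs; first by lia.
by split=> //; lia.
Qed.

Lemma mode1_persists : ~ null (fun i => dens R (w i) v) -> ~ null (fun t => ca_push A p t u).
Proof.
move=> /not_null[e e_gt0 He] Hn.
have [n0 Hn0] := Hn (e / 16) ltac:(by rewrite divr_gt0).
have [b0 Hb0] := ratio_low v w_growing e_gt0.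
have [s0 Hs0] := emb_bounds.
pose E := (maxn s0 n0).+1.
have [i Hi Hd] := He (maxn b0 (i1 E)); rewrite geq_max in Hi; case/andP: Hi => Hi1 Hi2.
have [[|s] HsE Hi] := slow_surj (spec_slow1 spec) Hi2; first by rewrite /E in HsE.
rewrite /E ltnS geq_max in HsE; case/andP: HsE => h1 h2.
have [s40 _ Hb] := Hs0 s h1.
set t := (reset_1 s.+1 + 2 ^ (s %/ 4))%N.
have P4 : (s + 2 ^ (s %/ 4) < 2 ^ s)%N.
  have : (2 ^ (s %/ 4) <= 2 ^ s.-1)%N by rewrite leq_exp2l //; lia.
  have : (s.-1 < 2 ^ s.-1)%N by apply: ltn_expl.
  have : (2 ^ s = 2 * 2 ^ s.-1)%N by rewrite -expnS; congr (_ ^ _)%N; lia.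
  have := ltn_expl (s %/ 4) (isT : (1 < 2)%N).
  have : (2 ^ (s %/ 4) * 2 <= 2 ^ s.-1)%N by rewrite -expnSr leq_exp2l //; lia.
  have : (s.-1 * 2 <= 2 ^ s.-1)%N.
    have := ltn_expl s.-2 (isT : (1 < 2)%N).
    have : (2 ^ s.-1 = 2 * 2 ^ s.-2)%N by rewrite -expnS; congr (_ ^ _)%N; lia.
    lia.
  by lia.
have Ht : (2 ^ s <= t < 2 ^ s.+1)%N by rewrite /t /reset_1 /= expnS; lia.
have nt : (n0 <= t)%N by apply: leq_trans h2 _; apply: leq_trans (ltnW (ltn_expl s (isT : (1 < 2)%N))) _; case/andP: Ht.
have [_ Hl] := Hb t Ht.
have := Hn0 t nt; apply/negP; rewrite -leNgt.
have -> : e / 16 = (e / 8) / 2 by field.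
apply: Hl; first by rewrite divr_ge0 // ltW.
move=> md e1 /(near_mode1 s40)[-> ->]; rewrite /word_of Hi.
by apply: Hb0.
Qed.

Lemma mode2_shown : ~ null (fun i => dens R (w' i) v) -> exists2 eta : R, 0 < eta &
  forall s0, exists2 s, (s0 <= s)%N &
    forall t, (2 ^ s + gap s <= t)%N -> (t + gap s <= 2 ^ s.+1)%N -> eta <= ca_push A p t u.
Proof.
move=> /not_null[e e_gt0 He]; exists (e / 16); first by rewrite divr_gt0.
have [b0 Hb0] := ratio_low v w'_growing e_gt0.
have [s1 Hs1] := emb_bounds.
move=> s0; pose E := (maxn s1 s0).+1.
have [i Hi Hd] := He (maxn b0 (i2 E)); rewrite geq_max in Hi; case/andP: Hi => Hi1 Hi2.
have [[|s] HsE Hi] := slow_surj (spec_slow2 spec) Hi2; first by rewrite /E in HsE.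
rewrite /E ltnS geq_max in HsE; case/andP: HsE => h1 h2.
exists s => // t Ht1 Ht2.
have [s40 _ Hb] := Hs1 s h1.
have g0 : (0 < gap s)%N by rewrite expn_gt0.
have [|_ Hl] := Hb t; first by lia.
have -> : e / 16 = (e / 8) / 2 by field.
apply: Hl; first by rewrite divr_ge0 // ltW.
move=> md e1 /(near_mode2 s40 Ht1 Ht2)[-> ->]; rewrite /word_of Hi.
by apply: Hb0.
Qed.

Lemma mode2_hidden (eta : R) : null (fun i => dens R (w' i) v) -> 0 < eta -> exists s1,
  forall s t, (s1 <= s)%N -> (2 ^ s + gap s <= t)%N -> (t + gap s <= 2 ^ s.+1)%N -> ca_push A p t u <= eta.
Proof.
move=> H eta0; have e2 : 0 < eta / 2 by rewrite divr_gt0.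
have K2 := ev_index (spec_slow2 spec) (ratio_null w'_growing H e2).
have [s1 Hs1] := ev_and emb_bounds (ev_and (ev_inv 3 e2) K2).
exists s1 => s t /Hs1[[s40 _ Hb] [Hs k2]] Ht1 Ht2.
have g0 : (0 < gap s)%N by rewrite expn_gt0.
have [|Hu _] := Hb t; first by lia.
apply: le_trans (Hu (eta / 2) (ltW e2) _) _; last by lra.
by move=> md e1 /(near_mode2 s40 Ht1 Ht2)[-> ->]; apply: ltW; apply: k2; apply: leqnSn.
Qed.

Lemma mode2_persists : ~ null (fun i => dens R (w' i) v) -> ~ null (fun t => ca_push A p t u).
Proof.
move=> /mode2_shown[eta eta0 H] Hn; have [n0 Hn0] := Hn eta eta0.
have [s Hs Ht] := H (maxn n0 8).
have [h1 h2] : (n0 <= s)%N /\ (8 <= s)%N by lia.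
have Hg : (2 * gap s <= 2 ^ s)%N by rewrite /gap -expnS leq_exp2l //; lia.
have /Hn0 : (n0 <= 2 ^ s + gap s)%N.
  by apply: leq_trans (leq_addr _ _); apply: leq_trans h1 _; exact: ltnW (ltn_expl s _).
by rewrite ltNge Ht // expnS; lia.
Qed.

Lemma mean_null : null (fun i => dens R (w' i) v) -> null (mean (fun t => ca_push A p t u)).
Proof.
move=> H; apply: null_upper => e e_gt0; have e2 : 0 < e / 2 by rewrite divr_gt0.
have [s1 Hs1] := mode2_hidden H e2.
have := cesaro_upper (fun t => push_le1 t u) e2 Hs1.
by have -> : 2 * (e / 2) = e by field.
Qed.

Lemma mean_not_null : ~ null (fun i => dens R (w' i) v) -> ~ null (mean (fun t => ca_push A p t u)).
Proof.
move=> /mode2_shown[eta eta0 H].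
by apply: (cesaro_lower _ eta0 H) => t; exact: push_ge0.
Qed.

End Main.

Theorem limit_words (R : realType) (Q0 : finType) (w w' : nat -> seq Q0) :
  growing_computable w -> growing_computable w' ->
  exists (Q : finType) (emb : Q0 -> Q) (A : ca Q),
    injective emb /\
    forall p : Q -> R, full_bernoulli p ->
      forall u : seq Q,
        (persistent A p u <->
           exists2 v : seq Q0, u = map emb v & (Lw R w v \/ Lw R w' v)) /\
        (cesaro_persistent A p u <->
           exists2 v : seq Q0, u = map emb v & Lw R w' v).
Proof.
move=> gw gw'; have [Hw _] := gw; have [Hw' _] := gw'.
have [prog [start2 [c [e0 [i1 [i2 spec]]]]]] := program_exists gw gw'.
have [m1 [P1 Hok]] := instr_ok_exists prog.
pose m0 := maxn 2 m1; pose P := (maxn P1 (maxn start2 (size prog))).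
have m0_ge : (2 <= m0)%N by rewrite leq_maxl.
have prog_ok : all (instr_ok m0 P) prog.
  by apply: sub_all Hok => i; apply: instr_ok_mono; [apply: leq_maxr|apply: leq_maxl].
have start2_ok : (start2 <= P)%N by rewrite /P; lia.
have size_ok : (size prog <= P)%N by rewrite /P; lia.
exists (Q0 * option (cell Q0 m0 P))%type, (fun q => (q, None)), (automaton m0 P prog start2).
split; first by move=> a b [].
move=> p p_full u; rewrite persistentP // cesaroP //.
case: (boolP (has (fun q : Q0 * option (cell Q0 m0 P) => q.2 != None) u)) => Hu.
  have small := not_emb_small m0_ge prog_ok start2_ok size_ok spec Hw Hw' p_full Hu.
  have no v : u = [seq (q, None) | q <- v] -> False.
    by move=> E; move: Hu; rewrite E has_map => /hasP[q].
  have N1 : null (fun t => ca_push (automaton m0 P prog start2) p t u).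
    apply: null_upper => e e_gt0.
    have [n0 Hn0] := dyadic (small e e_gt0).
    by exists n0 => t /Hn0[].
  have N2 : null (mean (fun t => ca_push (automaton m0 P prog start2) p t u)).
    apply: null_upper => e e_gt0; have e2 : 0 < e / 2 by rewrite divr_gt0.
    have [s1 Hs1] := small _ e2.
    have -> : e = 2 * (e / 2) by field.
    apply: (@cesaro_upper _ _ _ _ s1) => // [t|s t Hs Ht1 Ht2].
    - exact: push_le1.
    - have g0 : (0 < gap s)%N by rewrite expn_gt0.
      by apply: (Hs1 s Hs); lia.
  by split; split => // -[v /no].
have Ev : u = [seq (q, None) | q <- map fst u].
  rewrite -map_comp -[LHS]map_id; apply/eq_in_map => -[a k] Hq /=.
  by have := hasPn Hu _ Hq; rewrite /= negbK => /eqP ->.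
have inj v : u = [seq (q, None) | q <- v] -> v = map fst u.
  by move=> ->; rewrite -map_comp map_id.
have M1 := mode1_persists m0_ge prog_ok start2_ok size_ok spec Hw Hw' p_full.
have M2 := mode2_persists m0_ge prog_ok start2_ok size_ok spec Hw Hw' p_full.
have M3 := push_null m0_ge prog_ok start2_ok size_ok spec Hw Hw' p_full.
have M4 := mean_null m0_ge prog_ok start2_ok size_ok spec Hw Hw' p_full.
have M5 := mean_not_null m0_ge prog_ok start2_ok size_ok spec Hw Hw' p_full.
split; split.
- move=> Hn; exists (map fst u) => //; apply: contrapT => /not_orP[/LwP h1 /LwP h2].
  by apply: Hn; rewrite Ev; apply: M3; apply: contrapT.
- by move=> [v -> [/LwP|/LwP]]; [apply: M1|apply: M2].
- move=> Hn; exists (map fst u) => //; apply/LwP => H; apply: Hn.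
  by rewrite Ev; apply: M4.
- by move=> [v -> /LwP]; apply: M5.
Qed.

Theorem theorem1 (R : realType) (Q0 : finType) :
  (forall w : nat -> seq Q0, growing_computable w ->
     exists (Q : finType) (emb : Q0 -> Q) (A : ca Q),
       injective emb /\
       forall p : Q -> R, full_bernoulli p ->
         forall u : seq Q,
           persistent A p u <-> exists2 v : seq Q0, u = map emb v & Lw R w v)
  /\
  (forall w w' : nat -> seq Q0, growing_computable w -> growing_computable w' ->
     exists (Q : finType) (emb : Q0 -> Q) (A : ca Q),
       injective emb /\
       forall p : Q -> R, full_bernoulli p ->
         forall u : seq Q,
           (persistent A p u <->
              exists2 v : seq Q0, u = map emb v & (Lw R w v \/ Lw R w' v)) /\
           (cesaro_persistent A p u <->
              exists2 v : seq Q0, u = map emb v & Lw R w' v)).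
Proof.
split=> [w gw|w w' gw gw']; last exact: limit_words.
(* The first part is the second with [w] shown in both modes. *)
have [Q [emb [A [Hinj H]]]] := limit_words R gw gw.
exists Q, emb, A; split=> // p Hp u; have [-> _] := H p Hp u.
by split=> -[v E]; [case|]; exists v => //; left.
Qed.
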